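(* Let $(M,g_0,\omega)$ be a K\''ahler-Einstein manifold of complex dimension $n$ with $\mathrm{Ric}(g_0)=\lambda g_0$. Construct a principal circle bundle over $(M,u_0g_0)$, $u_0>0$ a constant, with curvature $F=\omega$ and constant fiber volume ($f\equiv C$). Then the Ricci flow on the bundle is given by $g(t)=u(t)g_0$, $f_t=f(t)$ (constant on $M$ for each $t$), and the principal connection is preserved. Furthermore, $u(t),f(t)$ are the solutions to the following system of ODEs: $$u'(t) = -2\lambda + \frac{e^{-2f}}{u},\quad u(0)=u_0,\qquad f'(t)=\frac{n e^{-2f}}{2u^2},\quad f(0)=C.$$ Furthermore, if $\lambda=0$, then $$u(t)=e^{-2C/(n+2)}\,u_0^{n/(n+2)}\left[(n+2)t+e^{2C}u_0^2\right]^{1/(n+2)},$$ $$f(t)=\frac{n}{2(n+2)}\log\left((n+2)t+e^{2C}u_0^2\right)+\frac{2C}{n+2}-\frac{n}{n+2}\log(u_0).$$ If $\lambda\neq 0$, then $$\Psi(t)=e^{2f}\left(1-\frac{n+1}{2\lambda u e^{2f}}\right)^{n/(n+1)}$$ is constant.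
   Context: For a principal circle bundle $\pi:E\to M$ (one may alternatively use structure group $\mathbb R$), fix a generator of the one-dimensional Lie algebra and regard the principal connection $\mu$ and its curvature $F$ as real-valued forms; $F$ is viewed as a $2$-form on $M$ with $d\mu=\pi^*F$. Given a metric $g$ on $M$ and a function $f$ on $M$, the metric on $E$ is $\tilde g=\pi^*g+e^{-2f}\mu\otimes\mu$. ''The Ricci flow on the bundle'' means the solution $\tilde g(t)$ of $\partial_t\tilde g=-2\mathrm{Ric}(\tilde g)$ on $E$, with initial metric $\pi^*(u_0g_0)+e^{-2C}\mu\otimes\mu$; the assertion that it is given by $g(t)=u(t)g_0$, $f_t=f(t)$ with preserved connection means $\tilde g(t)=\pi^*(u(t)g_0)+e^{-2f(t)}\mu\otimes\mu$ with $\mu$ independent of $t$. The K\''ahler form $\omega$ is normalized by $\omega(X,Y)=g_0(JX,Y)$, up to sign, so that $g_0^{\lambda\nu}\omega_{\beta\lambda}\omega_{\gamma\nu}=(g_0)_{\beta\gamma}$. If the base of the power in $\Psi$ is negative, the power is understood as a complex power with a fixed branch. *)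

(* Defs.v *)
From HB Require Import structures.
From mathcomp Require Import all_boot all_order all_algebra.
From mathcomp Require Import all_classical all_reals all_analysis.
From mathcomp Require Import complex.

Set Implicit Arguments.
Unset Strict Implicit.
Unset Printing Implicit Defensive.

Import Order.TTheory GRing.Theory Num.Theory.
Import numFieldNormedType.Exports.

Local Open Scope classical_set_scope.
Local Open Scope ring_scope.

Fixpoint iter_partial (R : realType) (m : nat) (s : seq 'I_m)
    (f : 'rV[R]_m -> R) : 'rV[R]_m -> R :=
  if s is a :: s' then fun x => 'D_(delta_mx 0 a) (iter_partial s' f) x else f.

(* C^oo: all iterated partial derivatives exist and are continuous on U.
   Only used for open U. *)
Definition smooth_on (R : realType) (m : nat) (U : set 'rV[R]_m)
    (f : 'rV[R]_m -> R) : Prop :=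
  forall (s : seq 'I_m) x, U x ->
    {for x, continuous (iter_partial s f)} /\
    forall a : 'I_m, derivable (iter_partial s f) x (delta_mx 0 a).

(* The raw data of an atlas; the axioms are in [smooth_manifold].
   [param i] is the inverse of [coord i] on [dom i], and the values of both
   elsewhere are irrelevant.  [chart_at p] is a chosen chart around p. *)
Record atlas (R : realType) (m : nat) (M : topologicalType) := Atlas {
  chart_index : Type;
  chart_at : M -> chart_index;
  dom : chart_index -> set M;
  coord : chart_index -> M -> 'rV[R]_m;
  param : chart_index -> 'rV[R]_m -> M }.

Definition smooth_map (R : realType) (m k : nat) (M N : topologicalType)
    (A : atlas R m M) (B : atlas R k N) (U : set M) (F : M -> N) : Prop :=
  (forall p, U p -> {for p, continuous F}) /\
  forall (i : chart_index A) (j : chart_index B) (b : 'I_k),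
    smooth_on (coord i @` (dom i `&` U `&` F @^-1` dom j))
              (fun x => coord j (F (param i x)) 0 b).

Definition smooth_fun (R : realType) (m : nat) (M : topologicalType)
    (A : atlas R m M) (U : set M) (h : M -> R) : Prop :=
  forall i : chart_index A,
    smooth_on (coord i @` (dom i `&` U)) (h \o param i).

Definition smooth_manifold (R : realType) (m : nat) (M : topologicalType)
    (A : atlas R m M) : Prop :=
  [/\ hausdorff_space M,
      @second_countable M,
      forall p, dom (chart_at A p) p,
      forall i : chart_index A,
        [/\ open (dom i),
            open (coord i @` dom i),
            forall p, dom i p -> param i (coord i p) = p,
            forall p, dom i p -> {for p, continuous (coord i)} &
            forall p, dom i p -> {for coord i p, continuous (param i)}] &
      smooth_map A A setT id].

Definition prod_line_atlas (R : realType) (m : nat) (M : topologicalType)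
    (A : atlas R m M) : atlas R (m + 1) (M * R)%type :=
  Atlas (fun q : M * R => chart_at A q.1)
        (fun i => [set q : M * R | dom i q.1])
        (fun i q => row_mx (coord i q.1) (q.2)%:M)
        (fun i x => (param i (lsubmx x), rsubmx x 0 0)).

(* The tangent space at a point of [dom i] is identified with row vectors via
   the coordinate frame of the chart i; matrices of differentials act on the
   right. *)

(* The derivative of h along the a-th coordinate vector field of the chart i. *)
Definition pd (R : realType) (m : nat) (M : topologicalType)
    (A : atlas R m M) (i : chart_index A) (a : 'I_m) (h : M -> R) (p : M) : R :=
  'D_(delta_mx 0 a) (h \o param i) (coord i p).

Definition jac (R : realType) (m k : nat) (M N : topologicalType)
    (A : atlas R m M) (B : atlas R k N) (i : chart_index A) (j : chart_index B)
    (F : M -> N) (p : M) : 'M[R]_(m, k) :=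
  \matrix_(a, b) pd i a (fun q => coord j (F q) 0 b) p.

(* [t i p] holds the components at p in the chart i, for p in [dom i]. *)
Definition field1 (R : realType) (m : nat) (M : topologicalType)
    (A : atlas R m M) : Type := chart_index A -> M -> 'cV[R]_m.

Definition field2 (R : realType) (m : nat) (M : topologicalType)
    (A : atlas R m M) : Type := chart_index A -> M -> 'M[R]_m.

Definition pullback1 (R : realType) (m k : nat) (M N : topologicalType)
    (A : atlas R m M) (B : atlas R k N) (F : M -> N) (t : field1 B) :
    field1 A :=
  fun i p => let j := chart_at B (F p) in jac i j F p *m t j (F p).

Definition pullback2 (R : realType) (m k : nat) (M N : topologicalType)
    (A : atlas R m M) (B : atlas R k N) (F : M -> N) (t : field2 B) :
    field2 A :=
  fun i p => let j := chart_at B (F p) in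
             jac i j F p *m t j (F p) *m (jac i j F p)^T.

Definition eq_field1 (R : realType) (m : nat) (M : topologicalType)
    (A : atlas R m M) (t t' : field1 A) : Prop :=
  forall i p, dom i p -> t i p = t' i p.

Definition eq_field2 (R : realType) (m : nat) (M : topologicalType)
    (A : atlas R m M) (t t' : field2 A) : Prop :=
  forall i p, dom i p -> t i p = t' i p.

Definition one_form (R : realType) (m : nat) (M : topologicalType)
    (A : atlas R m M) (t : field1 A) : Prop :=
  (forall i j p, dom i p -> dom j p -> t i p = jac i j id p *m t j p) /\
  (forall i a, smooth_on (coord i @` dom i) (fun x => t i (param i x) a 0)).

Definition tensor2 (R : realType) (m : nat) (M : topologicalType)
    (A : atlas R m M) (t : field2 A) : Prop :=
  (forall i j p, dom i p -> dom j p ->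
     t i p = jac i j id p *m t j p *m (jac i j id p)^T) /\
  (forall i a b, smooth_on (coord i @` dom i) (fun x => t i (param i x) a b)).

Definition riemannian_metric (R : realType) (m : nat) (M : topologicalType)
    (A : atlas R m M) (g : field2 A) : Prop :=
  [/\ tensor2 g,
      forall i p, dom i p -> (g i p)^T = g i p &
      forall i p (v : 'rV[R]_m), dom i p -> v != 0 ->
        0 < (v *m g i p *m v^T) 0 0].

(* d mu (X, Y) = X (mu Y) - Y (mu X) - mu [X, Y], without a factor 1/2. *)
Definition ext_deriv1 (R : realType) (m : nat) (M : topologicalType)
    (A : atlas R m M) (t : field1 A) : field2 A :=
  fun i p => \matrix_(a, b)
    (pd i a (fun q => t i q b 0) p - pd i b (fun q => t i q a 0) p).

Definition closed_form2 (R : realType) (m : nat) (M : topologicalType)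
    (A : atlas R m M) (t : field2 A) : Prop :=
  forall i p a b c, dom i p ->
    pd i a (fun q => t i q b c) p + pd i b (fun q => t i q c a) p
    + pd i c (fun q => t i q a b) p = 0.

(* The Christoffel symbol Gamma^c_{ab} of the Levi-Civita connection. *)
Definition christoffel (R : realType) (m : nat) (M : topologicalType)
    (A : atlas R m M) (g : field2 A) (i : chart_index A) (c a b : 'I_m)
    (p : M) : R :=
  2^-1 * \sum_(d < m) invmx (g i p) c d *
    (pd i a (fun q => g i q d b) p + pd i b (fun q => g i q a d) p
     - pd i d (fun q => g i q a b) p).

(* The d-th component of R(e_a, e_b) e_c, where
   R(X, Y) Z = D_X D_Y Z - D_Y D_X Z - D_[X,Y] Z. *)
Definition riemann (R : realType) (m : nat) (M : topologicalType)
    (A : atlas R m M) (g : field2 A) (i : chart_index A) (d a b c : 'I_m)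
    (p : M) : R :=
  pd i a (christoffel g i d b c) p - pd i b (christoffel g i d a c) p
  + \sum_(e < m) (christoffel g i d a e p * christoffel g i e b c p
                  - christoffel g i d b e p * christoffel g i e a c p).

(* Ric(Y, Z) = tr (X |-> R(X, Y) Z); round spheres have positive Ric. *)
Definition ricci (R : realType) (m : nat) (M : topologicalType)
    (A : atlas R m M) (g : field2 A) : field2 A :=
  fun i p => \matrix_(b, c) \sum_(a < m) riemann g i a a b c p.

Definition scale2 (R : realType) (m : nat) (M : topologicalType)
    (A : atlas R m M) (c : R) (t : field2 A) : field2 A :=
  fun i p => c *: t i p.

Definition einstein (R : realType) (m : nat) (M : topologicalType)
    (A : atlas R m M) (g : field2 A) (lam : R) : Prop :=
  eq_field2 (ricci g) (scale2 lam g).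

(* The coordinates z_k = x_k + i y_k of C^n are stored as (x, y); on row
   vectors, v *m J0 is the product of v by the imaginary unit. *)
Definition J0 (R : realType) (n : nat) : 'M[R]_(n + n) :=
  block_mx 0 1%:M (- 1%:M) 0.

(* The second condition is the Cauchy-Riemann equations for the transition
   maps. *)
Definition complex_manifold (R : realType) (n : nat) (M : topologicalType)
    (A : atlas R (n + n) M) : Prop :=
  smooth_manifold A /\
  forall (i j : chart_index A) p, dom i p -> dom j p ->
    jac i j id p *m J0 R n = J0 R n *m jac i j id p.

(* omega (X, Y) = + g (J X, Y) or - g (J X, Y), according to the sign
   convention in use. *)
Definition kahler_manifold (R : realType) (n : nat) (M : topologicalType)
    (A : atlas R (n + n) M) (g omega : field2 A) : Prop :=
  [/\ complex_manifold A,
      riemannian_metric g,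
      eq_field2 (fun i p => J0 R n *m g i p *m (J0 R n)^T) g,
      eq_field2 omega (fun i p => J0 R n *m g i p) \/
      eq_field2 omega (fun i p => - (J0 R n *m g i p)) &
      closed_form2 omega].

(* Principal bundle with structure group R / ell Z: the circle if ell > 0, the
   real line if ell = 0.  An action of this group is an action of R for which
   ell Z acts trivially; the generator of the Lie algebra is d/d theta.  The
   last condition is local triviality: (q, theta) |-> act theta (sigma q) is
   smooth, and its inverse e |-> (proj e, theta e mod ell) is smooth. *)
Definition principal_bundle (R : realType) (m k : nat) (M E : topologicalType)
    (A : atlas R m M) (B : atlas R k E) (ell : R) (proj : E -> M)
    (act : R -> E -> E) : Prop :=
  [/\ smooth_map B A setT proj,
      smooth_map (prod_line_atlas B) B setT (fun q : E * R => act q.2 q.1),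
      (forall e, act 0 e = e) /\
        (forall s t e, act (s + t) e = act s (act t e)),
      (forall e e', proj e = proj e' <-> exists theta, e' = act theta e) /\
        (forall theta e, act theta e = e <-> exists z : int, theta = z%:~R * ell) &
      forall p : M, exists (U : set M) (sigma : M -> E),
        [/\ open U, U p, smooth_map A B U sigma,
            forall q, U q -> proj (sigma q) = q &
            forall e, U (proj e) -> exists (W : set E) (theta : E -> R),
              [/\ open W, W e, smooth_fun B W theta &
                  forall e', W e' -> U (proj e') /\
                    act (theta e') (sigma (proj e')) = e']]].

Definition fundamental_field (R : realType) (k : nat) (E : topologicalType)
    (B : atlas R k E) (act : R -> E -> E) (i : chart_index B) (e : E) :
    'rV[R]_k :=
  \row_b 'D_1 (fun theta : R => coord i (act theta e) 0 b) 0.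

Definition principal_connection (R : realType) (k : nat) (E : topologicalType)
    (B : atlas R k E) (act : R -> E -> E) (mu : field1 B) : Prop :=
  [/\ one_form mu,
      forall i e, dom i e -> (fundamental_field act i e *m mu i e) 0 0 = 1 &
      forall theta, eq_field1 (pullback1 (act theta) mu) mu].

Definition has_curvature (R : realType) (m k : nat) (M E : topologicalType)
    (A : atlas R m M) (B : atlas R k E) (proj : E -> M) (mu : field1 B)
    (F : field2 A) : Prop :=
  eq_field2 (ext_deriv1 mu) (pullback2 proj F).

Definition bundle_metric (R : realType) (m k : nat) (M E : topologicalType)
    (A : atlas R m M) (B : atlas R k E) (proj : E -> M) (mu : field1 B)
    (g : field2 A) (f : M -> R) : field2 B :=
  fun i e => pullback2 proj g i e
             + expR (- (2 * f (proj e))) *: (mu i e *m (mu i e)^T).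

Definition before (R : realType) (T : \bar R) : set R :=
  [set t : R | 0 <= t /\ (t%:E < T)%E].

(* phi'(t) = l, as a function on [0, T) (right derivative at t = 0). *)
Definition time_deriv (R : realType) (T : \bar R) (phi : R -> R) (t l : R) :
    Prop :=
  (phi s - phi t) / (s - t) @[s --> within (before T) t^'] --> l.

Definition ricci_flow (R : realType) (m : nat) (E : topologicalType)
    (B : atlas R m E) (T : \bar R) (h : field2 B) (G : R -> field2 B) : Prop :=
  [/\ forall t, before T t -> riemannian_metric (G t),
      eq_field2 (G 0) h &
      forall t i e a b, before T t -> dom i e ->
        time_deriv T (fun s => G s i e a b) t (- 2 * ricci (G t) i e a b)].

Definition ode_solution (R : realType) (n : nat) (lam u0 C : R) (T : \bar R)
    (u f : R -> R) : Prop :=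
  [/\ u 0 = u0, f 0 = C &
      forall t, before T t ->
        [/\ 0 < u t,
            time_deriv T u t (- 2 * lam + expR (- 2 * f t) / u t) &
            time_deriv T f t (n%:R * expR (- 2 * f t) / (2 * u t ^+ 2))]].

(* b ^ q for real b and q, with the branch arg b = (2 z + 1) pi for b < 0. *)
Definition branch_pow (R : realType) (z : int) (b q : R) : R[i] :=
  if 0 <= b then Complex (b `^ q) 0
  else let theta := q * ((2 * z + 1)%:~R * pi) in
       Complex (`|b| `^ q * cos theta) (`|b| `^ q * sin theta).

Definition Psi (R : realType) (n : nat) (lam : R) (z : int) (u f : R -> R)
    (t : R) : R[i] :=
  (Complex (expR (2 * f t)) 0
   * branch_pow z (1 - n.+1%:R / (2 * lam * u t * expR (2 * f t)))
                (n%:R / n.+1%:R))%R.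

(* Main.v *)
(* In the frame dual to [mu] and the differential J of the projection, the metric
   [u J g0 J^T + w mu mu^T], [w = e^(-2 f)], has constant coefficients relative to
   g0, and Koszul's formula expresses its Levi-Civita connection through that of
   g0, the curvature omega and mu.  Since omega is parallel and
   [omega^2 = - 1] with respect to g0, contracting the curvature gives
     [Ric = (lam - w / (2 u)) pi^* g0 + (n w^2 / (2 u^2)) mu (x) mu],
   which is again of the same shape.  Comparing horizontal and vertical components,
   the flow equation is equivalent to the system of ODEs.  This system has the first
   integral [(1 / u - 2 lam / (n + 1) e^(2 f)) e^(2 f / n)], which makes 1 / u a
   function of f, reduces the system to an equation [f' = F f] with [F >= 0], and
   yields both the explicit solution for [lam = 0] and the invariance of Psi. *)

Require Import Defs.
From HB Require Import structures.
From mathcomp Require Import all_boot all_order all_algebra.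
From mathcomp Require Import all_classical all_reals all_analysis.
From mathcomp Require Import complex.
From mathcomp Require Import ring lra.

Set Implicit Arguments.
Unset Strict Implicit.
Unset Printing Implicit Defensive.

Import Order.TTheory GRing.Theory Num.Theory.
Import numFieldNormedType.Exports.

Local Open Scope classical_set_scope.
Local Open Scope ring_scope.

(* [coord] would otherwise denote [vector.coord]. *)
Import Defs.

(** * Differentiability and smoothness in coordinates *)

Lemma is_derive_line (R : numFieldType) (V W : normedModType R) (f : V -> W)
    (x v : V) (s : R) :
  derivable f (s *: v + x) v ->
  is_derive s 1 (fun t : R => f (t *: v + x)) ('D_v f (s *: v + x)).
Proof.
have E : (fun h => h^-1 *: (((fun t : R => f (t *: v + x)) \o shift s) (h *: 1)
            - f (s *: v + x))) =
         (fun h => h^-1 *: ((f \o shift (s *: v + x)) (h *: v)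
            - f (s *: v + x))).
  by apply/funext => h /=; rewrite [h *: 1]mulr1 scalerDl addrA.
by move=> df; apply: DeriveDef; rewrite /derivable /derive E.
Qed.

Lemma MVT_line (R : realType) (V : normedModType R) (f : V -> R) (x v : V)
    (t : R) :
  (forall s, `|s| <= `|t| -> derivable f (s *: v + x) v) ->
  exists2 c, `|c| <= `|t| & f (t *: v + x) - f x = t * 'D_v f (c *: v + x).
Proof.
move=> df; pose g s := f (s *: v + x).
have gder (s : R) : `|s| <= `|t| -> is_derive s 1 g ('D_v f (s *: v + x)).
  by move=> /df; exact: is_derive_line.
have gcont a b : `|a| <= `|t| -> `|b| <= `|t| -> {within `[a, b], continuous g}.
  move=> ha hb; apply: derivable_within_continuous => z; rewrite in_itv/=.
  move=> /andP[az zb]; have [|//] := gder z.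
  move: ha hb; rewrite !ler_norml => /andP[ha _] /andP[_ hb].
  by rewrite (le_trans ha az) (le_trans zb hb).
have g0 : g 0 = f x by rewrite /g scale0r add0r.
have [t0|t0] := leP 0 t.
- have [||c] := @MVT_segment R g (fun s => 'D_v f (s *: v + x)) 0 t t0.
  + move=> z; rewrite in_itv/= => /andP[z0 zt]; apply: gder.
    by rewrite !ger0_norm// ltW.
  + by apply: gcont; rewrite ?normr0.
  + rewrite in_itv/= => /andP[c0 ct]; rewrite g0 subr0 [_ * t]mulrC => E.
    by exists c => //; rewrite !ger0_norm.
- have [||c] := @MVT_segment R g (fun s => 'D_v f (s *: v + x)) t 0 (ltW t0).
  + move=> z; rewrite in_itv/= => /andP[tz z0]; apply: gder.
    by rewrite !ltr0_norm// lerN2 ltW.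
  + by apply: gcont; rewrite ?normr0.
  + rewrite in_itv/= => /andP[tc c0]; rewrite g0 sub0r.
    move=> /(congr1 -%R); rewrite opprB mulrN opprK mulrC => E.
    by exists c; [rewrite !ler0_norm ?lerN2// ltW | exact: E].
Qed.

Lemma bound_differentiable (R : numFieldType) (V W : normedModType R)
    (f : V -> W) (x : V) (L : {linear V -> W}) :
  continuous L ->
  (forall e, 0 < e -> \forall h \near (0 : V),
     `|f (h + x) - f x - L h| <= e * `|h|) ->
  differentiable f x.
Proof.
move=> Lc H.
have E : f \o shift x = cst (f x) + L +o_ 0 id.
  apply: eqaddoE; apply/eqaddoP => e e0; near=> h.
  rewrite [X in `|X|](_ : _ = f (h + x) - f x - L h).
    by near: h; exact: H.
  by rewrite -addrA -opprD.
by apply/diff_locallyP; split; rewrite (diff_unique Lc E).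
Unshelve. all: by end_near. Qed.

Lemma differentiable_row_bound (R : numFieldType) (m : nat) (f : 'rV[R]_m -> R)
    (x : 'rV[R]_m) (d : 'I_m -> R) :
  (forall e, 0 < e -> \forall h \near (0 : 'rV[R]_m),
     `|f (h + x) - f x - \sum_a h 0 a * d a| <= e * `|h|) ->
  differentiable f x.
Proof.
move=> H.
pose l (h : 'rV[R]_m) : R := \sum_a h 0 a * d a.
have l_lin : linear l.
  move=> k u v; rewrite /l scaler_sumr -big_split/=; apply: eq_bigr => a _.
  by rewrite !mxE mulrDl /GRing.scale /= mulrA.
pose llM := GRing.isLinear.Build _ _ _ _ _ l_lin.
pose L : {linear 'rV[R]_m -> R} := HB.pack l llM.
apply: (@bound_differentiable _ _ _ _ _ L) => // y.
apply: differentiable_continuous.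
rewrite (_ : (L : _ -> _) = \sum_a (fun h : 'rV[R]_m => h 0 a * d a)); last first.
  by apply/funext => h /=; rewrite fct_sumE.
apply: differentiable_sum => a; apply: differentiableM => //.
exact: differentiable_coord.
Qed.

Lemma near_norm (R : numFieldType) (V : normedModType R) (x : V) (P : V -> Prop) :
  (\forall y \near x, P y) ->
  exists2 r, 0 < r & forall y, `|y - x| < r -> P y.
Proof.
move=> /nbhs_ballP[r /= r0 H]; exists r; first exact: r0.
by move=> y yx; apply: H; rewrite -ball_normE /= distrC.
Qed.

Lemma norm_delta_row (R : realType) (m : nat) (a : 'I_m) :
  `|delta_mx 0 a : 'rV[R]_m| = 1.
Proof.
rewrite /Num.norm/= mx_normrE; apply/le_anti/andP; split.
  apply/bigmax_leP; split=> // -[i j] _ /=; rewrite mxE.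
  by case: (_ && _); rewrite ?normr1 ?normr0.
by apply/bigmax_geP; right; exists (0, a); rewrite //= mxE !eqxx normr1.
Qed.

Lemma ler_coord_norm (R : realType) (m : nat) (h : 'rV[R]_m) a :
  `|h 0 a| <= `|h|.
Proof.
rewrite {2}/Num.norm/= mx_normrE.
by apply/bigmax_geP; right; exists (0, a).
Qed.

Lemma continuous_partial_differentiable (R : realType) (m : nat)
    (f : 'rV[R]_m -> R) (x : 'rV[R]_m) :
  (forall a : 'I_m, \forall y \near x, derivable f y (delta_mx 0 a)) ->
  (forall a : 'I_m, {for x, continuous ('D_(delta_mx 0 a) f)}) ->
  differentiable f x.
Proof.
move=> df cf; apply: (@differentiable_row_bound _ _ _ _ (fun a => 'D_(delta_mx 0 a) f x)).
pose tr (s : seq 'I_m) (h : 'rV[R]_m) := \sum_(a <- s) h 0 a *: (delta_mx 0 a : 'rV[R]_m).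
have tr_le s h : `|tr s h| <= (size s)%:R * `|h|.
  rewrite /tr; elim: s => [|a s IHs]; first by rewrite big_nil normr0 mul0r.
  rewrite big_cons /= -natr1 mulrDl mul1r addrC (le_trans (ler_normD _ _))//.
  by rewrite lerD// normrZ norm_delta_row mulr1 ler_coord_norm.
suff H s e : 0 < e -> \forall h \near (0 : 'rV[R]_m),
    `|f (tr s h + x) - f x - \sum_(a <- s) h 0 a * 'D_(delta_mx 0 a) f x| <= e * `|h|.
  move=> e e0; apply: filterS (H (index_enum 'I_m) e e0) => h.
  by rewrite /tr -row_sum_delta.
elim: s e => [|a s IHs] e e0.
  by near=> h; rewrite /tr !big_nil add0r subrr subr0 normr0 mulr_ge0// ltW.
have e20 : 0 < e / 2 by rewrite divr_gt0.
have [/= r r0 Hr] : exists2 r, 0 < r & forall y, `|y - x| < r ->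
    derivable f y (delta_mx 0 a) /\
    `|'D_(delta_mx 0 a) f y - 'D_(delta_mx 0 a) f x| <= e / 2.
  have : \forall y \near x, derivable f y (delta_mx 0 a) /\
      `|'D_(delta_mx 0 a) f y - 'D_(delta_mx 0 a) f x| <= e / 2.
    near=> y; split; first by near: y; exact: df.
    near: y; move: (cf a) => /cvgrPdist_le /(_ _ e20).
    by apply: filterS => y; rewrite distrC.
  exact: near_norm.
have := IHs _ e20; move=> H; near=> h.
have hh : `|h 0 a| <= `|h| by exact: ler_coord_norm.
have hr : (size s).+1%:R * `|h| < r.
  rewrite mulrC -ltr_pdivlMr//.
  near: h; apply/nbhs_ballP; exists (r / (size s).+1%:R) => /=.
    by rewrite divr_gt0.
  by move=> h; rewrite -ball_normE /= sub0r normrN.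
have hs c : `|c| <= `|h 0 a| -> `|c *: (delta_mx 0 a : 'rV[R]_m) + (tr s h + x) - x| < r.
  move=> ch; apply: le_lt_trans hr; rewrite addrA addrK -natr1 mulrDl mul1r addrC.
  rewrite (le_trans (ler_normD _ _))// lerD//.
  by rewrite normrZ norm_delta_row mulr1 (le_trans ch).
have [|c ch] := @MVT_line R _ f (tr s h + x) (delta_mx 0 a) (h 0 a).
  by move=> c /hs /Hr[].
have [_] := Hr _ (hs _ ch).
rewrite /tr !big_cons -/(tr s h) addrA.
set D := 'D__ _ _; set D' := 'D__ _ _ => DD E.
have -> : f (h 0 a *: delta_mx 0 a + tr s h + x) = f (tr s h + x) + h 0 a * D.
  by move: E => /(canRL (subrK _)); rewrite addrA => ->; exact: addrC.
have -> : f (tr s h + x) + h 0 a * D - f x -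
   (h 0 a * D' + \sum_(j <- s) h 0 j * 'D_(delta_mx 0 j) f x) =
  h 0 a * (D - D') + (f (tr s h + x) - f x - \sum_(j <- s) h 0 j * 'D_(delta_mx 0 j) f x).
  by ring.
rewrite (le_trans (ler_normD _ _))// [e]splitr mulrDl lerD//; last first.
  by near: h; exact: H.
by rewrite normrM mulrC ler_pM.
Unshelve. all: by end_near. Qed.

Lemma row_differentiable (R : realType) (V : normedModType R) (k : nat)
    (phi : V -> 'rV[R]_k) (x : V) :
  (forall b, differentiable (fun y => phi y 0 b) x) -> differentiable phi x.
Proof.
move=> H; rewrite (_ : phi = \sum_b (fun y => phi y 0 b *: delta_mx 0 b)).
  by apply: differentiable_sum => b; apply: differentiableZl.
by apply/funext => y; rewrite fct_sumE [LHS]row_sum_delta.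
Qed.

Lemma chain_differentiable (R : realType) (V : normedModType R) (k : nat)
    (phi : V -> 'rV[R]_k) (h : 'rV[R]_k -> R) (x : V) :
  (forall b, differentiable (fun y => phi y 0 b) x) ->
  differentiable h (phi x) -> differentiable (h \o phi) x.
Proof. by move=> Hp Hh; apply: differentiable_comp => //; exact: row_differentiable. Qed.

Lemma chain_derive (R : realType) (V : normedModType R) (k : nat)
    (phi : V -> 'rV[R]_k) (h : 'rV[R]_k -> R) (x v : V) :
  (forall b, differentiable (fun y => phi y 0 b) x) ->
  differentiable h (phi x) ->
  'D_v (h \o phi) x =
  \sum_b 'D_v (fun y => phi y 0 b) x * 'D_(delta_mx 0 b) h (phi x).
Proof.
move=> Hp Hh; have dphi := row_differentiable Hp.
rewrite deriveE; last exact: differentiable_comp.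
rewrite (diff_comp dphi Hh) /= -(deriveE v dphi) derive_mx; last exact: diff_derivable.
set r := \matrix_(i, j) _.
rewrite [r]row_sum_delta linear_sum /=; apply: eq_bigr => b _.
by rewrite linearZ /= -deriveE// mxE.
Qed.

Section SmoothOn.
Variables (R : realType) (m : nat).
Implicit Types (U : set 'rV[R]_m) (f g : 'rV[R]_m -> R).

Lemma smooth_on_continuous U f x : smooth_on U f -> U x -> {for x, continuous f}.
Proof. by move=> /(_ [::] x) H /H[]. Qed.

Lemma iter_partial_rcons s a f :
  iter_partial (rcons s a) f = iter_partial s ('D_(delta_mx 0 a) f).
Proof. by elim: s => //= b s ->. Qed.

Lemma smooth_on_partial U f a : smooth_on U f -> smooth_on U ('D_(delta_mx 0 a) f).
Proof. by move=> H s x Ux; rewrite -iter_partial_rcons; exact: H. Qed.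

Lemma smooth_on_differentiable U f x :
  open U -> smooth_on U f -> U x -> differentiable f x.
Proof.
move=> Uo Hf Ux; apply: continuous_partial_differentiable => a.
  by apply: filterS (open_nbhs_nbhs (conj Uo Ux)) => y /(Hf [::])[].
exact: (smooth_on_continuous (smooth_on_partial a Hf) Ux).
Qed.

Lemma smooth_on_subset U V f : V `<=` U -> smooth_on U f -> smooth_on V f.
Proof. by move=> VU Hf s x /VU; exact: Hf. Qed.

End SmoothOn.

Section SmoothClosure.
Variables (R : realType) (m : nat).
Implicit Types (U : set 'rV[R]_m) (f g : 'rV[R]_m -> R).

(* Visibly closed under partial derivatives, so that no Leibniz or Faa di Bruno
   formula for iterated partial derivatives is needed. *)
Inductive smooth_closure U : ('rV[R]_m -> R) -> Prop :=
| Sc_smooth f : smooth_on U f -> smooth_closure U f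
| Sc_cst c : smooth_closure U (fun=> c)
| Sc_add f g : smooth_closure U f -> smooth_closure U g ->
    smooth_closure U (fun x => f x + g x)
| Sc_mul f g : smooth_closure U f -> smooth_closure U g ->
    smooth_closure U (fun x => f x * g x)
| Sc_inv f : smooth_closure U f -> (forall x, U x -> f x != 0) ->
    smooth_closure U (fun x => (f x)^-1)
| Sc_comp k (V : set 'rV[R]_k) h (phi : 'rV[R]_m -> 'rV[R]_k) :
    open V -> smooth_on V h -> (forall b, smooth_closure U (fun x => phi x 0 b)) ->
    (forall x, U x -> V (phi x)) -> smooth_closure U (fun x => h (phi x))
| Sc_ext f g : smooth_closure U f -> (forall x, U x -> f x = g x) ->
    smooth_closure U g.

Lemma smooth_closure_sum U (I : Type) (r : seq I) (P : pred I) (F : I -> 'rV[R]_m -> R) :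
  (forall i, P i -> smooth_closure U (F i)) ->
  smooth_closure U (fun x => \sum_(i <- r | P i) F i x).
Proof.
move=> H; elim: r => [|i r IHr].
  by apply: (Sc_ext (Sc_cst U 0)) => x _; rewrite big_nil.
have [Pi|Pi] := boolP (P i).
  by apply: (Sc_ext (Sc_add (H _ Pi) IHr)) => x _; rewrite big_cons Pi.
by apply: (Sc_ext IHr) => x _; rewrite big_cons (negbTE Pi).
Qed.

Lemma smooth_closure_prod U (I : Type) (r : seq I) (P : pred I) (F : I -> 'rV[R]_m -> R) :
  (forall i, P i -> smooth_closure U (F i)) ->
  smooth_closure U (fun x => \prod_(i <- r | P i) F i x).
Proof.
move=> H; elim: r => [|i r IHr].
  by apply: (Sc_ext (Sc_cst U 1)) => x _; rewrite big_nil.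
have [Pi|Pi] := boolP (P i).
  by apply: (Sc_ext (Sc_mul (H _ Pi) IHr)) => x _; rewrite big_cons Pi.
by apply: (Sc_ext IHr) => x _; rewrite big_cons (negbTE Pi).
Qed.

Lemma eq_on_differentiable U f g x : open U -> U x ->
  (forall y, U y -> f y = g y) -> differentiable f x -> differentiable g x.
Proof.
move=> Uo Ux fg df.
have nfg : \forall y \near x, f y = g y by exact: filterS (open_nbhs_nbhs (conj Uo Ux)).
apply: (@bound_differentiable _ _ _ _ _ ('d f x)); first exact: diff_continuous.
move=> e e0.
have /eqaddoP/(_ e e0) H := diff_locally df.
have : \forall h \near (0 : 'rV[R]_m), f (h + x) = g (h + x).
  by move: nfg; rewrite (near_shift 0 x)/=; apply: filterS => h; rewrite subr0.
move: H.
apply: filterS2 => h H fgh; rewrite -fgh -fg// -addrA -opprD.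
exact: H.
Qed.

Lemma eq_on_derive U f g x v : open U -> U x ->
  (forall y, U y -> f y = g y) -> 'D_v f x = 'D_v g x.
Proof.
move=> Uo Ux fg; apply: near_eq_derive.
exact: filterS (open_nbhs_nbhs (conj Uo Ux)).
Qed.

Lemma smooth_closure_differentiable U f x : open U -> smooth_closure U f -> U x ->
  differentiable f x.
Proof.
move=> Uo Hf Ux; elim: Hf => {f} [f Hf|c|f g _ df _ dg|f g _ df _ dg|f _ df f0|
  k V h phi Vo Hh _ dphi UV|f g _ df fg].
- exact: smooth_on_differentiable Hf Ux.
- exact: differentiable_cst.
- exact: differentiableD.
- exact: differentiableM.
- by apply: differentiableV => //; exact: f0.
- apply: (@chain_differentiable _ _ _ phi h) => //.
  exact: (smooth_on_differentiable Vo Hh (UV _ Ux)).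
- exact: eq_on_differentiable fg df.
Qed.

Lemma smooth_closure_derive U f a : open U -> smooth_closure U f ->
  smooth_closure U ('D_(delta_mx 0 a) f).
Proof.
move=> Uo Hf; have D := smooth_closure_differentiable Uo.
elim: Hf => {f} [f Hf|c|f g Hf df Hg dg|f g Hf df Hg dg|f Hf df f0|
  k V h phi Vo Hh Hphi dphi UV|f g Hf df fg].
- exact/Sc_smooth/smooth_on_partial.
- by apply: (Sc_ext (Sc_cst U 0)) => x _; rewrite derive_cst.
- apply: (Sc_ext (Sc_add df dg)) => x Ux.
  by rewrite deriveD//; apply: diff_derivable; exact: D.
- apply: (Sc_ext (Sc_add (Sc_mul Hf dg) (Sc_mul Hg df))) => x Ux.
  by rewrite deriveM//; apply: diff_derivable; exact: D.
- apply: (Sc_ext (Sc_mul (Sc_mul (Sc_cst U (-1)) df)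
    (Sc_mul (Sc_inv Hf f0) (Sc_inv Hf f0)))) => x Ux.
  rewrite deriveV ?f0//; last by apply: diff_derivable; exact: D.
  by rewrite /GRing.scale /= expr2 invfM mulN1r mulNr mulrC mulNr.
- have H b : smooth_closure U (fun x => 'D_(delta_mx 0 a) (fun y => phi y 0 b) x *
      'D_(delta_mx 0 b) h (phi x)).
    exact: (Sc_mul (dphi b) (Sc_comp Vo (smooth_on_partial b Hh) Hphi UV)).
  apply: (Sc_ext (@smooth_closure_sum U _ (index_enum 'I_k) xpredT _ (fun b _ => H b))).
  move=> x Ux /=; rewrite (@chain_derive _ _ _ phi h)//; last first.
    exact: (smooth_on_differentiable Vo Hh (UV _ Ux)).
  by move=> b; exact: D.
- by apply: (Sc_ext df) => x Ux; exact: eq_on_derive fg.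
Qed.

Lemma smooth_closureP U f : open U -> smooth_closure U f -> smooth_on U f.
Proof.
move=> Uo Hf s; have : smooth_closure U (iter_partial s f).
  by elim: s => //= a s IHs; exact: smooth_closure_derive.
move=> Hs x Ux; have Ds := smooth_closure_differentiable Uo Hs Ux.
by split=> [|a]; [exact: differentiable_continuous | exact: diff_derivable].
Qed.

End SmoothClosure.

Lemma is_derive_translate (R : numFieldType) (V W : normedModType R) (f : V -> W)
    (z y v : V) :
  derivable f (z + y) v -> is_derive y v (fun p => f (z + p)) ('D_v f (z + y)).
Proof.
have E : (fun h : R => h^-1 *: (((fun p => f (z + p)) \o shift y) (h *: v)
            - f (z + y))) =
         (fun h => h^-1 *: ((f \o shift (z + y)) (h *: v) - f (z + y))).
  by apply/funext => h /=; rewrite addrCA.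
by move=> df; apply: DeriveDef; rewrite /derivable /derive E.
Qed.

Lemma second_difference (R : realType) (V : normedModType R) (f : V -> R)
    (x v w : V) (r h : R) :
  (forall y, `|y - x| < r -> derivable f y v /\ derivable ('D_v f) y w) ->
  0 <= h -> h * (`|v| + `|w|) < r ->
  exists2 p, `|p - x| <= h * (`|v| + `|w|) &
    f (h *: w + (h *: v + x)) - f (h *: v + x) - (f (h *: w + x) - f x) =
    h * (h * 'D_w ('D_v f) p).
Proof.
move=> H h0 hr.
have bnd (s t : R) : `|s| <= `|h| -> `|t| <= `|h| ->
    `|t *: w + (s *: v + x) - x| <= h * (`|v| + `|w|).
  rewrite !(ger0_norm h0) => sh th.
  rewrite addrA addrK (le_trans (ler_normD _ _))// addrC mulrDr !normrZ.
  by rewrite lerD// ler_wpM2r.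
have bnd' (s t : R) sh th := le_lt_trans (bnd s t sh th) hr.
have n0 : `|0 : R| <= `|h| by rewrite normr0.
have D s : `|s| <= `|h| -> is_derive (s *: v + x) v (fun y => f (h *: w + y) - f y)
    ('D_v f (h *: w + (s *: v + x)) - 'D_v f (s *: v + x)).
  move=> sh; apply: is_deriveB; last first.
    have := bnd' s 0 sh n0; rewrite scale0r add0r => /H[dv _].
    exact: derivableP dv.
  by have /H[dv _] := bnd' s h sh (lexx _); exact: is_derive_translate dv.
have [s /D[dv _]|c ch] := @MVT_line _ _ (fun y => f (h *: w + y) - f y) x v h.
  exact: dv.
have [_ ->] := D _ ch.
move=> ->.
have [s sh|c' c'h] := @MVT_line _ _ ('D_v f) (c *: v + x) w h.
  by have /H[_ dv] := bnd' c s ch sh; exact: dv.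
move=> ->; exists (c' *: w + (c *: v + x)) => //.
exact: bnd.
Qed.

Lemma distr_le_halves (R : numFieldType) (a b c d : R) :
  `|a - c| <= d / 2 -> `|b - c| <= d / 2 -> `|a - b| <= d.
Proof.
move=> ac bc; rewrite [d]splitr (le_trans _ (lerD ac bc))// [`|b - c|]distrC.
by rewrite (le_trans _ (ler_normD _ _))// addrA subrK.
Qed.

Lemma derive_comm (R : realType) (V : normedModType R) (f : V -> R) (x v w : V) :
  (\forall y \near x, derivable f y v /\ derivable ('D_v f) y w) ->
  (\forall y \near x, derivable f y w /\ derivable ('D_w f) y v) ->
  {for x, continuous ('D_w ('D_v f))} -> {for x, continuous ('D_v ('D_w f))} ->
  'D_w ('D_v f) x = 'D_v ('D_w f) x.
Proof.
move=> H1 H2 c1 c2; apply/eqP; rewrite -subr_eq0 -normr_le0; apply/ler_addgt0Pr => e e0.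
rewrite add0r.
have e20 : 0 < e / 2 by rewrite divr_gt0.
have := c1 => /cvgrPdist_le /(_ _ e20) n1.
have := c2 => /cvgrPdist_le /(_ _ e20) n2.
have [r r0 Hr] : exists2 r, 0 < r & forall y, `|y - x| < r ->
    [/\ derivable f y v /\ derivable ('D_v f) y w,
    derivable f y w /\ derivable ('D_w f) y v,
    `|'D_w ('D_v f) x - 'D_w ('D_v f) y| <= e / 2 &
    `|'D_v ('D_w f) x - 'D_v ('D_w f) y| <= e / 2].
  have : \forall y \near x, [/\ derivable f y v /\ derivable ('D_v f) y w,
    derivable f y w /\ derivable ('D_w f) y v,
    `|'D_w ('D_v f) x - 'D_w ('D_v f) y| <= e / 2 &
    `|'D_v ('D_w f) x - 'D_v ('D_w f) y| <= e / 2].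
    apply: (filterS _ (filterI (filterI H1 H2) (filterI n1 n2))) => y.
    by move=> [[h1 h2] [h3 h4]]; exact: (And4 h1 h2 h3 h4).
  exact: near_norm.
have k0 : 0 < `|v| + `|w| + 1 by rewrite ltr_wpDl// addr_ge0.
pose h := r / (`|v| + `|w| + 1).
have h0 : 0 < h by rewrite divr_gt0.
have hr : h * (`|v| + `|w|) < r.
  by rewrite /h -mulrA gtr_pMr// mulrC ltr_pdivrMr// mul1r ltrDl.
have [|p px Ep] := @second_difference _ _ f x v w r h _ (ltW h0) hr.
  by move=> y /Hr[dv _ _ _]; exact: dv.
have hr' : h * (`|w| + `|v|) < r by rewrite addrC.
have [|q qx Eq] := @second_difference _ _ f x w v r h _ (ltW h0) hr'.
  by move=> y /Hr[_ dv _ _]; exact: dv.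
have E : 'D_w ('D_v f) p = 'D_v ('D_w f) q.
  apply: (mulfI (lt0r_neq0 h0)); apply: (mulfI (lt0r_neq0 h0)).
  have S (c3 c4 c5 c6 : R) : c3 - c4 - (c5 - c6) = c3 - c5 - (c4 - c6) by ring.
  apply: etrans (esym Ep) _; apply: etrans _ Eq.
  by rewrite S; congr (f _ - _ - _); exact: addrCA.
have [_ _ A _] := Hr _ (le_lt_trans px hr).
have [_ _ _ B] := Hr _ (le_lt_trans qx hr').
by apply: (distr_le_halves A); rewrite E; exact: B.
Qed.

Lemma smooth_on_derive_comm (R : realType) (m : nat) (U : set 'rV[R]_m)
    (f : 'rV[R]_m -> R) (a b : 'I_m) (x : 'rV[R]_m) :
  open U -> smooth_on U f -> U x ->
  'D_(delta_mx 0 a) ('D_(delta_mx 0 b) f) x =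
  'D_(delta_mx 0 b) ('D_(delta_mx 0 a) f) x.
Proof.
move=> Uo Hf Ux.
have near_derivable c d : \forall y \near x, derivable f y (delta_mx 0 c) /\
    derivable ('D_(delta_mx 0 c) f) y (delta_mx 0 d).
  apply: filterS (open_nbhs_nbhs (conj Uo Ux)) => y Uy.
  by split; [have [_] := Hf [::] _ Uy; exact | have [_] := Hf [:: c] _ Uy; exact].
apply: derive_comm => //.
- exact: (smooth_on_continuous (smooth_on_partial a (smooth_on_partial b Hf)) Ux).
- exact: (smooth_on_continuous (smooth_on_partial b (smooth_on_partial a Hf)) Ux).
Qed.

(** * Smooth matrix-valued maps *)

Section SmoothOnRules.
Variables (R : realType) (m : nat) (U : set 'rV[R]_m).
Hypothesis Uo : open U.
Implicit Types (f g : 'rV[R]_m -> R).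

Lemma smooth_on_eq f g : (forall x, U x -> f x = g x) -> smooth_on U f -> smooth_on U g.
Proof. by move=> fg Hf; apply: smooth_closureP => //; exact: Sc_ext (Sc_smooth Hf) fg. Qed.

Lemma smooth_on_cst c : smooth_on U (fun=> c).
Proof. by apply: smooth_closureP => //; exact: Sc_cst. Qed.

Lemma smooth_onD f g : smooth_on U f -> smooth_on U g -> smooth_on U (fun x => f x + g x).
Proof. by move=> Hf Hg; apply: smooth_closureP => //; apply: Sc_add; exact: Sc_smooth. Qed.

Lemma smooth_onM f g : smooth_on U f -> smooth_on U g -> smooth_on U (fun x => f x * g x).
Proof. by move=> Hf Hg; apply: smooth_closureP => //; apply: Sc_mul; exact: Sc_smooth. Qed.

Lemma smooth_onN f : smooth_on U f -> smooth_on U (fun x => - f x).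
Proof.
move=> Hf; have := smooth_onM (smooth_on_cst (-1)) Hf.
by apply: smooth_on_eq => x _; rewrite mulN1r.
Qed.

Lemma smooth_onV f : (forall x, U x -> f x != 0) -> smooth_on U f ->
  smooth_on U (fun x => (f x)^-1).
Proof.
move=> f0 Hf; apply: smooth_closureP => //; apply: Sc_inv f0.
exact: Sc_smooth.
Qed.

Lemma smooth_on_sum (I : Type) (r : seq I) (P : pred I) (F : I -> 'rV[R]_m -> R) :
  (forall i, P i -> smooth_on U (F i)) -> smooth_on U (fun x => \sum_(i <- r | P i) F i x).
Proof.
move=> H; apply: smooth_closureP => //; apply: smooth_closure_sum => i Pi.
exact/Sc_smooth/H.
Qed.

Lemma smooth_on_prod (I : Type) (r : seq I) (P : pred I) (F : I -> 'rV[R]_m -> R) :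
  (forall i, P i -> smooth_on U (F i)) -> smooth_on U (fun x => \prod_(i <- r | P i) F i x).
Proof.
move=> H; apply: smooth_closureP => //; apply: smooth_closure_prod => i Pi.
exact/Sc_smooth/H.
Qed.

Lemma smooth_on_comp k (V : set 'rV[R]_k) (h : 'rV[R]_k -> R) (phi : 'rV[R]_m -> 'rV[R]_k) :
  open V -> smooth_on V h -> (forall b, smooth_on U (fun x => phi x 0 b)) ->
  (forall x, U x -> V (phi x)) -> smooth_on U (fun x => h (phi x)).
Proof.
move=> Vo Hh Hphi UV; apply: smooth_closureP => //; apply: (Sc_comp Vo Hh) UV => b.
exact: Sc_smooth.
Qed.

End SmoothOnRules.

Definition smooth_mx (R : realType) (m p q : nat) (U : set 'rV[R]_m)
    (X : 'rV[R]_m -> 'M[R]_(p, q)) : Prop :=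
  forall i j, smooth_on U (fun x => X x i j).

(* Locked: unification would otherwise unfold derivatives into filter limits. *)
HB.lock Definition dmx (R : realType) (m p q : nat) (a : 'I_m)
    (X : 'rV[R]_m -> 'M[R]_(p, q)) (x : 'rV[R]_m) : 'M[R]_(p, q) :=
  \matrix_(i, j) 'D_(delta_mx 0 a) (fun y => X y i j) x.

Lemma dmxE (R : realType) (m p q : nat) (a : 'I_m)
    (X : 'rV[R]_m -> 'M[R]_(p, q)) (x : 'rV[R]_m) i j :
  dmx a X x i j = 'D_(delta_mx 0 a) (fun y => X y i j) x.
Proof. by rewrite dmx.unlock mxE. Qed.

Lemma eq_derive (R : numFieldType) (V W : normedModType R) (f g : V -> W) (x v : V) :
  (forall y, f y = g y) -> 'D_v f x = 'D_v g x.
Proof. by move=> /funext ->. Qed.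

Section SmoothMx.
Variables (R : realType) (m : nat) (U : set 'rV[R]_m).
Hypothesis Uo : open U.

Lemma smooth_mx_eq p q (X Y : 'rV[R]_m -> 'M[R]_(p, q)) :
  (forall x, U x -> X x = Y x) -> smooth_mx U X -> smooth_mx U Y.
Proof. by move=> E HX i j; apply: smooth_on_eq (HX i j) => // x Ux; rewrite E. Qed.

Lemma smooth_mx_cst p q (C : 'M[R]_(p, q)) : smooth_mx U (fun=> C).
Proof. by move=> i j; exact: smooth_on_cst. Qed.

Lemma smooth_mxD p q (X Y : 'rV[R]_m -> 'M[R]_(p, q)) :
  smooth_mx U X -> smooth_mx U Y -> smooth_mx U (fun x => X x + Y x).
Proof.
move=> HX HY i j; apply: smooth_on_eq (smooth_onD Uo (HX i j) (HY i j)) => // x _.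
by rewrite mxE.
Qed.

Lemma smooth_mxZ p q (s : 'rV[R]_m -> R) (X : 'rV[R]_m -> 'M[R]_(p, q)) :
  smooth_on U s -> smooth_mx U X -> smooth_mx U (fun x => s x *: X x).
Proof.
move=> Hs HX i j; apply: smooth_on_eq (smooth_onM Uo Hs (HX i j)) => // x _.
by rewrite mxE.
Qed.

Lemma smooth_mx_tr p q (X : 'rV[R]_m -> 'M[R]_(p, q)) :
  smooth_mx U X -> smooth_mx U (fun x => (X x)^T).
Proof.
by move=> HX i j; apply: smooth_on_eq (HX j i) => // x _; rewrite mxE.
Qed.

Lemma smooth_mx_sum p q (I : Type) (r : seq I) (P : pred I)
    (X : I -> 'rV[R]_m -> 'M[R]_(p, q)) :
  (forall k, P k -> smooth_mx U (X k)) -> smooth_mx U (fun x => \sum_(k <- r | P k) X k x).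
Proof.
move=> HX i j.
apply: smooth_on_eq (@smooth_on_sum _ _ U Uo _ r P (fun k x => X k x i j) _) => //.
  by move=> x _; rewrite summxE.
by move=> k Pk; exact: HX.
Qed.

Lemma smooth_mxM p q r (X : 'rV[R]_m -> 'M[R]_(p, q)) (Y : 'rV[R]_m -> 'M[R]_(q, r)) :
  smooth_mx U X -> smooth_mx U Y -> smooth_mx U (fun x => X x *m Y x).
Proof.
move=> HX HY i j.
apply: smooth_on_eq (@smooth_on_sum _ _ U Uo _ (index_enum 'I_q) xpredT
  (fun k x => X x i k * Y x k j) _) => //.
  by move=> x _; rewrite mxE.
by move=> k _; exact: smooth_onM.
Qed.

Lemma smooth_mx_block p1 p2 q1 q2 (X : 'rV[R]_m -> 'M[R]_(p1, q1))
    (Y : 'rV[R]_m -> 'M[R]_(p1, q2)) (Z : 'rV[R]_m -> 'M[R]_(p2, q1))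
    (T : 'rV[R]_m -> 'M[R]_(p2, q2)) :
  smooth_mx U X -> smooth_mx U Y -> smooth_mx U Z -> smooth_mx U T ->
  smooth_mx U (fun x => block_mx (X x) (Y x) (Z x) (T x)).
Proof.
move=> HX HY HZ HT i j; rewrite -(splitK i) -(splitK j).
case: (fintype.split i) => i'; case: (fintype.split j) => j' /=.
- by apply: smooth_on_eq (HX i' j') => // x _; rewrite block_mxEul.
- by apply: smooth_on_eq (HY i' j') => // x _; rewrite block_mxEur.
- by apply: smooth_on_eq (HZ i' j') => // x _; rewrite block_mxEdl.
- by apply: smooth_on_eq (HT i' j') => // x _; rewrite block_mxEdr.
Qed.

Lemma smooth_mx_row p q1 q2 (X : 'rV[R]_m -> 'M[R]_(p, q1))
    (Y : 'rV[R]_m -> 'M[R]_(p, q2)) :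
  smooth_mx U X -> smooth_mx U Y -> smooth_mx U (fun x => row_mx (X x) (Y x)).
Proof.
move=> HX HY i j; rewrite -(splitK j); case: (fintype.split j) => j' /=.
- by apply: smooth_on_eq (HX i j') => // x _; rewrite row_mxEl.
- by apply: smooth_on_eq (HY i j') => // x _; rewrite row_mxEr.
Qed.

Lemma smooth_on_det p (X : 'rV[R]_m -> 'M[R]_p) :
  smooth_mx U X -> smooth_on U (fun x => \det (X x)).
Proof.
move=> HX; rewrite /determinant; apply: smooth_on_sum => // s _.
apply: smooth_onM => //; first exact: smooth_on_cst.
by apply: smooth_on_prod => // i _; exact: HX.
Qed.

Lemma smooth_mx_inv p (X : 'rV[R]_m -> 'M[R]_p) :
  (forall x, U x -> X x \in unitmx) -> smooth_mx U X ->
  smooth_mx U (fun x => invmx (X x)).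
Proof.
move=> Xu HX.
have HA : smooth_mx U (fun x => (\det (X x))^-1 *: \adj (X x)).
  apply: smooth_mxZ.
    apply: smooth_onV => //; last exact: smooth_on_det.
    by move=> x /Xu; rewrite unitmxE unitfE.
  move=> i j; have : smooth_on U (fun x => cofactor (X x) j i).
    rewrite /cofactor; apply: smooth_onM => //; first exact: smooth_on_cst.
    apply: smooth_on_det => i' j'.
    by apply: smooth_on_eq (HX (lift j i') (lift i j')) => // x _; rewrite !mxE.
  by apply: smooth_on_eq => // x _; rewrite mxE.
by apply: smooth_mx_eq HA => x Ux; rewrite /invmx Xu.
Qed.

Lemma smooth_mx_comp k p q (V : set 'rV[R]_k) (X : 'rV[R]_k -> 'M[R]_(p, q))
    (phi : 'rV[R]_m -> 'rV[R]_k) :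
  open V -> smooth_mx V X -> smooth_mx U phi -> (forall x, U x -> V (phi x)) ->
  smooth_mx U (fun x => X (phi x)).
Proof.
move=> Vo HX Hphi UV i j.
exact: (@smooth_on_comp _ _ U Uo k V (fun y => X y i j) phi Vo (HX i j) (Hphi 0) UV).
Qed.

Lemma smooth_mx_dmx p q a (X : 'rV[R]_m -> 'M[R]_(p, q)) :
  smooth_mx U X -> smooth_mx U (dmx a X).
Proof.
move=> HX i j; apply: smooth_on_eq (smooth_on_partial a (HX i j)) => // x _.
by rewrite dmxE.
Qed.

Variable x : 'rV[R]_m.
Hypothesis Ux : U x.

Lemma smooth_on_derivable f v : smooth_on U f -> derivable f x v.
Proof. by move=> Hf; apply: diff_derivable; exact: smooth_on_differentiable Hf Ux. Qed.

Lemma dmx_eq p q a (X Y : 'rV[R]_m -> 'M[R]_(p, q)) :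
  (forall y, U y -> X y = Y y) -> dmx a X x = dmx a Y x.
Proof.
move=> E; apply/matrixP => i j; rewrite !dmxE; apply: (eq_on_derive _ Uo Ux) => y Uy.
by rewrite E.
Qed.

Lemma dmx_cst p q a (C : 'M[R]_(p, q)) : dmx a (fun=> C) x = 0.
Proof. by apply/matrixP => i j; rewrite dmxE derive_cst mxE. Qed.

Lemma dmxD p q a (X Y : 'rV[R]_m -> 'M[R]_(p, q)) :
  smooth_mx U X -> smooth_mx U Y ->
  dmx a (fun y => X y + Y y) x = dmx a X x + dmx a Y x.
Proof.
move=> HX HY; apply/matrixP => i j; rewrite !(mxE, dmxE).
rewrite -(deriveD (@smooth_on_derivable _ _ (HX i j)) (@smooth_on_derivable _ _ (HY i j))).
by apply: eq_derive => y; rewrite mxE.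
Qed.

Lemma dmxZ p q a (s : 'rV[R]_m -> R) (X : 'rV[R]_m -> 'M[R]_(p, q)) :
  smooth_on U s -> smooth_mx U X ->
  dmx a (fun y => s y *: X y) x =
  'D_(delta_mx 0 a) s x *: X x + s x *: dmx a X x.
Proof.
move=> Hs HX; apply/matrixP => i j; rewrite !(mxE, dmxE).
transitivity ('D_(delta_mx 0 a) (s * (fun y => X y i j)) x).
  by apply: eq_derive => y; rewrite mxE.
rewrite (deriveM (@smooth_on_derivable _ _ Hs) (@smooth_on_derivable _ _ (HX i j))).
by rewrite addrC /GRing.scale /= [X x i j * _]mulrC.
Qed.

Lemma dmx_tr p q a (X : 'rV[R]_m -> 'M[R]_(p, q)) :
  dmx a (fun y => (X y)^T) x = (dmx a X x)^T.
Proof.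
apply/matrixP => i j; rewrite !(mxE, dmxE).
by apply: eq_derive => y; rewrite mxE.
Qed.

Lemma derive_sum_on (I : finType) (F : I -> 'rV[R]_m -> R) v :
  (forall i, smooth_on U (F i)) ->
  'D_v (fun y => \sum_i F i y) x = \sum_i 'D_v (F i) x.
Proof.
move=> HF.
suff H (r : seq I) : 'D_v (fun y => \sum_(i <- r) F i y) x = \sum_(i <- r) 'D_v (F i) x.
  exact: H.
elim: r => [|i r IHr].
  rewrite big_nil -[RHS](derive_cst (0 : R) x v).
  by apply: eq_derive => y; rewrite big_nil.
rewrite big_cons -IHr -deriveD; last 2 first.
- exact: smooth_on_derivable.
- by apply: smooth_on_derivable; exact: smooth_on_sum.
by apply: eq_derive => y; rewrite big_cons.
Qed.

Lemma dmx_sum p q a (I : finType) (X : I -> 'rV[R]_m -> 'M[R]_(p, q)) :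
  (forall k, smooth_mx U (X k)) ->
  dmx a (fun y => \sum_k X k y) x = \sum_k dmx a (X k) x.
Proof.
move=> HX; apply/matrixP => i j; rewrite dmxE summxE.
transitivity ('D_(delta_mx 0 a) (fun y => \sum_k X k y i j) x).
  by apply: eq_derive => y; rewrite summxE.
rewrite (@derive_sum_on _ (fun k y => X k y i j)); last by move=> k; exact: HX.
by apply: eq_bigr => k _; rewrite dmxE.
Qed.

Lemma dmxM p q r a (X : 'rV[R]_m -> 'M[R]_(p, q)) (Y : 'rV[R]_m -> 'M[R]_(q, r)) :
  smooth_mx U X -> smooth_mx U Y ->
  dmx a (fun y => X y *m Y y) x = dmx a X x *m Y x + X x *m dmx a Y x.
Proof.
move=> HX HY; apply/matrixP => i j; rewrite dmxE !mxE -big_split/=.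
transitivity ('D_(delta_mx 0 a) (fun y => \sum_k X y i k * Y y k j) x).
  by apply: eq_derive => y; rewrite mxE.
rewrite (@derive_sum_on _ (fun k y => X y i k * Y y k j)); last first.
  by move=> k; exact: smooth_onM.
apply: eq_bigr => k _; rewrite !dmxE.
rewrite (deriveM (@smooth_on_derivable _ _ (HX i k)) (@smooth_on_derivable _ _ (HY k j))).
by rewrite addrC /GRing.scale /= [Y x k j * _]mulrC.
Qed.

Lemma dmx_block p1 p2 q1 q2 a (X : 'rV[R]_m -> 'M[R]_(p1, q1))
    (Y : 'rV[R]_m -> 'M[R]_(p1, q2)) (Z : 'rV[R]_m -> 'M[R]_(p2, q1))
    (T : 'rV[R]_m -> 'M[R]_(p2, q2)) :
  dmx a (fun y => block_mx (X y) (Y y) (Z y) (T y)) x =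
  block_mx (dmx a X x) (dmx a Y x) (dmx a Z x) (dmx a T x).
Proof.
apply/matrixP => i j; rewrite -(splitK i) -(splitK j).
case: (fintype.split i) => i'; case: (fintype.split j) => j' /=.
- by rewrite block_mxEul 2!dmxE; apply: eq_derive => y; rewrite block_mxEul.
- by rewrite block_mxEur 2!dmxE; apply: eq_derive => y; rewrite block_mxEur.
- by rewrite block_mxEdl 2!dmxE; apply: eq_derive => y; rewrite block_mxEdl.
- by rewrite block_mxEdr 2!dmxE; apply: eq_derive => y; rewrite block_mxEdr.
Qed.

Lemma dmx_row p q1 q2 a (X : 'rV[R]_m -> 'M[R]_(p, q1))
    (Y : 'rV[R]_m -> 'M[R]_(p, q2)) :
  dmx a (fun y => row_mx (X y) (Y y)) x = row_mx (dmx a X x) (dmx a Y x).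
Proof.
apply/matrixP => i j; rewrite -(splitK j); case: (fintype.split j) => j' /=;
  rewrite ?(row_mxEl, row_mxEr) 2!dmxE;
  by apply: eq_derive => y; rewrite ?(row_mxEl, row_mxEr).
Qed.

Lemma dmx_comp k p q a (V : set 'rV[R]_k) (X : 'rV[R]_k -> 'M[R]_(p, q))
    (phi : 'rV[R]_m -> 'rV[R]_k) :
  open V -> smooth_mx V X -> smooth_mx U phi -> V (phi x) ->
  dmx a (fun y => X (phi y)) x = \sum_b dmx a phi x 0 b *: dmx b X (phi x).
Proof.
move=> Vo HX Hphi Vx; apply/matrixP => i j; rewrite dmxE summxE.
have := @chain_derive _ _ k phi (fun y => X y i j) x (delta_mx 0 a).
rewrite /comp => ->; first by apply: eq_bigr => b _; rewrite mxE !dmxE.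
- by move=> b; exact: smooth_on_differentiable (Hphi 0 b) Ux.
- exact: smooth_on_differentiable (HX i j) Vx.
Qed.

Lemma dmx_comm p q a b (X : 'rV[R]_m -> 'M[R]_(p, q)) :
  smooth_mx U X -> dmx a (dmx b X) x = dmx b (dmx a X) x.
Proof.
move=> HX; apply/matrixP => i j; apply: etrans (dmxE _ _ _ _ _) _; apply: etrans _ (esym (dmxE _ _ _ _ _)).
transitivity ('D_(delta_mx 0 a) ('D_(delta_mx 0 b) (fun y => X y i j)) x).
  by apply: eq_derive => y; rewrite dmxE.
rewrite (smooth_on_derive_comm a b Uo (HX i j) Ux).
by apply: eq_derive => y; rewrite dmxE.
Qed.

End SmoothMx.

Lemma addmxE (V : nmodType) (p q : nat) (X Y : 'M[V]_(p, q)) i j :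
  (X + Y) i j = X i j + Y i j.
Proof. by rewrite mxE. Qed.

Lemma oppmxE (V : zmodType) (p q : nat) (X : 'M[V]_(p, q)) i j :
  (- X) i j = - X i j.
Proof. by rewrite mxE. Qed.

Lemma scalemxE (R : pzRingType) (p q : nat) (k : R) (X : 'M[R]_(p, q)) i j :
  (k *: X) i j = k * X i j.
Proof. by rewrite mxE. Qed.

(** * Levi-Civita connection and curvature in matrix form *)

Section Christoffel.
Variables (R : realType) (N : nat).
Implicit Types (G : 'rV[R]_N -> 'M[R]_N) (y : 'rV[R]_N).

Definition christoffel1 G (a b d : 'I_N) y : R :=
  2^-1 * (dmx a G y d b + dmx b G y a d - dmx d G y a b).

(* Row b, column c: the Christoffel symbol Gamma^c_{ab}. *)
Definition connection_mx G (a : 'I_N) y : 'M[R]_N :=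
  \matrix_(b, c) \sum_d invmx (G y) c d * christoffel1 G a b d y.

Definition curvature_mx k (W : 'I_N -> 'rV[R]_N -> 'M[R]_k) (a b : 'I_N) y : 'M[R]_k :=
  dmx a (W b) y - dmx b (W a) y + W b y *m W a y - W a y *m W b y.

Definition ricci_mx G y : 'M[R]_N :=
  \matrix_(b, c) \sum_a curvature_mx (connection_mx G) a b y c a.

Lemma connection_mxM G a y : G y \in unitmx -> (G y)^T = G y ->
  connection_mx G a y *m G y = \matrix_(b, d) christoffel1 G a b d y.
Proof.
move=> Gu Gs.
have -> : connection_mx G a y = (\matrix_(b, d) christoffel1 G a b d y) *m (invmx (G y))^T.
  by apply/matrixP => b c; rewrite !mxE; apply: eq_bigr => d _; rewrite !mxE mulrC.
by rewrite -mulmxA -{2}Gs -trmx_mul mulmxV// trmx1 mulmx1.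
Qed.

Lemma connection_mx_unique G (Gam : 'I_N -> 'M[R]_N) y :
  G y \in unitmx -> (G y)^T = G y ->
  (forall a b c, Gam a b c = Gam b a c) ->
  (forall a, dmx a G y = Gam a *m G y + G y *m (Gam a)^T) ->
  forall a, connection_mx G a y = Gam a.
Proof.
move=> Gu Gs Gam_sym Gam_compat a.
apply: (can_inj (mulmxK Gu)); rewrite connection_mxM//.
have E c b d : dmx c G y b d = (Gam c *m G y) b d + (Gam c *m G y) d b.
  rewrite Gam_compat mxE; congr (_ + _).
  by rewrite -[in LHS]Gs -trmx_mul mxE.
have L c b d : (Gam c *m G y) b d = (Gam b *m G y) c d.
  by rewrite !mxE; apply: eq_bigr => e _; rewrite Gam_sym.
apply/matrixP => b d; rewrite mxE /christoffel1 !E.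
rewrite (L b a d) (L d a b) (L d b a) (L b d a); by field.
Qed.

Lemma connection_mx_sym (U : set 'rV[R]_N) G y a b c : open U -> U y ->
  (forall x, U x -> (G x)^T = G x) ->
  connection_mx G a y b c = connection_mx G b y a c.
Proof.
move=> Uo Uy Gs; have Es e : (dmx e G y)^T = dmx e G y.
  by rewrite -dmx_tr; exact: (dmx_eq Uo).
have E e i j : dmx e G y i j = dmx e G y j i by rewrite -[in LHS]Es mxE.
rewrite !mxE; apply: eq_bigr => d _; rewrite /christoffel1 (E a d b) (E b a d) (E d a b).
by rewrite [X in _ * (_ * (X - _))]addrC.
Qed.

Lemma connection_mx_compat (U : set 'rV[R]_N) G y a : open U -> U y ->
  (forall x, U x -> (G x)^T = G x) -> G y \in unitmx ->
  dmx a G y = connection_mx G a y *m G y + G y *m (connection_mx G a y)^T.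
Proof.
move=> Uo Uy Gs Gu; have Es e : (dmx e G y)^T = dmx e G y.
  by rewrite -dmx_tr; exact: (dmx_eq Uo).
have E e i j : dmx e G y i j = dmx e G y j i by rewrite -[in LHS]Es mxE.
rewrite -{2}(Gs _ Uy) -trmx_mul connection_mxM ?Gs//.
apply/matrixP => i j; rewrite !mxE.
rewrite /christoffel1 (E a j i) (E i a j) (E j a i); by field.
Qed.

Lemma smooth_connection_mx (U : set 'rV[R]_N) G a : open U ->
  (forall x, U x -> G x \in unitmx) -> smooth_mx U G ->
  smooth_mx U (connection_mx G a).
Proof.
move=> Uo Gu HG b c.
have H d : smooth_on U (fun x => invmx (G x) c d * christoffel1 G a b d x).
  apply: smooth_onM => //; first exact: smooth_mx_inv.
  apply: smooth_onM => //; first exact: smooth_on_cst.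
  apply: smooth_onD => //; last by apply: smooth_onN => //; exact: smooth_mx_dmx.
  by apply: smooth_onD => //; exact: smooth_mx_dmx.
apply: smooth_on_eq (@smooth_on_sum _ _ U Uo _ (index_enum 'I_N) xpredT _ (fun d _ => H d)) => //.
by move=> x _; rewrite mxE.
Qed.

End Christoffel.

Lemma curvature_mx_gauge (R : realType) (N k : nat) (U : set 'rV[R]_N)
    (Gam : 'I_N -> 'rV[R]_N -> 'M[R]_N) (W : 'I_N -> 'rV[R]_N -> 'M[R]_k)
    (T : 'rV[R]_N -> 'M[R]_(N, k)) (y : 'rV[R]_N) (a b : 'I_N) :
  open U -> U y -> (forall c, smooth_mx U (Gam c)) -> (forall c, smooth_mx U (W c)) ->
  smooth_mx U T ->
  (forall c x, U x -> Gam c x *m T x = dmx c T x + T x *m W c x) ->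
  curvature_mx Gam a b y *m T y = T y *m curvature_mx W a b y.
Proof.
move=> Uo Uy HGam HW HT E.
have D c d : dmx c (Gam d) y *m T y =
    dmx c (dmx d T) y + dmx c T y *m W d y + T y *m dmx c (W d) y - Gam d y *m dmx c T y.
  apply/esym/eqP; rewrite subr_eq -(dmxM Uo Uy)//; apply/eqP.
  have -> : dmx c (fun x => Gam d x *m T x) y = dmx c (fun x => dmx d T x + T x *m W d x) y.
    by apply: (dmx_eq Uo Uy) => x Ux; exact: E.
  rewrite (dmxD Uo Uy); [| exact: smooth_mx_dmx | exact: smooth_mxM].
  by rewrite (dmxM Uo Uy)// addrA.
rewrite /curvature_mx !(mulmxDl, mulNmx, mulmxDr, mulmxN) !D -!mulmxA !E//.
rewrite !(mulmxDr, mulmxDl) !mulmxA !E// !mulmxDl (dmx_comm Uo Uy a b HT).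
apply/matrixP => i j; rewrite !(addmxE, oppmxE).
move: (dmx b _ y i j) ((dmx a T y *m W b y) i j) ((T y *m dmx a (W b) y) i j)
  ((Gam b y *m dmx a T y) i j) ((dmx b T y *m W a y) i j)
  ((T y *m dmx b (W a) y) i j) ((Gam a y *m dmx b T y) i j)
  ((T y *m W b y *m W a y) i j) ((T y *m W a y *m W b y) i j).
by move=> c1 c2 c3 c4 c5 c6 c7 c8 c9; ring.
Qed.

(* The Kähler identity [nabla J = 0], for [A a] the derivative along [e_a] of the
   metric in holomorphic coordinates. *)
Lemma kahler_christoffel (R : realType) (m : nat) (A : 'I_m -> 'M[R]_m) (K : 'M[R]_m) :
  K *m K = - 1%:M -> K^T = - K -> (forall a, (A a)^T = A a) ->
  (forall a, A a *m K = K *m A a) ->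
  (forall a b c, (K *m A a) b c + (K *m A b) c a + (K *m A c) a b = 0) ->
  forall a, let S := \matrix_(b, d) (A a b d + A b a d - A d a b) in
    S *m K = K *m S.
Proof.
move=> KK KT As AK closed a S.
have Kas b c : K b c = - K c b.
  by have /matrixP/(_ c b) := KT; rewrite mxE oppmxE.
pose B c := \sum_e K c e *: A e.
have BE c i j : B c i j = \sum_e K c e * A e i j.
  by rewrite summxE; apply: eq_bigr => e _; rewrite mxE.
have contracted b d : - B b d a + B d a b + (K *m A a) b d = 0.
  have : \sum_e \sum_z K b e * K d z *
     ((K *m A e) z a + (K *m A z) a e + (K *m A a) e z) = 0.
    by rewrite big1// => e _; rewrite big1// => z _; rewrite closed mulr0.
  under eq_bigr do under eq_bigr do rewrite !mulrDr.
  under eq_bigr do rewrite !big_split/=.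
  rewrite !big_split/= => <-; congr (_ + _ + _).
  - rewrite BE -sumrN; apply: eq_bigr => e _.
    transitivity (K b e * (K *m (K *m A e)) d a).
      by rewrite mulmxA KK mulNmx mul1mx oppmxE mulrN.
    by rewrite mxE mulr_sumr; apply: eq_bigr => z _; rewrite mulrA.
  - rewrite BE exchange_big/=; apply: eq_bigr => z _.
    transitivity (K d z * (K *m A z *m K^T) a b).
      by rewrite KT mulmxN -mulmxA AK mulmxA KK mulNmx mul1mx opprK.
    rewrite mxE mulr_sumr; apply: eq_bigr => e _; rewrite [X in _ * (_ * X) = _]mxE; ring.
  - transitivity ((K *m (K *m A a) *m K^T) b d).
      by rewrite mulmxA KK mulNmx mul1mx KT mulmxN mulNmx opprK AK.
    rewrite mxE exchange_big/=; apply: eq_bigr => z _.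
    rewrite [(K *m _) b z]mxE mulr_suml; apply: eq_bigr => e _.
    rewrite [X in _ * X = _]mxE; ring.
have BT c i j : B c i j = B c j i.
  by rewrite !BE; apply: eq_bigr => e _; rewrite -{1}As mxE.
apply/matrixP => b d.
have -> : (S *m K) b d = (A a *m K) b d + (A b *m K) a d + B d a b.
  rewrite BE !mxE -!big_split/=; apply: eq_bigr => e _; rewrite mxE [K d e]Kas; ring.
have -> : (K *m S) b d = (K *m A a) b d + B b a d + (A d *m K) a b.
  rewrite BE !mxE -!big_split/=; apply: eq_bigr => e _; rewrite mxE [K e b]Kas; ring.
have := contracted b d; have := closed a b d; rewrite !AK.
have -> : (K *m A b) d a = - (K *m A b) a d.
  have : (K *m A b)^T = - (K *m A b) by rewrite trmx_mul As KT mulmxN AK.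
  by move=> /matrixP/(_ a d); rewrite mxE oppmxE.
rewrite (BT b d a); lra.
Qed.

Lemma connection_mx_kahler (R : realType) (m : nat) (U : set 'rV[R]_m)
    (g : 'rV[R]_m -> 'M[R]_m) (K : 'M[R]_m) (x : 'rV[R]_m) :
  open U -> U x -> smooth_mx U g -> (forall y, U y -> (g y)^T = g y) ->
  g x \in unitmx ->
  K *m K = - 1%:M -> K^T = - K -> (forall y, U y -> g y *m K = K *m g y) ->
  (forall a b c, (K *m dmx a g x) b c + (K *m dmx b g x) c a
     + (K *m dmx c g x) a b = 0) ->
  forall a, connection_mx g a x *m K = K *m connection_mx g a x.
Proof.
move=> Uo Ux Hg gs gu KK KT gK closed a.
have dgs c : (dmx c g x)^T = dmx c g x by rewrite -dmx_tr; exact: (dmx_eq Uo Ux).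
have dgK c : dmx c g x *m K = K *m dmx c g x.
  have := @dmx_eq _ _ U Uo x Ux _ _ c _ _ gK.
  rewrite (dmxM Uo Ux _ Hg (smooth_mx_cst Uo K)) (dmxM Uo Ux _ (smooth_mx_cst Uo K) Hg).
  by rewrite !(dmx_cst)// mulmx0 addr0 mul0mx add0r.
have E : connection_mx g a x *m g x =
    2^-1 *: \matrix_(b, d) (dmx a g x b d + dmx b g x a d - dmx d g x a b).
  rewrite connection_mxM ?gs//; apply/matrixP => b d.
  by rewrite mxE scalemxE mxE /christoffel1 -[in LHS]dgs mxE.
apply: (can_inj (mulmxK gu)).
rewrite -mulmxA -gK// mulmxA E -mulmxA E -scalemxAl -scalemxAr.
by congr (_ *: _); exact: kahler_christoffel.
Qed.

(** * Curvature of the bundle metric in the adapted frame *)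

Lemma trmxZ (R : pzRingType) (p q : nat) (k : R) (X : 'M[R]_(p, q)) :
  (k *: X)^T = k *: X^T.
Proof. by apply/matrixP => a b; rewrite !mxE. Qed.

Lemma trmxD (V : nmodType) (p q : nat) (X Y : 'M[V]_(p, q)) :
  (X + Y)^T = X^T + Y^T.
Proof. by apply/matrixP => a b; rewrite !mxE. Qed.

Section FrameAlgebra.
Variables (R : realType) (m : nat) (g K : 'M[R]_m) (kap : R).
Hypotheses (gs : g^T = g) (KK : K *m K = - 1%:M) (KT : K^T = - K)
  (gK : g *m K = K *m g).

(* The connection form of the bundle metric in the frame dual to [mu] and the
   base coordinates, along a vector with mu-component s and projection j; gam is
   the connection form of the base, and kap = e^(-2 f) / (2 u). *)
Definition frame_connection (j : 'rV[R]_m) (s : R) (gam : 'M[R]_m) : 'M[R]_(1 + m) :=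
  block_mx 0 (kap *: (j *m K)) (2^-1 *: (K *m g *m j^T)) (gam + (kap * s) *: K).

Definition frame_curvature (ja jb : 'rV[R]_m) (sa sb : R) (Rm : 'M[R]_m) : 'M[R]_(1 + m) :=
  block_mx 0 (kap ^+ 2 *: (sb *: ja - sa *: jb))
    (kap / 2 *: (sa *: (g *m jb^T) - sb *: (g *m ja^T)))
    (Rm + kap * (ja *m (K *m g) *m jb^T) 0 0 *: K
     + kap / 2 *: (K *m g *m jb^T *m ja *m K - K *m g *m ja^T *m jb *m K)).

Lemma Kg_tr : (K *m g)^T = - (K *m g).
Proof. by rewrite trmx_mul KT gs mulmxN gK. Qed.

Lemma frame_connection_compat (j : 'rV[R]_m) (s u w : R) (gam : 'M[R]_m) :
  2 * kap * u = w ->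
  let eta : 'M[R]_(1 + m) := block_mx w%:M 0 0 (u *: g) in
  let W := frame_connection j s gam in
  block_mx 0 0 0 (u *: (gam *m g + g *m gam^T)) = W *m eta + eta *m W^T.
Proof.
move=> kuw eta W; rewrite /W /eta /frame_connection tr_block_mx !mulmx_block.
rewrite !(trmx0, mulmx0, mul0mx, add0r, addr0) add_block_mx add0r.
have ur : kap *: (j *m K) *m (u *: g) + w%:M *m (2^-1 *: (K *m g *m j^T))^T = 0.
  rewrite mul_scalar_mx trmxZ trmx_mul trmxK Kg_tr.
  rewrite mulmxN mulmxA -scalemxAl -scalemxAr !scalerA scalerN -scalerBl.
  by rewrite (_ : _ - _ = 0) ?scale0r// -kuw; field.
congr block_mx.
- by rewrite ur.
- have := congr1 trmx ur; rewrite trmx0 linearD /= !trmx_mul !trmxK tr_scalar_mx => <-.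
  by rewrite [RHS]addrC trmxZ gs.
rewrite trmxD trmxZ KT mulmxDl mulmxDr -!scalemxAl -!scalemxAr mulmxN gK.
apply/matrixP => a b; rewrite !(addmxE, scalemxE, oppmxE).
move: ((gam *m g) a b) ((g *m gam^T) a b) ((K *m g) a b) => c1 c2 c3; ring.
Qed.

Lemma frame_curvatureE (ja jb h : 'rV[R]_m) (sa sb dab dba : R)
    (gama gamb dgab dgba : 'M[R]_m) :
  gama *m K = K *m gama -> gamb *m K = K *m gamb ->
  jb *m gama = ja *m gamb ->
  dab - dba = (ja *m (K *m g) *m jb^T) 0 0 ->
  let Wa := frame_connection ja sa gama in
  let Wb := frame_connection jb sb gamb in
  let Xab : 'M[R]_(1 + m) := block_mx 0 (kap *: (h *m K))
    (2^-1 *: ((gama *m (K *m g) + K *m g *m gama^T) *m jb^T + K *m g *m h^T))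
    (dgab + (kap * dab) *: K) in
  let Xba : 'M[R]_(1 + m) := block_mx 0 (kap *: (h *m K))
    (2^-1 *: ((gamb *m (K *m g) + K *m g *m gamb^T) *m ja^T + K *m g *m h^T))
    (dgba + (kap * dba) *: K) in
  Xab - Xba + Wb *m Wa - Wa *m Wb =
  frame_curvature ja jb sa sb (dgab - dgba + gamb *m gama - gama *m gamb).
Proof.
move=> gaK gbK jg dd Wa Wb Xab Xba.
have KKg : K *m (K *m g) = - g by rewrite mulmxA KK mulNmx mul1mx.
have gjT : gama^T *m jb^T = gamb^T *m ja^T by rewrite -!trmx_mul jg.
have omj v : (ja *m K *m (K *m g *m v^T)) = - (ja *m g *m v^T).
  by rewrite mulmxA -[ja *m K *m _]mulmxA KKg mulmxN mulNmx.
have omj' v : (jb *m K *m (K *m g *m v^T)) = - (jb *m g *m v^T).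
  by rewrite mulmxA -[jb *m K *m _]mulmxA KKg mulmxN mulNmx.
rewrite /Xab /Xba /Wa /Wb /frame_connection !mulmx_block /frame_curvature.
rewrite !(mul0mx, mulmx0, add0r, addr0) !opp_block_mx !add_block_mx oppr0 !addr0 add0r.
congr block_mx.
- rewrite -!scalemxAl -!scalemxAr omj omj' !scalerN.
  rewrite opprK addrC -!scalerBr (_ : _ - _ = 0) ?scaler0//.
  apply/eqP; rewrite subr_eq0; apply/eqP.
  have : (ja *m g *m jb^T)^T = jb *m g *m ja^T by rewrite !trmx_mul trmxK gs mulmxA.
  by move=> <-; apply/matrixP => a b; rewrite [RHS]mxE !ord1.
- rewrite subrr add0r !mulmxDr -!scalemxAl -!scalemxAr.
  have jK v G : G *m K = K *m G -> v *m K *m G = v *m G *m K.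
    by move=> GK; rewrite -!mulmxA GK.
  rewrite !jK// jg -!mulmxA KK !mulmxN !mulmx1.
  apply/matrixP => a b; rewrite !(addmxE, scalemxE, oppmxE); ring.
- have KKx n (X : 'M[R]_(m, n)) : K *m (K *m X) = - X.
    by rewrite mulmxA KK mulNmx mul1mx.
  rewrite -!scalemxAr !mulmxDl -!mulmxA gjT -!scalemxAl !KKx.
  apply/matrixP => a b; rewrite !(addmxE, scalemxE, oppmxE).
  move: ((gama *m _) a b) ((K *m (g *m h^T)) a b) ((K *m (g *m (gamb^T *m _))) a b)
    ((gamb *m _) a b) ((g *m ja^T) a b) ((g *m jb^T) a b) => c1 c2 c3 c4 c5 c6.
  ring.
- rewrite -dd !mulmxDl !mulmxDr -!scalemxAl -!scalemxAr gaK gbK !mulmxA.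
  apply/matrixP => a b; rewrite !(addmxE, scalemxE, oppmxE).
  move: (dgab a b) (dgba a b) ((K *m g *m jb^T *m ja *m K) a b)
    ((K *m g *m ja^T *m jb *m K) a b) ((gamb *m gama) a b) ((gama *m gamb) a b)
    ((K *m gama) a b) ((K *m gamb) a b) ((K *m K) a b) (K a b).
  by move=> c1 c2 c3 c4 c5 c6 c7 c8 c9 c10; ring.
Qed.

Lemma frame_curvature_linear (k : R) (ja ja' jb : 'rV[R]_m) (sa sa' sb : R) (Rm Rm' : 'M[R]_m) :
  frame_curvature (k *: ja + ja') jb (k * sa + sa') sb (k *: Rm + Rm') =
  k *: frame_curvature ja jb sa sb Rm + frame_curvature ja' jb sa' sb Rm'.
Proof.
rewrite /frame_curvature scale_block_mx add_block_mx scaler0 addr0.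
congr block_mx.
- apply/matrixP => a b; rewrite !(addmxE, scalemxE, oppmxE).
  by move: (ja a b) (ja' a b) (jb a b) => c1 c2 c3; ring.
- rewrite trmxD trmxZ mulmxDr -scalemxAr.
  apply/matrixP => a b; rewrite !(addmxE, scalemxE, oppmxE).
  by move: ((g *m jb^T) a b) ((g *m ja^T) a b) ((g *m ja'^T) a b) => c1 c2 c3; ring.
- rewrite trmxD trmxZ !(mulmxDr, mulmxDl).
  rewrite -!(scalemxAr, scalemxAl) -![_ *m ja *m K]mulmxA -![_ *m ja' *m K]mulmxA.
  apply/matrixP => a b; rewrite !(addmxE, scalemxE, oppmxE).
  by ring.
Qed.

Lemma frame_trace_fiber (N : nat) (J : 'M[R]_(N, m)) (mu : 'cV[R]_N) (jb : 'rV[R]_m)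
    (sb : R) (Rm : 'M[R]_m) c i :
  (row_mx mu J *m frame_curvature 0 jb 1 sb Rm) c (lshift m i) =
  kap / 2 * (J *m g *m jb^T) c i.
Proof.
rewrite /frame_curvature mul_row_block row_mxEl mulmx0 add0r.
by rewrite trmx0 mulmx0 scaler0 subr0 scale1r -scalemxAr scalemxE mulmxA.
Qed.

Lemma frame_trace_base (N : nat) (J : 'M[R]_(N, m)) (mu : 'cV[R]_N) (jb : 'rV[R]_m)
    (sb : R) (Rm : 'I_m -> 'M[R]_m) c :
  \sum_i (row_mx mu J *m frame_curvature (delta_mx 0 i) jb 0 sb (Rm i)) c (rshift 1 i) =
  kap ^+ 2 * m%:R * (mu c 0 * sb) + \sum_i (J *m Rm i) c i
  - (kap + kap / 2) * (J *m g *m jb^T) c 0.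
Proof.
pose q := (J *m g *m jb^T) c 0.
transitivity (\sum_i (kap ^+ 2 * (mu c 0 * sb) + (J *m Rm i) c i
    + kap * ((J *m K) c i * (K *m g *m jb^T) i 0)
    + kap / 2 * ((J *m K *m g *m jb^T) c 0 * K i i)
    - kap / 2 * ((J *m K *m g) c i * (jb *m K) 0 i))).
  apply: eq_bigr => i _; rewrite /frame_curvature mul_row_block row_mxEr.
  rewrite scale0r subr0 !(mulmxDr, mulmxN) -!scalemxAr !(mulmxDr, mulmxN).
  rewrite !(addmxE, scalemxE, oppmxE).
  have -> : ((delta_mx 0 i : 'rV[R]_m) *m (K *m g) *m jb^T) 0 0 = (K *m g *m jb^T) i 0.
    by rewrite -mulmxA -rowE mxE.
  rewrite !mulmxA.
  have -> : (mu *m delta_mx 0 i) c i = mu c 0.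
    by rewrite mxE big_ord1 mxE !eqxx mulr1.
  have -> : (J *m K *m g *m jb^T *m delta_mx 0 i *m K) c i =
      (J *m K *m g *m jb^T) c 0 * K i i.
    by rewrite -[_ *m delta_mx 0 i *m K]mulmxA -rowE mxE big_ord1 [row i K 0 i]mxE.
  have -> : (J *m K *m g *m (delta_mx 0 i)^T *m jb *m K) c i =
      (J *m K *m g) c i * (jb *m K) 0 i.
    by rewrite trmx_delta -[_ *m jb *m K]mulmxA -colE mxE big_ord1 [col i _ c 0]mxE.
  ring.
have Kii i : K i i = 0.
  have /matrixP/(_ i i) := KT; rewrite mxE oppmxE; lra.
rewrite !big_split/= sumrN -!mulr_sumr sumr_const card_ord.
have -> : \sum_(i < m) K i i = 0 by apply: big1 => i _; rewrite Kii.
have -> : \sum_i (J *m K) c i * (K *m g *m jb^T) i 0 = - q.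
  transitivity ((J *m K *m (K *m g *m jb^T)) c 0); first by rewrite [RHS]mxE.
  by rewrite !mulmxA -[J *m K *m K]mulmxA KK mulmxN mulmx1 !mulNmx oppmxE.
have -> : \sum_i (J *m K *m g) c i * (jb *m K) 0 i = q.
  transitivity ((J *m K *m g *m (jb *m K)^T) c 0).
    by rewrite [RHS]mxE; apply: eq_bigr => i _; rewrite [(_^T) i 0]mxE.
  rewrite trmx_mul KT mulNmx mulmxN !mulmxA.
  rewrite -[J *m K *m g *m K]mulmxA gK !mulmxA -[J *m K *m K]mulmxA KK.
  by rewrite mulmxN mulmx1 !mulNmx opprK.
rewrite -mulr_natr /q; ring.
Qed.

End FrameAlgebra.

Definition jacobian_mx (R : realType) (N m : nat) (phi : 'rV[R]_N -> 'rV[R]_m)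
    (y : 'rV[R]_N) : 'M[R]_(N, m) :=
  \matrix_(a, b) dmx a phi y 0 b.

Lemma contract_frame (R : comPzRingType) (N k : nat) (T : 'M[R]_(N, k))
    (Q : 'M[R]_(k, N)) (L : 'rV[R]_k -> 'M[R]_k) (c : 'I_N) :
  linear L -> Q *m T = 1%:M ->
  \sum_a (T *m L (row a T) *m Q) c a = \sum_e (T *m L (delta_mx 0 e)) c e.
Proof.
move=> L_lin QT.
pose LM := GRing.isLinear.Build _ _ _ _ _ L_lin.
pose LL : {linear 'rV[R]_k -> 'M[R]_k} := HB.pack L LM.
have E a : (T *m L (row a T) *m Q) c a =
    \sum_e (T *m L (delta_mx 0 e) *m Q) c a * T a e.
  rewrite [row a T]row_sum_delta -[L]/(LL : _ -> _) linear_sum mulmx_sumr mulmx_suml summxE.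
  by apply: eq_bigr => e _; rewrite linearZ -scalemxAr -scalemxAl scalemxE mxE mulrC.
under eq_bigr do rewrite E.
rewrite exchange_big /=; apply: eq_bigr => e _.
by rewrite -[in RHS](mulmx1 (_ *m _)) -QT mulmxA mxE.
Qed.

Section BundleMetric.
Variables (R : realType) (N m : nat) (U : set 'rV[R]_m) (V : set 'rV[R]_N).
Variables (g : 'rV[R]_m -> 'M[R]_m) (K : 'M[R]_m).
Variables (phi : 'rV[R]_N -> 'rV[R]_m) (mu : 'rV[R]_N -> 'cV[R]_N).
Variables (P : 'rV[R]_N -> 'M[R]_(1 + m, N)) (u w : R).
Hypotheses (Uo : open U) (Vo : open V).
Hypotheses (g_smooth : smooth_mx U g) (g_sym : forall x, U x -> (g x)^T = g x)
  (g_unit : forall x, U x -> g x \in unitmx).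
Hypotheses (KK : K *m K = - 1%:M) (KT : K^T = - K)
  (gK : forall x, U x -> g x *m K = K *m g x).
Hypothesis closed_Kg : forall x a b c, U x ->
  (K *m dmx a g x) b c + (K *m dmx b g x) c a + (K *m dmx c g x) a b = 0.
Hypotheses (phi_smooth : smooth_mx V phi) (mu_smooth : smooth_mx V mu)
  (phiV : forall y, V y -> U (phi y)).

Let J := jacobian_mx phi.
Let T y : 'M[R]_(N, 1 + m) := row_mx (mu y) (J y).
Hypotheses (PT : forall y, V y -> P y *m T y = 1%:M)
  (TP : forall y, V y -> T y *m P y = 1%:M).
Hypothesis dmu : forall y a b, V y ->
  dmx a mu y b 0 - dmx b mu y a 0 = (J y *m (K *m g (phi y)) *m (J y)^T) a b.
Hypotheses (u_gt0 : 0 < u) (w_gt0 : 0 < w).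

Let G y : 'M[R]_N := u *: (J y *m g (phi y) *m (J y)^T) + w *: (mu y *m (mu y)^T).
Let kap : R := w / (2 * u).
Let j (a : 'I_N) y : 'rV[R]_m := dmx a phi y.
Let gam (a : 'I_N) y : 'M[R]_m := \sum_e j a y 0 e *: connection_mx g e (phi y).
Let W (a : 'I_N) y : 'M[R]_(1 + m) :=
  frame_connection (g (phi y)) K kap (j a y) (mu y a 0) (gam a y).

Lemma row_jacobian a y : row a (J y) = j a y.
Proof. by apply/rowP => b; rewrite !mxE. Qed.

Lemma jacobian_entry a b y : J y a b = j a y 0 b.
Proof. by rewrite mxE. Qed.

Lemma jacobian_mul p (X : 'M[R]_(m, p)) a y d : (J y *m X) a d = (j a y *m X) 0 d.
Proof. by rewrite mxE [RHS]mxE; apply: eq_bigr => i _; rewrite jacobian_entry. Qed.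

Lemma jacobian_quad (X : 'M[R]_m) a b y :
  (J y *m X *m (J y)^T) a b = (j a y *m X *m (j b y)^T) 0 0.
Proof.
rewrite -mulmxA jacobian_mul mulmxA mxE [RHS]mxE; apply: eq_bigr => i _.
congr (_ * _); rewrite [LHS]mxE [RHS]mxE; exact: jacobian_entry.
Qed.

Lemma jacobian_col p (X : 'M[R]_(p, m)) c b y :
  (X *m (j b y)^T) c 0 = (X *m (J y)^T) c b.
Proof.
rewrite mxE [RHS]mxE; apply: eq_bigr => i _; congr (_ * _).
by rewrite [LHS]mxE [RHS]mxE jacobian_entry.
Qed.

Lemma smooth_j a : smooth_mx V (j a).
Proof. exact: smooth_mx_dmx. Qed.

Lemma smooth_J : smooth_mx V J.
Proof.
move=> a b; apply: smooth_on_eq (smooth_j a 0 b) => // y _.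
by rewrite jacobian_entry.
Qed.

Lemma smooth_T : smooth_mx V T.
Proof. by apply: smooth_mx_row => //; exact: smooth_J. Qed.

Lemma smooth_gphi : smooth_mx V (fun y => g (phi y)).
Proof. exact: smooth_mx_comp g_smooth phi_smooth phiV. Qed.

Lemma smooth_omega : smooth_mx V (fun y => K *m g (phi y)).
Proof. exact: (smooth_mxM Vo (smooth_mx_cst Vo K) smooth_gphi). Qed.

Lemma smooth_conn e : smooth_mx V (fun y => connection_mx g e (phi y)).
Proof. exact: (smooth_mx_comp Vo Uo (smooth_connection_mx e Uo g_unit g_smooth) phi_smooth phiV). Qed.

Lemma smooth_gam a : smooth_mx V (gam a).
Proof.
apply: smooth_mx_sum => // e _; apply: smooth_mxZ => //; first exact: smooth_j.
exact: smooth_conn.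
Qed.

Lemma smooth_kapmu a : smooth_on V (fun y => kap * mu y a 0).
Proof. by apply: smooth_onM => //; exact: smooth_on_cst. Qed.

Lemma smooth_W a : smooth_mx V (W a).
Proof.
apply: (smooth_mx_block Vo); first exact: smooth_mx_cst.
- apply: (smooth_mxZ Vo); first exact: smooth_on_cst.
  exact: (smooth_mxM Vo (smooth_j a) (smooth_mx_cst Vo K)).
- apply: (smooth_mxZ Vo); first exact: smooth_on_cst.
  exact: (smooth_mxM Vo smooth_omega (smooth_mx_tr Vo (smooth_j a))).
- apply: smooth_mxD => //; first exact: smooth_gam.
  by apply: smooth_mxZ => //; [exact: smooth_kapmu|exact: smooth_mx_cst].
Qed.

Lemma smooth_G : smooth_mx V G.
Proof.
have HJ := smooth_J; have Hg := smooth_gphi.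
apply: smooth_mxD => //; apply: smooth_mxZ => //; try exact: smooth_on_cst.
  exact: (smooth_mxM Vo (smooth_mxM Vo HJ Hg) (smooth_mx_tr Vo HJ)).
exact: (smooth_mxM Vo mu_smooth (smooth_mx_tr Vo mu_smooth)).
Qed.

Lemma G_sym y : V y -> (G y)^T = G y.
Proof.
move=> Vy; rewrite /G !(linearD, linearZ) /= !trmx_mul !trmxK g_sym ?mulmxA//.
exact: phiV.
Qed.

Let eta y : 'M[R]_(1 + m) := block_mx w%:M 0 0 (u *: g (phi y)).

Lemma G_frame y : G y = T y *m eta y *m (T y)^T.
Proof.
rewrite /T /eta mul_row_block !mulmx0 addr0 add0r tr_row_mx mul_row_col.
by rewrite mul_mx_scalar -scalemxAr -!scalemxAl addrC.
Qed.

Lemma G_unit y : V y -> G y \in unitmx.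
Proof.
move=> Vy; have gu := g_unit (phiV Vy).
pose eta' : 'M[R]_(1 + m) := block_mx (w^-1)%:M 0 0 (u^-1 *: invmx (g (phi y))).
have EE : eta y *m eta' = 1%:M.
  rewrite mulmx_block !mulmx0 !mul0mx !addr0 add0r -scalar_mxM divff ?lt0r_neq0//.
  rewrite -scalemxAl -scalemxAr scalerA mulmxV// divff ?lt0r_neq0// scale1r.
  by rewrite -scalar_mx_block.
suff : G y *m ((P y)^T *m eta' *m P y) = 1%:M by move=> /mulmx1_unit[].
rewrite G_frame !mulmxA -[_ *m (T y)^T *m _]mulmxA -trmx_mul PT// trmx1 mulmx1.
by rewrite -[_ *m eta y *m _]mulmxA EE mulmx1 TP.
Qed.

Lemma gam_K a y : V y -> gam a y *m K = K *m gam a y.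
Proof.
move=> Vy; rewrite /gam mulmx_suml mulmx_sumr; apply: eq_bigr => e _.
rewrite -scalemxAl -scalemxAr; congr (_ *: _).
apply: (connection_mx_kahler Uo (phiV Vy)) => //; first exact: g_unit (phiV Vy).
by move=> b c d; exact: closed_Kg (phiV Vy).
Qed.

Lemma j_gam a b y : V y -> j b y *m gam a y = j a y *m gam b y.
Proof.
move=> Vy; apply/rowP => d.
have E c e : (j c y *m gam e y) 0 d =
    \sum_i \sum_k j c y 0 i * j e y 0 k * connection_mx g k (phi y) i d.
  rewrite mxE; apply: eq_bigr => i _; rewrite summxE mulr_sumr.
  by apply: eq_bigr => k _; rewrite scalemxE mulrA.
rewrite !E exchange_big/=; apply: eq_bigr => i _; apply: eq_bigr => k _.
rewrite (connection_mx_sym k i d Uo (phiV Vy) g_sym); congr (_ * _); exact: mulrC.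
Qed.

Lemma dmx_gphi a y : V y ->
  dmx a (fun z => g (phi z)) y = gam a y *m g (phi y) + g (phi y) *m (gam a y)^T.
Proof.
move=> Vy; rewrite (dmx_comp Vo Vy a Uo g_smooth phi_smooth (phiV Vy)).
rewrite mulmx_suml linear_sum /= mulmx_sumr -big_split/=; apply: eq_bigr => e _.
rewrite (connection_mx_compat e Uo (phiV Vy) g_sym (g_unit (phiV Vy))).
by rewrite scalerDr linearZ /= -scalemxAl -scalemxAr.
Qed.

Lemma dmx_omega a y : V y ->
  dmx a (fun z => K *m g (phi z)) y =
  gam a y *m (K *m g (phi y)) + K *m g (phi y) *m (gam a y)^T.
Proof.
move=> Vy; rewrite (dmxM Vo Vy a (smooth_mx_cst Vo K) smooth_gphi) dmx_cst mul0mx add0r.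
by rewrite dmx_gphi// mulmxDr !mulmxA gam_K.
Qed.

Lemma dmx_j_sym a b y : V y -> dmx a (j b) y = dmx b (j a) y.
Proof. by move=> Vy; exact: (dmx_comm Vo Vy a b phi_smooth). Qed.

(* [P] is the dual frame of [T], so this is the connection of [G] in coordinates. *)
Let Mtx (a : 'I_N) y : 'M[R]_(N, 1 + m) := dmx a T y + T y *m W a y.

Lemma MtxE a y : Mtx a y =
  row_mx (dmx a mu y + 2^-1 *: (J y *m (K *m g (phi y)) *m (j a y)^T))
    (dmx a J y + (kap *: (mu y *m j a y *m K) + J y *m gam a y
       + (kap * mu y a 0) *: (J y *m K))).
Proof.
rewrite /Mtx /T dmx_row /W /frame_connection mul_row_block mulmx0 add0r add_row_mx.
by rewrite mulmxDr -!scalemxAr !mulmxA !addrA.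
Qed.

Lemma Mtx_sym a b c y : V y -> Mtx a y b c = Mtx b y a c.
Proof.
move=> Vy; rewrite !MtxE -(splitK c); case: (fintype.split c) => d /=.
- rewrite !row_mxEl !(addmxE, scalemxE) !ord1.
  have E e f : (J y *m (K *m g (phi y)) *m (j f y)^T) e 0 =
      (J y *m (K *m g (phi y)) *m (J y)^T) e f.
    by rewrite !mxE; apply: eq_bigr => i _; rewrite !mxE.
  rewrite !E.
  have As : (J y *m (K *m g (phi y)) *m (J y)^T) b a = - (J y *m (K *m g (phi y)) *m (J y)^T) a b.
    have : (J y *m (K *m g (phi y)) *m (J y)^T)^T = - (J y *m (K *m g (phi y)) *m (J y)^T).
      by rewrite trmx_mul trmxK trmx_mul (Kg_tr (g_sym (phiV Vy)) KT (gK (phiV Vy))) mulNmx mulmxN mulmxA.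
    by move=> /matrixP/(_ a b); rewrite mxE oppmxE.
  have := dmu a b Vy; rewrite As => <-; by field.
- rewrite !row_mxEr !(addmxE, scalemxE).
  have dJ e f : dmx e J y f d = dmx e (j f) y 0 d.
    by rewrite !dmxE; apply: eq_derive => z; rewrite jacobian_entry.
  have mj e f : (mu y *m j e y *m K) f d = mu y f 0 * (j e y *m K) 0 d.
    by rewrite -mulmxA mxE big_ord1.
  have Jx (X : 'M[R]_m) e : (J y *m X) e d = (j e y *m X) 0 d.
    exact: jacobian_mul.
  rewrite !dJ (dmx_j_sym a b Vy) !mj !Jx (j_gam a b Vy).
  by rewrite !mulrA; ring.
Qed.

Lemma connection_G a y : V y -> connection_mx G a y = Mtx a y *m P y.
Proof.
move=> Vy; apply: (connection_mx_unique (Gam := fun a => Mtx a y *m P y)).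
- exact: G_unit.
- exact: G_sym.
- by move=> e b c; rewrite !mxE; apply: eq_bigr => i _; rewrite Mtx_sym.
move=> e; rewrite G_frame !mulmxA -[Mtx e y *m P y *m T y]mulmxA PT// mulmx1.
have -> : T y *m eta y *m (T y)^T *m (Mtx e y *m P y)^T =
    T y *m eta y *m (Mtx e y)^T.
  by rewrite -[LHS]mulmxA -trmx_mul -[Mtx e y *m P y *m T y]mulmxA PT// mulmx1.
have Heta : smooth_mx V eta.
  apply: (smooth_mx_block Vo (smooth_mx_cst Vo _) (smooth_mx_cst Vo _) (smooth_mx_cst Vo _)).
  exact: (smooth_mxZ Vo (smooth_on_cst Vo u) smooth_gphi).
have HT := smooth_T.
have -> : dmx e G y = dmx e (fun z => T z *m eta z *m (T z)^T) y.
  by apply: (dmx_eq Vo Vy) => z _; exact: G_frame.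
rewrite (dmxM Vo Vy e (smooth_mxM Vo HT Heta) (smooth_mx_tr Vo HT)) (dmxM Vo Vy e HT Heta).
rewrite dmx_tr /Mtx.
have -> : dmx e eta y = W e y *m eta y + eta y *m (W e y)^T.
  have -> : dmx e eta y = block_mx 0 0 0 (u *: dmx e (fun z => g (phi z)) y).
    rewrite dmx_block !dmx_cst (dmxZ Vo Vy e (smooth_on_cst Vo u) smooth_gphi).
    by rewrite derive_cst scale0r add0r.
  rewrite dmx_gphi//; apply: frame_connection_compat; [exact: g_sym (phiV Vy)|exact: KT|exact: gK (phiV Vy)|].
  by rewrite /kap; field; rewrite lt0r_neq0.
move: (dmx e T y) (T y) (W e y) (eta y) => X1 X2 X3 X4.
rewrite trmxD trmx_mul !(mulmxDr, mulmxDl) !mulmxA.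
by rewrite !addrA [RHS]addrAC.
Qed.

Lemma connection_GT a y : V y -> connection_mx G a y *m T y = dmx a T y + T y *m W a y.
Proof. by move=> Vy; rewrite connection_G// -mulmxA PT// mulmx1. Qed.

Let Rm (a b : 'I_N) y : 'M[R]_m :=
  \sum_c \sum_d (j a y 0 c * j b y 0 d) *: curvature_mx (connection_mx g) c d (phi y).

Lemma dmx_gam a b y : V y -> dmx a (gam b) y =
  \sum_d (dmx a (j b) y 0 d *: connection_mx g d (phi y)
          + j b y 0 d *: \sum_c j a y 0 c *: dmx c (connection_mx g d) (phi y)).
Proof.
move=> Vy.
have Hc d := smooth_mxZ Vo (smooth_j b 0 d) (smooth_conn d).
rewrite (dmx_sum Vo Vy a Hc); apply: eq_bigr => d _.
rewrite (dmxZ Vo Vy a (smooth_j b 0 d) (smooth_conn d)) -dmxE; congr (_ + _ *: _).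
exact: (dmx_comp Vo Vy a Uo (smooth_connection_mx d Uo g_unit g_smooth) phi_smooth (phiV Vy)).
Qed.

Lemma RmE a b y : V y -> Rm a b y = dmx a (gam b) y - dmx b (gam a) y
  + gam b y *m gam a y - gam a y *m gam b y.
Proof.
move=> Vy; rewrite !dmx_gam// (dmx_j_sym b a Vy).
have E1 c e : gam c y *m gam e y = \sum_i \sum_k (j e y 0 i * j c y 0 k) *:
    (connection_mx g k (phi y) *m connection_mx g i (phi y)).
  rewrite /gam mulmx_sumr; apply: eq_bigr => i _.
  rewrite mulmx_suml; apply: eq_bigr => k _.
  by rewrite -scalemxAl -scalemxAr !scalerA mulrC.
have E2 : gam a y *m gam b y = \sum_i \sum_k (j a y 0 i * j b y 0 k) *:
    (connection_mx g i (phi y) *m connection_mx g k (phi y)).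
  rewrite E1 exchange_big/=; apply: eq_bigr => i _; apply: eq_bigr => k _.
  by rewrite mulrC.
rewrite [gam b y *m _]E1 E2 !big_split/= opprD addrACA subrr add0r.
have -> : \sum_d j b y 0 d *: \sum_c j a y 0 c *: dmx c (connection_mx g d) (phi y) =
    \sum_c \sum_d (j a y 0 c * j b y 0 d) *: dmx c (connection_mx g d) (phi y).
  rewrite exchange_big/=; apply: eq_bigr => d _; rewrite scaler_sumr; apply: eq_bigr => c _.
  by rewrite scalerA mulrC.
have -> : \sum_d j a y 0 d *: \sum_c j b y 0 c *: dmx c (connection_mx g d) (phi y) =
    \sum_c \sum_d (j a y 0 c * j b y 0 d) *: dmx d (connection_mx g c) (phi y).
  by apply: eq_bigr => d _; rewrite scaler_sumr; apply: eq_bigr => c _; rewrite scalerA.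
rewrite -sumrB -big_split -sumrB /=; apply: eq_bigr => c _.
rewrite -sumrB -big_split -sumrB /=; apply: eq_bigr => d _.
by rewrite /curvature_mx !scalerDr !scalerN.
Qed.

Lemma dmx_W a b y : V y -> dmx a (W b) y =
  block_mx 0 (kap *: (dmx a (j b) y *m K))
    (2^-1 *: ((gam a y *m (K *m g (phi y)) + K *m g (phi y) *m (gam a y)^T) *m (j b y)^T
              + K *m g (phi y) *m (dmx a (j b) y)^T))
    (dmx a (gam b) y + (kap * dmx a mu y b 0) *: K).
Proof.
move=> Vy; rewrite /W /frame_connection dmx_block dmx_cst.
have Hj := smooth_j b; have HK := smooth_mx_cst Vo K; have Ho := smooth_omega.
have HjT := smooth_mx_tr Vo Hj.
congr block_mx.
- rewrite (dmxZ Vo Vy a (smooth_on_cst Vo kap) (smooth_mxM Vo Hj HK)).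
  by rewrite derive_cst scale0r add0r (dmxM Vo Vy a Hj HK) dmx_cst mulmx0 addr0.
- rewrite (dmxZ Vo Vy a (smooth_on_cst Vo 2^-1) (smooth_mxM Vo Ho HjT)).
  by rewrite derive_cst scale0r add0r (dmxM Vo Vy a Ho HjT) dmx_omega// dmx_tr.
- rewrite (dmxD Vo Vy a (smooth_gam b) (smooth_mxZ Vo (smooth_kapmu b) HK)).
  rewrite (dmxZ Vo Vy a (smooth_kapmu b) HK) dmx_cst scaler0 addr0.
  congr (_ + _ *: _); rewrite dmxE.
  have := deriveZ kap (smooth_on_derivable Vo Vy (v := delta_mx 0 a) (mu_smooth b 0)).
  by [].
Qed.

Lemma curvature_W a b y : V y -> curvature_mx W a b y =
  frame_curvature (g (phi y)) K kap (j a y) (j b y) (mu y a 0) (mu y b 0) (Rm a b y).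
Proof.
move=> Vy; rewrite RmE// /curvature_mx !dmx_W// (dmx_j_sym b a Vy).
apply: frame_curvatureE => //.
- exact: g_sym (phiV Vy).
- exact: gam_K.
- exact: gam_K.
- exact: j_gam.
- by rewrite dmu// jacobian_quad.
Qed.

Lemma curvature_G a b y : V y ->
  curvature_mx (connection_mx G) a b y = T y *m curvature_mx W a b y *m P y.
Proof.
move=> Vy; rewrite -(curvature_mx_gauge a b Vo Vy (fun c => smooth_connection_mx c Vo G_unit smooth_G)
  smooth_W smooth_T (fun c x Vx => connection_GT c Vx)).
by rewrite -mulmxA TP// mulmx1.
Qed.

Lemma ricci_G lam y : V y -> ricci_mx g (phi y) = lam *: g (phi y) ->
  ricci_mx G y = (lam - kap) *: (J y *m g (phi y) *m (J y)^T)
    + (kap ^+ 2 * m%:R) *: (mu y *m (mu y)^T).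
Proof.
move=> Vy ric; apply/matrixP => b c; rewrite mxE.
pose Rl (v : 'rV[R]_m) : 'M[R]_m := \sum_i \sum_k (v 0 i * j b y 0 k) *:
  curvature_mx (connection_mx g) i k (phi y).
pose L (t : 'rV[R]_(1 + m)) : 'M[R]_(1 + m) :=
  frame_curvature (g (phi y)) K kap (rsubmx t) (j b y) (lsubmx t 0 0) (mu y b 0) (Rl (rsubmx t)).
have Rl_lin k v v' : Rl (k *: v + v') = k *: Rl v + Rl v'.
  rewrite /Rl scaler_sumr -big_split/=; apply: eq_bigr => i _.
  rewrite scaler_sumr -big_split/=; apply: eq_bigr => e _.
  by rewrite scalerA -scalerDl !mxE mulrDl mulrA.
have L_lin : linear L.
  by move=> k s t; rewrite /L [rsubmx _]linearP [lsubmx _]linearP /= addmxE scalemxE Rl_lin frame_curvature_linear.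
have LT a : L (row a (T y)) =
    frame_curvature (g (phi y)) K kap (j a y) (j b y) (mu y a 0) (mu y b 0) (Rm a b y).
  have E1 : rsubmx (row a (T y)) = j a y by rewrite /T row_row_mx row_mxKr row_jacobian.
  have E2 : lsubmx (row a (T y)) 0 0 = mu y a 0 by rewrite /T row_row_mx row_mxKl mxE.
  by rewrite /L E1 E2.
have -> : \sum_a curvature_mx (connection_mx G) a b y c a =
    \sum_a (T y *m L (row a (T y)) *m P y) c a.
  by apply: eq_bigr => a _; rewrite (curvature_G a b Vy) (curvature_W a b Vy) LT.
apply: etrans (contract_frame c L_lin (PT Vy)) _; rewrite big_split_ord big_ord1.
pose q := (J y *m g (phi y) *m (j b y)^T) c 0.
have r0 : rsubmx (delta_mx 0 (lshift m ord0) : 'rV[R]_(1 + m)) = 0.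
  by apply/rowP => e; rewrite !mxE eq_rlshift andbF.
have l0 : lsubmx (delta_mx 0 (lshift m ord0) : 'rV[R]_(1 + m)) 0 0 = 1.
  by rewrite !mxE !eqxx.
have rE i : rsubmx (delta_mx 0 (rshift 1 i) : 'rV[R]_(1 + m)) = delta_mx 0 i.
  by apply/rowP => e; rewrite !mxE eq_rshift.
have lE i : lsubmx (delta_mx 0 (rshift 1 i) : 'rV[R]_(1 + m)) 0 0 = 0.
  by rewrite !mxE eq_lrshift andbF.
have RlE i : Rl (delta_mx 0 i) = \sum_k j b y 0 k *: curvature_mx (connection_mx g) i k (phi y).
  rewrite /Rl (bigD1 i)//= [X in _ + X = _]big1 ?addr0 => [|i' i'i].
    by apply: eq_bigr => k _; rewrite mxE !eqxx mul1r.
  by apply: big1 => k _; rewrite mxE (negbTE i'i) andbF mul0r scale0r.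
have HR : \sum_i (J y *m Rl (delta_mx 0 i)) c i = lam * q.
  transitivity (\sum_e J y c e * (\sum_k j b y 0 k * ricci_mx g (phi y) k e)).
    transitivity (\sum_i \sum_e J y c e * Rl (delta_mx 0 i) e i).
      by apply: eq_bigr => i _; rewrite mxE.
    rewrite exchange_big/=; apply: eq_bigr => e _; rewrite -mulr_sumr; congr (_ * _).
    transitivity (\sum_i \sum_k j b y 0 k * curvature_mx (connection_mx g) i k (phi y) e i).
      apply: eq_bigr => i _; rewrite RlE summxE; apply: eq_bigr => k _.
      exact: scalemxE.
    rewrite exchange_big/=; apply: eq_bigr => k _; rewrite -mulr_sumr; congr (_ * _).
    by rewrite [RHS]mxE.
  rewrite /q -mulmxA [in RHS]mxE mulr_sumr; apply: eq_bigr => e _.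
  rewrite [in RHS]mulrCA; congr (_ * _); rewrite [in RHS]mxE mulr_sumr; apply: eq_bigr => k _.
  rewrite ric scalemxE [((j b y)^T) k 0]mxE -{1}(g_sym (phiV Vy)) mxE; ring.
have F0 : (T y *m L (delta_mx 0 (lshift m ord0))) c (lshift m ord0) = kap / 2 * q.
  rewrite /L r0 l0; exact: frame_trace_fiber.
have F1 : \sum_(i < m) (T y *m L (delta_mx 0 (rshift 1 i))) c (rshift 1 i) =
    kap ^+ 2 * m%:R * (mu y c 0 * mu y b 0) + lam * q - (kap + kap / 2) * q.
  rewrite -HR -(frame_trace_base kap KK KT (gK (phiV Vy)) (J y) (mu y) (j b y) (mu y b 0)
    (fun i => Rl (delta_mx 0 i)) c).
  by apply: eq_bigr => i _; rewrite /L rE lE.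
apply: etrans (congr2 +%R F0 F1) _.
have qE : (J y *m g (phi y) *m (J y)^T) b c = q.
  have : (J y *m g (phi y) *m (J y)^T)^T = J y *m g (phi y) *m (J y)^T.
    by rewrite trmx_mul trmxK trmx_mul (g_sym (phiV Vy)) mulmxA.
  by move=> /matrixP/(_ c b); rewrite mxE => ->; rewrite /q jacobian_col.
have mE : (mu y *m (mu y)^T) b c = mu y b 0 * mu y c 0.
  by rewrite mxE big_ord1 [(_^T) 0 c]mxE.
rewrite !(addmxE, scalemxE) qE mE; by field.
Qed.

End BundleMetric.

(** * Charts and principal bundles *)

Definition chart_axioms (R : realType) (m : nat) (M : topologicalType)
    (A : atlas R m M) (i : chart_index A) : Prop :=
  [/\ open (dom i),
      open (coord i @` dom i),
      forall p, dom i p -> param i (coord i p) = p &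
      forall p, dom i p -> {for coord i p, continuous (param i)}].

Lemma smooth_manifold_chart (R : realType) (m : nat) (M : topologicalType)
    (A : atlas R m M) (i : chart_index A) : smooth_manifold A -> chart_axioms i.
Proof. by move=> [_ _ _ H _]; have [? ? ? _ ?] := H i; split. Qed.

Section Charts.
Variables (R : realType) (m : nat) (M : topologicalType) (A : atlas R m M).
Implicit Types (i : chart_index A) (p : M).

Lemma near_param i p (W : set M) : chart_axioms i -> dom i p -> open W -> W p ->
  \forall x \near coord i p,
    exists q, [/\ dom i q, W q, param i x = q & coord i q = x].
Proof.
move=> [_ Co pK pc] ip Wo Wp.
have H1 : \forall x \near coord i p, W (param i x).
  apply: (pc _ ip); rewrite pK//; exact: open_nbhs_nbhs.
have H2 : \forall x \near coord i p, (coord i @` dom i) x.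
  by apply: open_nbhs_nbhs; split => //; exists p.
apply: filterS2 H1 H2 => x Wx [q iq qx]; exists q.
by split => //; rewrite -qx pK// in Wx *.
Qed.

Lemma open_chart_image i (W : set M) : chart_axioms i -> open W ->
  open (coord i @` (dom i `&` W)).
Proof.
move=> Ci Wo; rewrite openE => _ [p [ip Wp] <-].
apply: filterS (near_param Ci ip Wo Wp) => x [q [iq Wq _ qx]].
by exists q.
Qed.

End Charts.

Lemma prod_line_chart (R : realType) (m : nat) (M : topologicalType)
    (A : atlas R m M) (i : chart_index A) :
  chart_axioms i -> chart_axioms (A := prod_line_atlas A) i.
Proof.
move=> [Do Co pK pc]; split.
- have -> : @dom _ _ _ (prod_line_atlas A) i = fst @^-1` dom i by [].
  by apply: open_comp => // -[q t] _; exact: cvg_fst.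
- have -> : @coord _ _ _ (prod_line_atlas A) i @` @dom _ _ _ (prod_line_atlas A) i =
      lsubmx @^-1` (coord i @` dom i).
    apply/seteqP; split => [_ [[q t] /= iq <-]|x [q iq qx]].
      by exists q; rewrite ?row_mxKl.
    exists (q, rsubmx x 0 0) => //=; rewrite qx -[RHS]hsubmxK; congr row_mx.
    by apply/matrixP => a b; rewrite mxE !ord1 eqxx mulr1n.
  by apply: open_comp => // x _; exact: differentiable_continuous (differentiable_lsubmx _).
- by move=> [q t] /= iq; rewrite row_mxKl row_mxKr pK// mxE eqxx mulr1n.
- move=> [q t] iq; set x := @coord _ _ _ (prod_line_atlas A) i (q, t).
  have c1 : {for x, continuous (param i \o lsubmx)}.
    apply: (@continuous_comp _ _ _ lsubmx (param i)); first exact: continuous_lsubmx.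
    by rewrite /x /= row_mxKl; exact: pc.
  have c2 : {for x, continuous ((fun X : 'M[R]_1 => X 0 0) \o rsubmx)}.
    apply: (@continuous_comp _ _ _ rsubmx (fun X : 'M[R]_1 => X 0 0)).
      exact: continuous_rsubmx.
    exact: coord_continuous.
  exact: (cvg_pair c1 c2).
Qed.

Section SmoothMaps.
Variables (R : realType) (m k : nat) (M N : topologicalType).
Variables (A : atlas R m M) (B : atlas R k N).
Implicit Types (i : chart_index A) (j : chart_index B) (F : M -> N).

Lemma open_preimage_on (U : set M) (W : set N) F : open U -> open W ->
  (forall p, U p -> {for p, continuous F}) -> open (U `&` F @^-1` W).
Proof.
move=> Uo Wo Fc; rewrite openE => p [Up Wp]; apply: filterI.
  exact: open_nbhs_nbhs.
by apply: (Fc _ Up); exact: open_nbhs_nbhs.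
Qed.

Lemma smooth_map_open (U : set M) F i j : chart_axioms i -> chart_axioms j ->
  open U -> smooth_map A B U F ->
  open (coord i @` (dom i `&` U `&` F @^-1` dom j)).
Proof.
move=> Ci [Dj _ _ _] Uo [Fc _]; rewrite -setIA; apply: open_chart_image => //.
exact: open_preimage_on.
Qed.

Lemma smooth_map_differentiable (U : set M) F i j p b :
  chart_axioms i -> chart_axioms j -> open U -> smooth_map A B U F ->
  U p -> dom i p -> dom j (F p) ->
  differentiable (fun x => coord j (F (param i x)) 0 b) (coord i p).
Proof.
move=> Ci Cj Uo HF Up ip jp.
apply: (smooth_on_differentiable (smooth_map_open Ci Cj Uo HF) (HF.2 i j b)).
by exists p.
Qed.

Lemma near_dom (U : set M) F i j p : chart_axioms i -> chart_axioms j ->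
  open U -> smooth_map A B U F -> U p -> dom i p -> dom j (F p) ->
  \forall x \near coord i p, exists q, [/\ dom i q, U q, dom j (F q), param i x = q & coord i q = x].
Proof.
move=> Ci [Dj _ _ _] Uo [Fc _] Up ip jp.
apply: filterS (near_param Ci ip (open_preimage_on Uo Dj Fc) (conj Up jp)) => x.
by move=> [q [iq [Uq jq] xq qx]]; exists q.
Qed.

Lemma jac_eq (F F' : M -> N) (i : chart_index A) j p :
  (\forall x \near coord i p, F (param i x) = F' (param i x)) ->
  jac i j F p = jac i j F' p.
Proof.
move=> E; apply/matrixP => a b; rewrite !mxE; apply: near_eq_derive.
by apply: filterS E => x /= ->.
Qed.

End SmoothMaps.

Lemma jac_comp (R : realType) (m k l : nat) (M N P : topologicalType)
    (A : atlas R m M) (B : atlas R k N) (C : atlas R l P) (F : M -> N) (H : N -> P)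
    (i : chart_index A) (j : chart_index B) (h : chart_index C) (p : M) :
  chart_axioms i -> chart_axioms j -> dom i p ->
  (forall b, differentiable (fun x => coord j (F (param i x)) 0 b) (coord i p)) ->
  (forall c, differentiable (fun y => coord h (H (param j y)) 0 c) (coord j (F p))) ->
  (\forall x \near coord i p, dom j (F (param i x))) ->
  jac i h (H \o F) p = jac i j F p *m jac j h H (F p).
Proof.
move=> [_ _ pKi _] [_ _ pKj _] ip dF dH near_j.
apply/matrixP => a c; rewrite !mxE.
pose phi x := coord j (F (param i x)); pose psi y := coord h (H (param j y)) 0 c.
have -> : pd i a (fun q => coord h ((H \o F) q) 0 c) p =
    'D_(delta_mx 0 a) (psi \o phi) (coord i p).
  apply: near_eq_derive; apply: filterS near_j => x jx.
  by rewrite /psi /phi /= pKj.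
rewrite chain_derive; first last.
- by rewrite /phi pKi//; exact: dH.
- exact: dF.
apply: eq_bigr => b _; rewrite !mxE /pd /phi pKi//.
Qed.

Lemma derive_coord (R : realType) (m : nat) (y v : 'rV[R]_m) b :
  'D_v (fun x : 'rV[R]_m => x 0 b) y = v 0 b.
Proof.
have H : derivable (@id 'rV[R]_m) y v by exact: derivable_id.
have := derive_mx H; rewrite derive_id => /matrixP/(_ 0 b).
by rewrite [X in _ = X]mxE => ->.
Qed.

Lemma jac_id (R : realType) (m : nat) (M : topologicalType) (A : atlas R m M)
    (i : chart_index A) p : chart_axioms i -> dom i p -> jac i i id p = 1%:M.
Proof.
move=> Ci ip; apply/matrixP => a b; rewrite !mxE.
transitivity ('D_(delta_mx 0 a) (fun x : 'rV[R]_m => x 0 b) (coord i p)).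
  apply: near_eq_derive; apply: filterS (near_param Ci ip openT I) => x.
  by move=> [q [_ _ xq qx]] /=; rewrite xq qx.
by rewrite derive_coord mxE eqxx eq_sym.
Qed.

Section PrincipalBundle.
Variables (R : realType) (m k : nat) (M E : topologicalType).
Variables (A : atlas R m M) (B : atlas R k E) (ell : R) (proj : E -> M).
Variable act : R -> E -> E.
Hypotheses (manifoldM : smooth_manifold A) (manifoldE : smooth_manifold B).
Hypothesis bundleE : principal_bundle A B ell proj act.
Implicit Types (i : chart_index B) (j : chart_index A) (e : E).

Let chM j := smooth_manifold_chart j manifoldM.
Let chE i := smooth_manifold_chart i manifoldE.

Lemma proj_act theta e : proj (act theta e) = proj e.
Proof.
have [_ _ _ [H _] _] := bundleE; apply/esym.
by apply/(H e (act theta e)); exists theta.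
Qed.

Lemma act_joint_differentiable i i' e theta b : dom i e -> dom i' (act theta e) ->
  differentiable (fun z : 'rV[R]_(k + 1) =>
    coord i' (act (rsubmx z 0 0) (param i (lsubmx z))) 0 b)
    (row_mx (coord i e) theta%:M).
Proof.
move=> ie ie'; have [_ Hact _ _ _] := bundleE.
exact: (@smooth_map_differentiable _ _ _ _ _ (prod_line_atlas B) B setT
  (fun q : E * R => act q.2 q.1) i i' (e, theta) b
  (prod_line_chart (chE i)) (chE i') openT Hact I ie ie').
Qed.

Lemma act_differentiable i i' e theta b : dom i e -> dom i' (act theta e) ->
  differentiable (fun x => coord i' (act theta (param i x)) 0 b) (coord i e).
Proof.
move=> ie ie'; have := act_joint_differentiable b ie ie'.
set h := (fun z => _); pose phi (x : 'rV[R]_k) : 'rV[R]_(k + 1) := row_mx x theta%:M.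
rewrite -/(phi (coord i e)) => dh.
have -> : (fun x => coord i' (act theta (param i x)) 0 b) = h \o phi.
  by apply/funext => x; rewrite /h /phi /= row_mxKl row_mxKr mxE eqxx mulr1n.
apply: chain_differentiable => // c; rewrite -(splitK c); case: (fintype.split c) => d /=.
  have -> : (fun y => phi y 0 (lshift 1 d)) = (fun y : 'rV[R]_k => y 0 d).
    by apply/funext => y; rewrite /phi row_mxEl.
  exact: differentiable_coord.
have -> : (fun y => phi y 0 (rshift k d)) = cst ((theta%:M : 'M[R]_1) 0 d).
  by apply/funext => y; rewrite /phi row_mxEr.
exact: differentiable_cst.
Qed.

Lemma orbit_differentiable i e b : dom i e -> dom i (act 0 e) ->
  differentiable (fun theta : R => coord i (act theta e) 0 b) 0.
Proof.
move=> ie ie'; have := act_joint_differentiable b ie ie'.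
set h := (fun z => _); pose phi (t : R) : 'rV[R]_(k + 1) := row_mx (coord i e) t%:M.
rewrite -/(phi 0) => dh; have [_ _ pK _] := chE i.
have -> : (fun theta => coord i (act theta e) 0 b) = h \o phi.
  by apply/funext => x; rewrite /h /phi /= row_mxKl row_mxKr mxE eqxx mulr1n pK.
apply: chain_differentiable => // c; rewrite -(splitK c); case: (fintype.split c) => d /=.
  have -> : (fun y => phi y 0 (lshift 1 d)) = cst (coord i e 0 d).
    by apply/funext => y; rewrite /phi row_mxEl.
  exact: differentiable_cst.
have -> : (fun y => phi y 0 (rshift k d)) = id.
  by apply/funext => y; rewrite /phi row_mxEr !ord1 mxE eqxx mulr1n.
exact: ex_diff.
Qed.

Lemma act_continuous theta e : {for e, continuous (act theta)}.
Proof.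
have [_ [Hc _] _ _ _] := bundleE.
have c1 : {for e, continuous (fun q : E => (q, theta))}.
  have a1 : {for e, continuous (@id E)} by exact: cvg_id.
  have a2 : {for e, continuous (fun=> theta : R)} by exact: cvg_cst.
  exact: (cvg_pair a1 a2).
exact: (continuous_comp c1 (Hc (e, theta) I)).
Qed.

Lemma orbit_continuous e theta : {for theta, continuous (fun t : R => act t e)}.
Proof.
have [_ [Hc _] _ _ _] := bundleE.
have c1 : {for theta, continuous (fun t : R => (e, t))}.
  have a1 : {for theta, continuous (@id R)} by exact: cvg_id.
  have a2 : {for theta, continuous (fun=> e : E)} by exact: cvg_cst.
  exact: (cvg_pair a2 a1).
exact: (continuous_comp c1 (Hc (e, theta) I)).
Qed.

Lemma proj_differentiable i j e b : dom i e -> dom j (proj e) ->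
  differentiable (fun x => coord j (proj (param i x)) 0 b) (coord i e).
Proof.
have [Hp _ _ _ _] := bundleE.
exact: (smooth_map_differentiable b (chE i) (chM j) openT Hp I).
Qed.

Lemma fundamental_field_vertical i j e : dom i e -> dom j (proj e) ->
  fundamental_field act i e *m jac i j proj e = 0.
Proof.
move=> ie je; have [_ _ [act0 _] _ _] := bundleE; have [Di _ pK _] := chE i.
have ie0 : dom i (act 0 e) by rewrite act0.
apply/rowP => b; rewrite mxE [RHS]mxE.
pose phi (t : R) := coord i (act t e); pose h x := coord j (proj (param i x)) 0 b.
transitivity ('D_1 (h \o phi) (0 : R)).
  rewrite chain_derive.
  - apply: eq_bigr => a _; rewrite /phi act0 !mxE; congr (_ * _).
  - by move=> c; exact: orbit_differentiable.
  - by rewrite /phi act0; exact: proj_differentiable.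
transitivity ('D_1 (cst (coord j (proj e) 0 b)) (0 : R)); last exact: derive_cst.
apply: near_eq_derive.
have : \forall t \near (0 : R), dom i (act t e).
  by apply: orbit_continuous; apply: open_nbhs_nbhs.
by apply: filterS => t it; rewrite /h /phi /= pK// proj_act.
Qed.

Lemma jac_proj_left_inverse i j e : dom i e -> dom j (proj e) ->
  exists S : 'M[R]_(m, k), S *m jac i j proj e = 1%:M.
Proof.
move=> ie je; have [Hp _ _ _ loc] := bundleE.
have [U [sigma [Uo Up Hs projs lift]]] := loc (proj e).
have [W [theta [_ We _ act_s]]] := lift _ Up.
have [_ actE] := act_s _ We; set c := theta e in actE; set p := proj e in je Up actE.
have [_ _ dom_at _ _] := manifoldE; pose h := chart_at B (sigma p).
have hs : dom h (sigma p) := dom_at _.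
exists (jac j h sigma p *m jac h i (act c) (sigma p)).
have iact : dom i (act c (sigma p)) by rewrite actE.
have E1 : jac h i (act c) (sigma p) *m jac i j proj e = jac h j proj (sigma p).
  rewrite -{1}actE -(jac_comp (chE h) (chE i) hs).
  - by apply: jac_eq; near=> x; rewrite /= proj_act.
  - by move=> b; exact: act_differentiable.
  - by move=> b; rewrite actE; exact: proj_differentiable.
  have [Di _ _ _] := chE i; have [_ _ pKh pch] := chE h.
  have cc : {for coord h (sigma p), continuous (act c \o param h)}.
    apply: (@continuous_comp _ _ _ (param h)); first exact: pch.
    by rewrite pKh//; exact: act_continuous.
  by apply: cc => /=; apply: open_nbhs_nbhs; rewrite pKh.
rewrite -mulmxA E1 -(jac_comp (chM j) (chE h) je).
- rewrite -(jac_id (chM j) je); apply: jac_eq.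
  apply: filterS (near_dom (chM j) (chE h) Uo Hs Up je hs) => x [q [_ Uq _ -> _]].
  by rewrite /= projs.
- by move=> b; exact: (smooth_map_differentiable b (chM j) (chE h) Uo Hs Up je hs).
- by move=> b; apply: proj_differentiable => //; rewrite projs.
- apply: filterS (near_dom (chM j) (chE h) Uo Hs Up je hs) => x [q [_ _ hq -> _]].
  exact: hq.
Unshelve. all: by end_near. Qed.

Lemma proj_surjective p : exists e, proj e = p.
Proof.
have [_ _ _ _ loc] := bundleE; have [U [sigma [_ Up _ projs _]]] := loc p.
by exists (sigma p); exact: projs.
Qed.

End PrincipalBundle.

Lemma frame_unit (R : realType) (m : nat) (xi : 'rV[R]_(m.+1)) (S : 'M[R]_(m, m.+1))
    (mu : 'cV[R]_(m.+1)) (J : 'M[R]_(m.+1, m)) :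
  (xi *m mu) 0 0 = 1 -> xi *m J = 0 -> S *m J = 1%:M ->
  (row_mx mu J : 'M[R]_(1 + m)) \in unitmx.
Proof.
move=> xmu xJ SJ; pose X : 'M[R]_(1 + m) := col_mx xi S.
have : X *m (row_mx mu J : 'M[R]_(1 + m)) \in unitmx.
  rewrite unitmxE mul_col_row xJ SJ det_lblock det1 mulr1 det_mx11 xmu.
  exact: unitr1.
by rewrite unitmx_mul => /andP[].
Qed.

(** * Ricci curvature of the bundle metric *)

Lemma connection_mx_eq (R : realType) (N : nat) (V : set 'rV[R]_N)
    (G G' : 'rV[R]_N -> 'M[R]_N) y a : open V -> V y ->
  (forall x, V x -> G x = G' x) -> connection_mx G a y = connection_mx G' a y.
Proof.
move=> Vo Vy E; apply/matrixP => b c; rewrite !mxE; apply: eq_bigr => d _.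
by rewrite /christoffel1 E// !(dmx_eq Vo Vy _ E).
Qed.

Lemma curvature_mx_eq (R : realType) (N k : nat) (V : set 'rV[R]_N)
    (W W' : 'I_N -> 'rV[R]_N -> 'M[R]_k) y a b : open V -> V y ->
  (forall c x, V x -> W c x = W' c x) -> curvature_mx W a b y = curvature_mx W' a b y.
Proof.
move=> Vo Vy E; rewrite /curvature_mx !(E _ _ Vy).
by rewrite (dmx_eq Vo Vy a (E b)) (dmx_eq Vo Vy b (E a)).
Qed.

Lemma ricci_mx_eq (R : realType) (N : nat) (V : set 'rV[R]_N)
    (G G' : 'rV[R]_N -> 'M[R]_N) y : open V -> V y ->
  (forall x, V x -> G x = G' x) -> ricci_mx G y = ricci_mx G' y.
Proof.
move=> Vo Vy E; apply/matrixP => b c; rewrite !mxE; apply: eq_bigr => a _.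
rewrite (curvature_mx_eq (W' := connection_mx G') a b Vo Vy)// => d x Vx.
exact: connection_mx_eq Vo Vx E.
Qed.

Lemma ricciE (R : realType) (m : nat) (M : topologicalType) (A : atlas R m M)
    (g : field2 A) i p : chart_axioms i -> dom i p ->
  ricci g i p = ricci_mx (fun x => g i (param i x)) (coord i p).
Proof.
move=> Ci ip; set G := fun x => _; have [_ Co pK _] := Ci.
have chr c a b q : dom i q -> christoffel g i c a b q = connection_mx G a (coord i q) b c.
  move=> iq; rewrite mxE /christoffel mulr_sumr; apply: eq_bigr => d _.
  by rewrite /christoffel1 !dmxE /G pK// mulrCA.
have pdchr a c b d : pd i a (christoffel g i c b d) p = dmx a (connection_mx G b) (coord i p) d c.
  rewrite dmxE; apply: (eq_on_derive _ Co); first by exists p.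
  by move=> _ [q iq <-]; rewrite /= pK// chr.
apply/matrixP => b c; rewrite !mxE; apply: eq_bigr => a _.
rewrite /riemann /curvature_mx !pdchr !(addmxE, oppmxE) -addrA; congr (_ + _).
rewrite big_split/= sumrN; congr (_ - _).
  by rewrite mxE; apply: eq_bigr => e _; rewrite !chr// mulrC.
by rewrite mxE; apply: eq_bigr => e _; rewrite !chr// mulrC.
Qed.

Lemma pos_def_unit (R : realType) (m : nat) (g : 'M[R]_m) :
  (forall v : 'rV[R]_m, v != 0 -> 0 < (v *m g *m v^T) 0 0) -> g \in unitmx.
Proof.
move=> H; rewrite unitmxE unitfE; apply/negP => /det0P[v v0 vg].
by have := H v v0; rewrite vg mul0mx mxE ltxx.
Qed.

Lemma J0_square (R : realType) (n : nat) : J0 R n *m J0 R n = - 1%:M.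
Proof.
rewrite /J0 mulmx_block !(mul0mx, mulmx0, mul1mx, mulmx1, add0r, addr0).
by rewrite [in RHS](scalar_mx_block n n) opp_block_mx oppr0.
Qed.

Lemma J0_tr (R : realType) (n : nat) : (J0 R n)^T = - J0 R n.
Proof. by rewrite /J0 tr_block_mx opp_block_mx !trmx0 oppr0 linearN /= trmx1 opprK. Qed.

Lemma frame_quadratic_form (R : realType) (k d : nat) (J : 'M[R]_(k, d)) (g : 'M[R]_d)
    (m : 'cV[R]_k) (c w : R) (v : 'rV[R]_k) :
  (v *m (c *: (J *m g *m J^T) + w *: (m *m m^T)) *m v^T) 0 0 =
  c * ((v *m J) *m g *m (v *m J)^T) 0 0 + w * (v *m m) 0 0 ^+ 2.
Proof.
rewrite mulmxDr mulmxDl -!scalemxAr -!scalemxAl addmxE !scalemxE.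
have -> : v *m (m *m m^T) *m v^T = (v *m m) *m (v *m m)^T by rewrite trmx_mul !mulmxA.
have -> : v *m (J *m g *m J^T) *m v^T = (v *m J) *m g *m (v *m J)^T.
  by rewrite trmx_mul !mulmxA.
by congr (_ + w * _); rewrite mxE big_ord1 [(_^T) 0 0]mxE expr2.
Qed.

Section KahlerBundle.
Variables (R : realType) (n : nat) (M E : topologicalType).
Variables (A : atlas R (n + n) M) (B : atlas R (n + n).+1 E).
Variables (g0 omega : field2 A) (lam ell : R).
Variables (proj : E -> M) (act : R -> E -> E) (mu : field1 B).
Hypotheses (kahlerM : kahler_manifold g0 omega) (einsteinM : einstein g0 lam).
Hypothesis manifoldE : smooth_manifold B.
Hypothesis bundleE : principal_bundle A B ell proj act.
Hypothesis connection_mu : principal_connection act mu.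
Hypothesis curvature_mu : has_curvature proj mu omega.
Implicit Types (i : chart_index B) (j : chart_index A) (e : E) (p : M).

Let manifoldM : smooth_manifold A.
Proof. by have [[]] := kahlerM. Qed.
Let chM j := smooth_manifold_chart j manifoldM.
Let chE i := smooth_manifold_chart i manifoldE.

Let Jp i j e : 'M[R]_((n + n).+1, n + n) := jac i j proj e.

Lemma jac_id_comp j j' i e : dom i e -> dom j (proj e) -> dom j' (proj e) ->
  jac i j' proj e = Jp i j e *m jac j j' id (proj e).
Proof.
move=> ie je je'; have [Hp _ _ _ _] := bundleE; have [_ _ _ _ Hid] := manifoldM.
rewrite -(jac_comp (chE i) (chM j) ie)//.
- by move=> b; exact: (proj_differentiable manifoldM manifoldE bundleE).
- by move=> b; exact: (smooth_map_differentiable b (chM j) (chM j') openT Hid I je je').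
apply: filterS (near_dom (chE i) (chM j) openT Hp I ie je) => x [q [_ _ jq -> _]].
exact: jq.
Qed.

Lemma jac_chart_comp i i' j e : dom i e -> dom i' e -> dom j (proj e) ->
  Jp i j e = jac i i' id e *m Jp i' j e.
Proof.
move=> ie ie' je; have [_ _ _ _ Hid] := manifoldE.
rewrite -(jac_comp (chE i) (chE i') ie)//.
- by move=> b; exact: (smooth_map_differentiable b (chE i) (chE i') openT Hid I ie ie').
- by move=> b; exact: (proj_differentiable manifoldM manifoldE bundleE).
apply: filterS (near_dom (chE i) (chE i') openT Hid I ie ie') => x [q [_ _ iq -> _]].
exact: iq.
Qed.

Lemma pullback2E (t : field2 A) i j e : dom i e -> dom j (proj e) ->
  (forall j j' p, dom j p -> dom j' p ->
     t j p = jac j j' id p *m t j' p *m (jac j j' id p)^T) ->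
  pullback2 proj t i e = Jp i j e *m t j (proj e) *m (Jp i j e)^T.
Proof.
move=> ie je law; rewrite /pullback2.
set j' := chart_at A (proj e).
have je' : dom j' (proj e) by have [_ _ H _ _] := manifoldM; exact: H.
by rewrite (jac_id_comp ie je je') (law j j')// trmx_mul !mulmxA.
Qed.

Let g0_law j j' p : dom j p -> dom j' p ->
  g0 j p = jac j j' id p *m g0 j' p *m (jac j j' id p)^T.
Proof. by have [_ [[H _] _ _] _ _ _] := kahlerM; exact: H. Qed.

Let g0_sym j p : dom j p -> (g0 j p)^T = g0 j p.
Proof. by have [_ [_ H _] _ _ _] := kahlerM; exact: H. Qed.

Let g0_pos j p (v : 'rV[R]_(n + n)) : dom j p -> v != 0 -> 0 < (v *m g0 j p *m v^T) 0 0.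
Proof. by have [_ [_ _ H] _ _ _] := kahlerM; exact: H. Qed.

Let g0_hermitian j p : dom j p -> g0 j p *m J0 R n = J0 R n *m g0 j p.
Proof.
move=> jp; have [_ _ H _ _] := kahlerM; have := H j p jp.
rewrite J0_tr mulmxN => /(congr1 (fun X => X *m J0 R n)) <-.
by rewrite mulNmx -mulmxA J0_square mulmxN mulmx1 opprK.
Qed.

(* The sign convention for omega is absorbed in the complex structure. *)
Lemma omegaE : exists K : 'M[R]_(n + n), [/\ K *m K = - 1%:M, K^T = - K,
  forall j p, dom j p -> g0 j p *m K = K *m g0 j p,
  forall j j' p, dom j p -> dom j' p -> jac j j' id p *m K = K *m jac j j' id p &
  forall j p, dom j p -> omega j p = K *m g0 j p].
Proof.
have [[_ Hc] _ _ [Ho|Ho] _] := kahlerM.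
  exists (J0 R n); split => //; [exact: J0_square|exact: J0_tr].
exists (- J0 R n); split.
- by rewrite mulNmx mulmxN opprK J0_square.
- by rewrite linearN /= J0_tr.
- by move=> j p jp; rewrite mulmxN mulNmx g0_hermitian.
- by move=> j j' p jp jp'; rewrite mulmxN mulNmx Hc.
- by move=> j p jp; rewrite Ho// mulNmx.
Qed.

Lemma vertical_horizontal i j e : dom i e -> dom j (proj e) ->
  exists (xi : 'rV[R]_((n + n).+1)) (S : 'M[R]_(n + n, (n + n).+1)),
    [/\ xi *m mu i e = 1%:M, xi *m Jp i j e = 0, S *m mu i e = 0 & S *m Jp i j e = 1%:M].
Proof.
move=> ie je; have [_ Hxi _] := connection_mu.
have [S SJ] := jac_proj_left_inverse manifoldM manifoldE bundleE ie je.
have xJ := fundamental_field_vertical manifoldM manifoldE bundleE ie je.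
set xi := fundamental_field act i e in xJ.
have xmu : xi *m mu i e = 1%:M.
  by apply/matrixP => a b; rewrite !ord1 Hxi// mxE eqxx.
exists xi, (S - S *m mu i e *m xi); split => //.
- by rewrite mulmxBl -[_ *m xi *m _]mulmxA xmu mulmx1 subrr.
- by rewrite mulmxBl -[_ *m xi *m _]mulmxA xJ mulmx0 subr0.
Qed.

Lemma bundle_metricE i j e u f : dom i e -> dom j (proj e) ->
  bundle_metric proj mu (scale2 u g0) (fun=> f) i e =
  u *: (Jp i j e *m g0 j (proj e) *m (Jp i j e)^T)
  + expR (- (2 * f)) *: (mu i e *m (mu i e)^T).
Proof.
move=> ie je; rewrite /bundle_metric (@pullback2E _ i j e)//.
  by rewrite /scale2 -scalemxAr -scalemxAl.
by move=> j1 j2 p j1p j2p; rewrite /scale2 -scalemxAr -scalemxAl -(g0_law j1p j2p).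
Qed.

Section LocalForm.
Variables (i : chart_index B) (j : chart_index A).

Let U := coord j @` dom j.
Let V := coord i @` (dom i `&` setT `&` proj @^-1` dom j).
Let g x := g0 j (param j x).
Let phi y := coord j (proj (param i y)).
Let mul y := mu i (param i y).

Let Uo : open U. Proof. by have [_] := chM j. Qed.
Let Vo : open V.
Proof. by have [Hp _ _ _ _] := bundleE; exact: (smooth_map_open (chE i) (chM j) openT Hp). Qed.

Let VP y : V y -> exists e, [/\ dom i e, dom j (proj e), coord i e = y & param i y = e].
Proof.
have [_ _ pK _] := chE i.
by move=> [e [[ie _] je] <-]; exists e; split => //; rewrite pK.
Qed.

Let UP x : U x -> exists2 p, dom j p & coord j p = x /\ param j x = p.
Proof.
by have [_ _ pK _] := chM j; move=> [p jp <-]; exists p => //; rewrite pK.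
Qed.

Let g_smooth : smooth_mx U g.
Proof. by have [_ [[_ H] _ _] _ _ _] := kahlerM; exact: H. Qed.

Let phi_smooth : smooth_mx V phi.
Proof.
move=> a b; rewrite ord1; have [[_ Hp] _ _ _ _] := bundleE; exact: Hp.
Qed.

Let mul_smooth : smooth_mx V mul.
Proof.
move=> a b; rewrite ord1; have [[_ H] _ _] := connection_mu.
apply: smooth_on_subset (H i a) => y [e [[ie _] _] <-]; by exists e.
Qed.

Let phiV y : V y -> U (phi y).
Proof. by move=> /VP[e [ie je _ ey]]; rewrite /phi ey; exists (proj e). Qed.

Let jacobian_phi y : V y -> jacobian_mx phi y = Jp i j (param i y).
Proof.
move=> /VP[e [ie je <- ->]]; apply/matrixP => a b; rewrite mxE dmxE mxE.
by [].
Qed.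

Lemma bundle_metric_smooth_on u f a b :
  smooth_on V (fun y => bundle_metric proj mu (scale2 u g0) (fun=> f) i (param i y) a b).
Proof.
have H := smooth_G u (expR (- (2 * f))) Uo Vo g_smooth phi_smooth mul_smooth phiV.
apply: smooth_on_eq (H a b) => // y Vy.
have [e [ie je ey ye]] := VP Vy.
have [_ _ pK _] := chM j.
by rewrite jacobian_phi// ye (bundle_metricE _ _ ie je) /g /phi /mul ye pK.
Qed.

Let T y : 'M[R]_(1 + (n + n)) := row_mx (mul y) (jacobian_mx phi y).

Let T_unit y : V y -> T y \in unitmx.
Proof.
move=> Vy; have [e [ie je _ ye]] := VP Vy.
have [xi [S [xmu xJ _ SJ]]] := vertical_horizontal ie je.
rewrite /T jacobian_phi// ye /mul ye.
by apply: (frame_unit _ xJ SJ); rewrite xmu mxE eqxx.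
Qed.

Lemma ricci_bundle_metric u f e : 0 < u -> dom i e -> dom j (proj e) ->
  let kap := expR (- (2 * f)) / (2 * u) in
  ricci (bundle_metric proj mu (scale2 u g0) (fun=> f)) i e =
  (lam - kap) *: (Jp i j e *m g0 j (proj e) *m (Jp i j e)^T)
  + (kap ^+ 2 * (n + n)%:R) *: (mu i e *m (mu i e)^T).
Proof.
move=> u0 ie je kap; have [K [KK KT gK jacK omK]] := omegaE.
have [_ _ pKj _] := chM j; have [_ _ pKi _] := chE i.
have Vy : V (coord i e) by exists e.
pose w := expR (- (2 * f)); have w0 : 0 < w by exact: expR_gt0.
pose G y := u *: (jacobian_mx phi y *m g (phi y) *m (jacobian_mx phi y)^T)
  + w *: (mul y *m (mul y)^T).
rewrite (ricciE _ (chE i) ie) (ricci_mx_eq (G' := G) Vo Vy); last first.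
  move=> y /[dup] Vy' /VP[e' [ie' je' _ ye']].
  by rewrite /G jacobian_phi// ye' (bundle_metricE _ _ ie' je') /g /phi /mul ye' pKj.
have gs x : U x -> (g x)^T = g x.
  by move=> /UP[p jp [_ xp]]; rewrite /g xp g0_sym.
have gu x : U x -> g x \in unitmx.
  by move=> /UP[p jp [_ xp]]; rewrite /g xp; apply: pos_def_unit => v; exact: g0_pos.
have gK' x : U x -> g x *m K = K *m g x.
  by move=> /UP[p jp [_ xp]]; rewrite /g xp gK.
have closed x a b c : U x ->
    (K *m dmx a g x) b c + (K *m dmx b g x) c a + (K *m dmx c g x) a b = 0.
  move=> /[dup] Ux /UP[p jp [px xp]].
  have dom_pd a' b' c' : (K *m dmx a' g x) b' c' = pd j a' (fun q => omega j q b' c') p.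
    have -> : K *m dmx a' g x = dmx a' (fun z => K *m g z) x.
      by rewrite (dmxM Uo Ux a' (smooth_mx_cst Uo K) g_smooth) dmx_cst mul0mx add0r.
    rewrite dmxE /pd px; apply: (eq_on_derive _ Uo Ux) => z /UP[q jq [_ zq]].
    by rewrite /= zq omK// /g zq.
  by rewrite !dom_pd; have [_ _ _ _ H] := kahlerM; exact: H.
have dmul y a b : V y -> dmx a mul y b 0 - dmx b mul y a 0 =
    (jacobian_mx phi y *m (K *m g (phi y)) *m (jacobian_mx phi y)^T) a b.
  move=> /[dup] Vy' /VP[e' [ie' je' ey' ye']].
  have := curvature_mu ie' => /matrixP/(_ a b).
  rewrite (@pullback2E _ i j e')//; last first.
    move=> j1 j2 p jp1 jp2; rewrite !omK// (g0_law jp1 jp2) !mulmxA.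
    by rewrite jacK.
  rewrite omK// jacobian_phi// ye' /g /phi ye' pKj// => <-.
  by rewrite mxE !dmxE -ey'.
have ric : ricci_mx g (phi (coord i e)) = lam *: g (phi (coord i e)).
  rewrite /phi pKi// /g -(ricciE g0 (chM j) je) pKj//; exact: einsteinM je.
have PT y : V y -> (invmx (T y) : 'M[R]_(1 + (n + n), (n + n).+1)) *m T y = 1%:M.
  by move=> /T_unit; exact: mulVmx.
have TP y : V y -> T y *m (invmx (T y) : 'M[R]_(1 + (n + n), (n + n).+1)) = 1%:M.
  by move=> /T_unit; exact: mulmxV.
rewrite (ricci_G Uo Vo g_smooth gs gu KK KT gK' closed phi_smooth mul_smooth phiV
  PT TP dmul u0 w0 Vy ric).
by rewrite jacobian_phi// /g /phi /mul pKi// pKj.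
Qed.

End LocalForm.

Lemma riemannian_bundle_metric u f : 0 < u ->
  riemannian_metric (bundle_metric proj mu (scale2 u g0) (fun=> f)).
Proof.
move=> u0; have [_ _ dom_at _ _] := manifoldM; have [_ _ dom_atE _ _] := manifoldE.
have [[mu_law _] _ _] := connection_mu.
split.
- split.
    move=> i i' e ie ie'; pose j := chart_at A (proj e); have je : dom j (proj e) by exact: dom_at.
    rewrite (bundle_metricE u f ie je) (bundle_metricE u f ie' je).
    rewrite (jac_chart_comp ie ie' je) (mu_law i i' e ie ie').
    by rewrite !trmx_mul mulmxDr mulmxDl -!scalemxAr -!scalemxAl !mulmxA.
  move=> i a b s y [e ie ey].
  have H := @bundle_metric_smooth_on i (chart_at A (proj e)) u f a b.
  by apply: H; exists e => //; split; [split|exact: dom_at].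
- move=> i e ie; have je := dom_at (proj e).
  by rewrite (bundle_metricE u f ie je) trmxD !trmxZ !trmx_mul !trmxK g0_sym// mulmxA.
- move=> i e v ie v0; have je := dom_at (proj e).
  have [xi [S [xmu xJ Smu SJ]]] := vertical_horizontal ie je.
  set j := chart_at A (proj e) in je xJ SJ.
  rewrite (bundle_metricE u f ie je) frame_quadratic_form.
  have [vJ|vJ] := eqVneq (v *m Jp i j e) 0.
    rewrite vJ !mul0mx [X in u * X]mxE mulr0 add0r mulr_gt0 ?expR_gt0// exprn_even_gt0//=.
    apply: contra_neq v0 => vm0.
    have Tu : (row_mx (mu i e) (Jp i j e) : 'M[R]_(1 + (n + n))) \in unitmx.
      by apply: (frame_unit _ xJ SJ); rewrite xmu mxE eqxx.
    have vmu : v *m mu i e = 0 by apply/matrixP => a b; rewrite !ord1 vm0 mxE.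
    have vT : v *m (row_mx (mu i e) (Jp i j e) : 'M[R]_(1 + (n + n))) = 0.
      by rewrite mul_mx_row vJ vmu row_mx0.
    by rewrite -[v](mulmxK Tu) vT mul0mx.
  rewrite ltr_wpDr//; last by rewrite mulr_gt0// g0_pos.
  by rewrite mulr_ge0 ?expR_ge0// sqr_ge0.
Qed.

End KahlerBundle.

(** * The system of ODEs *)

Section TimeDeriv.
Variables (R : realType) (T : \bar R).
Implicit Types (phi psi : R -> R) (t l : R).

Lemma before_le s t : before T t -> 0 <= s -> s <= t -> before T s.
Proof. by move=> [_ tT] s0 st; split => //; rewrite (le_lt_trans _ tT)// lee_fin. Qed.

Let F t : set_system R := within (before T) t^'.

Lemma time_cvg_eq phi psi t (l : R) :
  (forall s, before T s -> s != t -> phi s = psi s) ->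
  phi s @[s --> F t] --> l -> psi s @[s --> F t] --> l.
Proof.
move=> E; apply: cvg_trans; apply: near_eq_cvg.
rewrite /F !near_withinE; apply: nearW => s st Ts.
exact: E.
Qed.

Lemma time_cvg_id t : s @[s --> F t] --> t.
Proof. by apply: cvg_within_filter; apply: cvg_within_filter; exact: cvg_id. Qed.

Lemma time_deriv_cvg phi t l : time_deriv T phi t l -> phi s @[s --> F t] --> phi t.
Proof.
move=> H.
have c1 : (s - t) @[s --> F t] --> (0 : R).
  by rewrite -(subrr t); apply: cvgB; [exact: time_cvg_id|exact: cvg_cst].
rewrite -[X in _ --> X](add0r (phi t)) -(mulr0 l).
apply: time_cvg_eq (cvgD (cvgM H c1) (cvg_cst (phi t))) => s _ st.
rewrite -[LHS]/((phi s - phi t) / (s - t) * (s - t) + phi t).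
by rewrite mulfVK ?subrK// subr_eq0.
Qed.

Lemma time_derivD phi psi t l l' : time_deriv T phi t l -> time_deriv T psi t l' ->
  time_deriv T (fun s => phi s + psi s) t (l + l').
Proof.
move=> H H'; apply: time_cvg_eq (cvgD H H') => s _ _.
by rewrite /= -mulrDl opprD addrACA.
Qed.

Lemma time_derivM phi psi t l l' : time_deriv T phi t l -> time_deriv T psi t l' ->
  time_deriv T (fun s => phi s * psi s) t (l * psi t + phi t * l').
Proof.
move=> H H'.
apply: time_cvg_eq (cvgD (cvgM H (time_deriv_cvg H')) (cvgM (cvg_cst (phi t)) H')) => s _ _.
rewrite -[LHS]/((phi s - phi t) / (s - t) * psi s + phi t * ((psi s - psi t) / (s - t))).
by ring.
Qed.

Lemma time_deriv_cst c t : time_deriv T (fun=> c) t 0.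
Proof.
by apply: (@time_cvg_eq (fun=> 0)); [move=> s _ _; rewrite subrr mul0r|exact: cvg_cst].
Qed.

Lemma time_deriv_id t : time_deriv T id t 1.
Proof.
apply: (@time_cvg_eq (fun=> 1)); last exact: cvg_cst.
by move=> s _ st; rewrite divff// subr_eq0.
Qed.

Lemma time_derivZ c phi t l : time_deriv T phi t l -> time_deriv T (fun s => c * phi s) t (c * l).
Proof.
move=> H; have := time_derivM (time_deriv_cst c t) H.
by rewrite mul0r add0r.
Qed.

Lemma time_deriv_sum (I : Type) (r : seq I) (phi : I -> R -> R) (l : I -> R) t :
  (forall i, time_deriv T (phi i) t (l i)) ->
  time_deriv T (fun s => \sum_(i <- r) phi i s) t (\sum_(i <- r) l i).
Proof.
move=> H; elim: r => [|i r IHr].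
  rewrite big_nil; have -> : (fun s => \sum_(i <- [::]) phi i s) = (fun=> 0).
    by apply/funext => s; rewrite big_nil.
  exact: time_deriv_cst.
rewrite big_cons; have -> : (fun s => \sum_(j <- i :: r) phi j s) =
    (fun s => phi i s + \sum_(j <- r) phi j s).
  by apply/funext => s; rewrite big_cons.
exact: time_derivD.
Qed.

Lemma time_deriv_comp h phi t l d : time_deriv T phi t l -> is_derive (phi t) 1 h d ->
  time_deriv T (h \o phi) t (d * l).
Proof.
move=> H /is_derive1_caratheodory[g [gE gc gd]].
have c1 : g (phi s) @[s --> within (before T) t^'] --> d.
  by rewrite -gd; exact: (cvg_comp _ _ (time_deriv_cvg H) gc).
by apply: time_cvg_eq (cvgM c1 H) => s _ _; rewrite /= gE mulrA.
Qed.

Lemma is_derive_time_deriv phi t l : is_derive t 1 phi l -> time_deriv T phi t l.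
Proof.
move=> /is_derive1_caratheodory[g [gE /continuous_withinNx gc <-]].
apply: (@time_cvg_eq g); last exact: cvg_within_filter gc.
by move=> s _ st; rewrite gE mulfK// subr_eq0.
Qed.

Lemma near_before t : before T t -> 0 < t -> \forall s \near t, before T s.
Proof.
move=> [_ tT] t0; near=> s; split; near: s.
  by apply: filterS (lt_nbhsr t0) => s /ltW.
case: T tT => [r| |] //; last by move=> _; apply: nearW => s; exact: ltry.
rewrite lte_fin => tr; apply: filterS (lt_nbhsl tr) => s sr.
by rewrite lte_fin.
Unshelve. all: by end_near. Qed.

Lemma time_deriv_is_derive phi t l : before T t -> 0 < t -> time_deriv T phi t l ->
  is_derive t 1 phi l.
Proof.
move=> Tt t0 H; apply/is_derive1_caratheodory.
exists (fun s => if s == t then l else (phi s - phi t) / (s - t)); split.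
- move=> s; case: eqVneq => [->|st]; first by rewrite !subrr mulr0.
  by rewrite mulfVK// subr_eq0.
- apply/continuous_withinNx; rewrite eqxx.
  have H1 : (phi s - phi t) / (s - t) @[s --> t^'] --> l.
    apply: cvg_trans H => P; rewrite /F /= => HP.
    have := near_before Tt t0; move=> nb.
    have nb' : \forall s \near t^', before T s by exact: cvg_within nb.
    by apply: filterS2 nb' HP => s Ts; apply.
  apply: cvg_trans H1; apply: near_eq_cvg; rewrite near_withinE.
  by apply: nearW => s /negbTE ->.
- by rewrite eqxx.
Qed.

Lemma time_deriv_continuous phi t : before T t -> 0 < t ->
  (forall s, before T s -> exists l, time_deriv T phi s l) ->
  {within `[0, t], continuous phi}.
Proof.
move=> Tt t0 H; apply/continuous_within_itvP => //.
have pos s : 0 < s -> s <= t -> {for s, continuous phi}.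
  move=> s0 st; have Ts := before_le Tt (ltW s0) st.
  have [l /(time_deriv_is_derive Ts s0)[d _]] := H s Ts.
  by apply: differentiable_continuous; exact/derivable1_diffP.
split.
- by move=> s; rewrite in_itv/= => /andP[s0 /ltW st]; exact: pos.
- have T0 : before T 0 by apply: before_le (ltW t0).
  have [l /time_deriv_cvg] := H 0 T0.
  apply: cvg_trans => P; rewrite /F /= => HP.
  have n1 : \forall s \near (0 : R)^'+, s < t by exact: nbhs_right_lt.
  have n2 : \forall s \near (0 : R)^'+, s != 0 -> before T s -> P (phi s).
    have HP' : \forall s \near (0 : R), s != 0 -> before T s -> P (phi s) by exact: HP.
    exact: (cvg_within _ HP').
  have n3 : \forall s \near (0 : R)^'+, 0 < s by exact: nbhs_right_gt.
  suff : \forall s \near (0 : R)^'+, P (phi s) by [].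
  apply: filterS3 n1 n2 n3 => s st H2 s0; apply: H2; first by rewrite gt_eqF.
  exact: (before_le Tt (ltW s0) (ltW st)).
- exact: cvg_at_left_filter (pos t t0 (lexx _)).
Qed.

Lemma time_deriv_MVT phi dphi t : before T t ->
  (forall s, before T s -> time_deriv T phi s (dphi s)) ->
  exists2 c, 0 <= c <= t & phi t - phi 0 = dphi c * t.
Proof.
move=> Tt H; have [+ _] := Tt; rewrite le_eqVlt => /orP[/eqP t0|t0].
  by exists t; rewrite -t0 ?lexx// subrr mulr0.
have [|| c] := @MVT_segment R phi dphi 0 t (ltW t0).
- move=> s; rewrite in_itv/= => /andP[s0 st].
  have Ts := before_le Tt (ltW s0) (ltW st).
  exact: time_deriv_is_derive (H _ Ts).
- by apply: time_deriv_continuous => // s /H; exists (dphi s).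
- by rewrite in_itv/= subr0 => ct E; exists c.
Qed.

Lemma time_deriv0_cst phi t : (forall s, before T s -> time_deriv T phi s 0) ->
  before T t -> phi t = phi 0.
Proof.
move=> H Tt; have [c _] := time_deriv_MVT (dphi := fun=> 0) Tt H.
by rewrite mul0r => /eqP; rewrite subr_eq0 => /eqP.
Qed.

Lemma time_deriv_ext phi psi t l l' : time_deriv T phi t l ->
  (forall s, phi s = psi s) -> l = l' -> time_deriv T psi t l'.
Proof. by move=> H /funext <- <-. Qed.

Lemma time_deriv_expR phi t l : time_deriv T phi t l ->
  time_deriv T (fun s => expR (phi s)) t (expR (phi t) * l).
Proof. by move=> H; exact: (time_deriv_comp H (is_derive_expR _)). Qed.

Lemma time_deriv_ln phi t l : 0 < phi t -> time_deriv T phi t l ->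
  time_deriv T (fun s => ln (phi s)) t ((phi t)^-1 * l).
Proof. by move=> p0 H; exact: (time_deriv_comp H (is_derive1_ln p0)). Qed.

Lemma time_derivV phi t l : phi t != 0 -> time_deriv T phi t l ->
  time_deriv T (fun s => (phi s)^-1) t (- (phi t) ^- 2 * l).
Proof.
move=> p0 H; apply: (time_deriv_comp (h := fun x => x^-1) H).
have D : is_derive (phi t) 1 (@id R) 1 by exact: is_derive_id.
have := is_deriveV p0 D.
by rewrite /GRing.scale /= mulr1.
Qed.

End TimeDeriv.

Section OdeSolution.
Variables (R : realType) (n : nat) (lam u0 C : R) (T : \bar R) (u f : R -> R).
Hypothesis n_gt0 : (0 < n)%N.
Hypothesis sol : ode_solution n lam u0 C T u f.

Let n0 : (n%:R : R) != 0. Proof. by rewrite pnatr_eq0 -lt0n. Qed.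
Let n1' : (1 + n%:R : R) != 0. Proof. by rewrite nat1r pnatr_eq0. Qed.

Lemma ode_u_gt0 t : before T t -> 0 < u t.
Proof. by have [_ _ H] := sol; move=> /H[]. Qed.

Lemma ode_u t : before T t -> time_deriv T u t (- 2 * lam + expR (- 2 * f t) / u t).
Proof. by have [_ _ H] := sol; move=> /H[]. Qed.

Lemma ode_f t : before T t -> time_deriv T f t (n%:R * expR (- 2 * f t) / (2 * u t ^+ 2)).
Proof. by have [_ _ H] := sol; move=> /H[]. Qed.

(* First integral: f' > 0, and 1/u satisfies a linear equation in the variable f. *)
Definition ode_integral (x y : R) : R :=
  (x^-1 - 2 * lam / n.+1%:R * expR (2 * y)) * expR (2 / n%:R * y).

Lemma ode_integral_cst t : before T t ->
  ode_integral (u t) (f t) = ode_integral u0 C.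
Proof.
move=> Tt; have [u00 f0 _] := sol.
have -> : ode_integral u0 C = ode_integral (u 0) (f 0) by rewrite u00 f0.
apply: (time_deriv0_cst (T := T) (phi := fun s => ode_integral (u s) (f s))) => // s Ts.
have us := lt0r_neq0 (ode_u_gt0 Ts).
have H1 := time_derivV us (ode_u Ts).
have H2 := time_derivZ (c := - (2 * lam / n.+1%:R)) (time_deriv_expR (time_derivZ (c := 2) (ode_f Ts))).
have H3 := time_deriv_expR (time_derivZ (c := 2 / n%:R) (ode_f Ts)).
apply: (time_deriv_ext (time_derivM (time_derivD H1 H2) H3)) => [r|].
  by rewrite /ode_integral mulNr.
have -> : expR (2 * f s) = (expR (- 2 * f s))^-1 by rewrite mulNr expRN invrK.
have := lt0r_neq0 (expR_gt0 (- 2 * f s)); have := n1'.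
move: (expR _) (expR _) => w v n11 w0.
by field; rewrite us w0 n0 n11.
Qed.

Lemma ode_lam0 : lam = 0 -> forall t, before T t ->
  expR (2 * f t) * u t ^+ 2 = n.+2%:R * t + expR (2 * C) * u0 ^+ 2.
Proof.
move=> lam0 t Tt; have [u00 f0 _] := sol.
pose phi s := expR (2 * f s) * (u s * u s) - n.+2%:R * s.
have : phi t = phi 0.
  apply: (time_deriv0_cst (T := T)) => // s Ts.
  have us := lt0r_neq0 (ode_u_gt0 Ts).
  have H1 := time_derivM (time_deriv_expR (time_derivZ (c := 2) (ode_f Ts)))
    (time_derivM (ode_u Ts) (ode_u Ts)).
  apply: (time_deriv_ext (time_derivD H1 (time_derivZ (c := - n.+2%:R) (time_deriv_id T s)))) => [r|].
    by rewrite /phi mulNr.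
  rewrite lam0; have -> : expR (2 * f s) = (expR (- 2 * f s))^-1 by rewrite mulNr expRN invrK.
  have := lt0r_neq0 (expR_gt0 (- 2 * f s)).
  move: (expR _) => w w0; rewrite -[n.+2]addn2 natrD.
  by field; rewrite us w0.
rewrite /phi u00 f0 mulr0 subr0 => /eqP; rewrite subr_eq => /eqP.
by rewrite !expr2 addrC.
Qed.

End OdeSolution.

Lemma branch_pow_scale (R : realType) (z : int) (k E c q : R) :
  0 < E -> c * E `^ q = 1 ->
  (Complex c 0 * branch_pow z (k * E) q)%R = branch_pow z k q.
Proof.
move=> E0 cE; rewrite /branch_pow pmulr_lge0//.
have [k0|k0] := leP 0 k.
  apply/eqP; rewrite eq_complex /= !mul0r !mulr0 subr0 addr0 eqxx andbT.
  by rewrite powRM// ?ltW// mulrCA cE mulr1.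
apply/eqP; rewrite eq_complex /= !mul0r subr0 addr0.
rewrite normrM (gtr0_norm E0) powRM ?normr_ge0 ?ltW//.
by rewrite !mulrA -[c * _ * _]mulrA [_ `^ _ * E `^ _]mulrC !mulrA cE !mul1r !eqxx.
Qed.

Section OdeExplicit.
Variables (R : realType) (n : nat) (lam u0 C : R) (T : \bar R) (u f : R -> R).
Hypotheses (n_gt0 : (0 < n)%N) (u0_gt0 : 0 < u0).
Hypothesis sol : ode_solution n lam u0 C T u f.

Let n0 : (n%:R : R) != 0. Proof. by rewrite pnatr_eq0 -lt0n. Qed.

Lemma ode_psi z t : before T t ->
  lam != 0 -> Psi n lam z u f t =
  branch_pow z (- (n.+1%:R / (2 * lam)) * ode_integral n lam u0 C) (n%:R / n.+1%:R).
Proof.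
move=> Tt lam0; have ut := ode_u_gt0 sol Tt.
rewrite -(ode_integral_cst n_gt0 sol Tt) /Psi.
set E := expR (- (2 * f t * (n.+1%:R / n%:R))).
have n1 : (n.+1%:R : R) != 0 by rewrite pnatr_eq0.
have n1' : (1 + n%:R : R) != 0 by rewrite nat1r.
have -> : 1 - n.+1%:R / (2 * lam * u t * expR (2 * f t)) =
    - (n.+1%:R / (2 * lam)) * ode_integral n lam (u t) (f t) * E.
  have -> : E = (expR (2 / n%:R * f t))^-1 * (expR (2 * f t))^-1.
    rewrite -!expRN -expRD /E; congr expR; rewrite -[n.+1]addn1 natrD.
    by field.
  have := lt0r_neq0 (expR_gt0 (2 * f t)); have := lt0r_neq0 (expR_gt0 (2 / n%:R * f t)).
  rewrite /ode_integral; have := lt0r_neq0 ut.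
  move: (u t) (expR (2 * f t)) (expR (2 / n%:R * f t)) => x v w x0 w0 v0.
  by field; rewrite x0 w0 v0 n1' lam0.
apply: branch_pow_scale; first exact: expR_gt0.
rewrite /powR gt_eqF ?expR_gt0// expRK -expRD -[RHS]expR0; congr expR.
by field; rewrite n0 n1'.
Qed.

Lemma ode_lam0_explicit : lam = 0 -> forall t, before T t ->
  u t = expR (- 2 * C / n.+2%:R) * u0 `^ (n%:R / n.+2%:R)
        * (n.+2%:R * t + expR (2 * C) * u0 ^+ 2) `^ (n.+2%:R^-1) /\
  f t = n%:R / (2 * n.+2%:R) * ln (n.+2%:R * t + expR (2 * C) * u0 ^+ 2)
        + 2 * C / n.+2%:R - n%:R / n.+2%:R * ln u0.
Proof.
move=> lam0 t Tt; have ut := ode_u_gt0 sol Tt.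
have P0 := ode_lam0 sol lam0 Tt.
have I0 := ode_integral_cst n_gt0 sol Tt.
set P := _ * t + _ in P0 *.
have Pgt : 0 < P by rewrite -P0 mulr_gt0 ?expR_gt0// exprn_gt0.
have lnP : ln P = 2 * f t + 2 * ln (u t).
  by rewrite -P0 lnM ?posrE ?expR_gt0 ?exprn_gt0// expRK lnXn// mulr2n; ring.
have lnI : - ln (u t) + 2 / n%:R * f t = - ln u0 + 2 / n%:R * C.
  have lnE x y : 0 < x -> ln (ode_integral n lam x y) = - ln x + 2 / n%:R * y.
    move=> x0; rewrite /ode_integral lam0 mulr0 mul0r mul0r subr0.
    by rewrite lnM ?posrE ?expR_gt0 ?invr_gt0// expRK lnV.
  by rewrite -lnE// I0 lnE.
have n2 : (n.+2%:R : R) != 0 by rewrite pnatr_eq0.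
have n2' : (2 + n%:R : R) != 0 by rewrite -natrD pnatr_eq0.
have lu : ln (u t) = ln u0 + 2 / n%:R * (f t - C).
  move: lnI; move: (2 / n%:R) => k; rewrite mulrBr; lra.
rewrite lu in lnP; split.
  rewrite -[LHS]lnK ?posrE// lu /powR !gt_eqF// -!expRD lnP; congr expR.
  by rewrite -addn2 natrD; field; apply/andP; split; [exact: n0|exact: n2'].
rewrite lnP -addn2 natrD; field.
by apply/andP; split; [exact: n2'|exact: n0].
Qed.

End OdeExplicit.

Lemma is_derive_lipschitz (R : realType) (F dF : R -> R) (a b : R) :
  (forall x : R, is_derive x 1 F (dF x)) -> continuous dF -> a <= b ->
  exists2 L, 0 <= L & forall x y, a <= x <= b -> a <= y <= b ->
    `|F x - F y| <= L * `|x - y|.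
Proof.
move=> FdF cdF ab.
have [c _ cM] := @EVT_max R (fun x => `|dF x|) a b ab
  (continuous_subspaceT (fun x => cvg_norm (cdF x))).
exists `|dF c| => // .
suff H x y : x <= y -> a <= x <= b -> a <= y <= b ->
    `|F x - F y| <= `|dF c| * `|x - y|.
  move=> x y xab yab; have [xy|/ltW yx] := leP x y; first exact: H.
  by rewrite distrC [`|x - y|]distrC; exact: H.
move=> xy /andP[ax xb] /andP[ay yb].
have cF : {within `[x, y], continuous F}.
  apply: continuous_subspaceT => z; apply: differentiable_continuous.
  by apply/derivable1_diffP; have [] := FdF z.
have [z + E] := MVT_segment xy (fun z _ => FdF z) cF.
rewrite in_itv/= => /andP[xz zy].
rewrite distrC E normrM [`|x - y|]distrC ler_wpM2r// cM// in_itv/=.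
by rewrite (le_trans ax xz) (le_trans zy yb).
Qed.

Lemma time_deriv_bounded (R : realType) (T : \bar R) (phi dphi : R -> R) (t : R) :
  before T t -> (forall s, before T s -> time_deriv T phi s (dphi s)) ->
  exists K, forall s, 0 <= s <= t -> phi s <= K.
Proof.
move=> Tt H; have [+ _] := Tt; rewrite le_eqVlt => /orP[/eqP <-|t0].
  by exists (phi 0) => s s0; have -> : s = 0 by apply/eqP; rewrite eq_le andbC.
have [c _ cM] := EVT_max (ltW t0)
  (time_deriv_continuous Tt t0 (fun s Ts => ex_intro _ _ (H s Ts))).
by exists (phi c) => s st; apply: cM; rewrite in_itv.
Qed.

(* Gronwall's argument applied to [exp (- 2 L t) (phi - psi)^2]. *)
Lemma autonomous_ode_unique (R : realType) (T : \bar R) (F dF phi psi : R -> R) :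
  (forall x : R, is_derive x 1 F (dF x)) -> continuous dF -> (forall x, 0 <= F x) ->
  (forall s, before T s -> time_deriv T phi s (F (phi s))) ->
  (forall s, before T s -> time_deriv T psi s (F (psi s))) ->
  phi 0 = psi 0 -> forall t, before T t -> phi t = psi t.
Proof.
move=> FdF cdF F0 Hphi Hpsi E0 t Tt.
have lb chi : (forall s, before T s -> time_deriv T chi s (F (chi s))) ->
    forall s, 0 <= s <= t -> chi 0 <= chi s.
  move=> H s /andP[s0 st]; have Ts := before_le Tt s0 st.
  have [c _ E] := time_deriv_MVT Ts H.
  by rewrite -subr_ge0 E mulr_ge0.
have [K1 K1P] := time_deriv_bounded Tt Hphi.
have [K2 K2P] := time_deriv_bounded Tt Hpsi.
have t0 : 0 <= t by have [] := Tt.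
have tt : 0 <= t <= t by rewrite t0 lexx.
have [] := @is_derive_lipschitz R F dF (phi 0) (Num.max K1 K2) FdF cdF.
  by rewrite le_max (le_trans (lb _ Hphi t tt))// K1P.
move=> L L0 lipF.
pose d s := phi s - psi s.
pose dd s := F (phi s) - F (psi s).
have Hd s : before T s -> time_deriv T d s (dd s).
  move=> Ts; have := time_derivD (Hphi s Ts) (time_derivZ (c := -1) (Hpsi s Ts)).
  by move=> H; apply: (time_deriv_ext H) => [r|]; rewrite mulN1r.
pose En s := expR (- (2 * L) * s) * (d s * d s).
have HE s : before T s -> time_deriv T En s
    (expR (- (2 * L) * s) * (2 * (d s * dd s - L * (d s * d s)))).
  move=> Ts; apply: (time_deriv_ext (time_derivM (time_deriv_expR (time_derivZ (c := - (2 * L)) (time_deriv_id T s)))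
    (time_derivM (Hd s Ts) (Hd s Ts)))) => //.
  by rewrite /=; ring.
have [c ct] := time_deriv_MVT Tt HE.
have -> : En 0 = 0 by rewrite /En /d E0 subrr mul0r mulr0.
have dle : d c * dd c <= L * (d c * d c).
  have b1 : phi 0 <= phi c <= Num.max K1 K2 by rewrite lb// le_max K1P.
  have b2 : phi 0 <= psi c <= Num.max K1 K2 by rewrite E0 lb// le_max K2P// orbT.
  apply: le_trans (ler_norm _) _; rewrite normrM.
  have -> : d c * d c = `|d c| * `|d c| by rewrite -normrM ger0_norm// -expr2 sqr_ge0.
  by rewrite mulrCA ler_wpM2l// lipF.
rewrite subr0 => E.
have : En t <= 0.
  by rewrite E mulr_le0_ge0// mulr_ge0_le0 ?expR_ge0// mulr_ge0_le0// subr_le0.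
rewrite /En pmulr_rle0 ?expR_gt0// -expr2 => d2.
have : d t ^+ 2 == 0 by rewrite eq_le d2 sqr_ge0.
by rewrite sqrf_eq0 subr_eq0 => /eqP.
Qed.

Section OdeUnique.
Variables (R : realType) (n : nat) (lam u0 C : R).
Hypothesis n_gt0 : (0 < n)%N.

Let a := ode_integral n lam u0 C.

(* Along a solution, [1 / u] is [ode_inv_u f] and [f'] is [ode_field f]. *)
Definition ode_inv_u (x : R) : R :=
  a * expR (- (2 / n%:R) * x) + 2 * lam / n.+1%:R * expR (2 * x).

Definition ode_field (x : R) : R := n%:R / 2 * (expR (- 2 * x) * ode_inv_u x ^+ 2).

Definition ode_dinv_u (x : R) : R :=
  a * (expR (- (2 / n%:R) * x) * - (2 / n%:R)) + 2 * lam / n.+1%:R * (expR (2 * x) * 2).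

Lemma is_derive_expRZ (k x : R) : is_derive x 1 (fun y => expR (k * y)) (expR (k * x) * k).
Proof.
have D : is_derive x 1 (fun y : R => k * y) k.
  have -> : (fun y : R => k * y) = k \*: id by [].
  apply: is_derive_eq; exact: mulr1.
exact: (is_derive1_comp (is_derive_expR (k * x)) D).
Qed.

Lemma is_derive_ode_inv_u (x : R) : is_derive x 1 ode_inv_u (ode_dinv_u x).
Proof.
have D1 := is_derive_expRZ (- (2 / n%:R)) x.
have D2 := is_derive_expRZ 2 x.
exact: (is_deriveD (is_deriveZ a D1) (is_deriveZ (2 * lam / n.+1%:R) D2)).
Qed.

Definition ode_dfield (x : R) : R :=
  n%:R / 2 * (expR (- 2 * x) * - 2 * ode_inv_u x ^+ 2
              + expR (- 2 * x) * (2 * ode_inv_u x * ode_dinv_u x)).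

Lemma is_derive_ode_field (x : R) : is_derive x 1 ode_field (ode_dfield x).
Proof.
have D1 := is_derive_expRZ (- 2) x.
have D2 := is_derive_ode_inv_u x.
have := is_deriveZ (n%:R / 2) (is_deriveM D1 (is_deriveM D2 D2)).
move=> D; have -> : ode_field = (n%:R / 2) \*: ((fun y => expR (- 2 * y)) * (ode_inv_u * ode_inv_u)).
  by apply/funext => y; rewrite /ode_field expr2.
apply: (is_derive_eq D); rewrite /ode_dfield /GRing.scale /=.
rewrite -[(ode_inv_u * ode_inv_u) x]/(ode_inv_u x * ode_inv_u x).
by ring.
Qed.

Lemma continuous_expRZ (k : R) : continuous (fun y => expR (k * y)).
Proof.
move=> x; apply: differentiable_continuous; apply/derivable1_diffP.
by have [] := is_derive_expRZ k x.
Qed.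

Lemma continuous_ode_inv_u : continuous ode_inv_u.
Proof.
move=> x; apply: differentiable_continuous; apply/derivable1_diffP.
by have [] := is_derive_ode_inv_u x.
Qed.

Lemma continuous_ode_dfield : continuous ode_dfield.
Proof.
move=> x; have e k := continuous_expRZ k (x := x); have cu := continuous_ode_inv_u (x := x).
have cd : {for x, continuous ode_dinv_u}.
  apply: cvgD; apply: cvgM; [exact: cvg_cst| |exact: cvg_cst|];
    apply: cvgM; [exact: e|exact: cvg_cst|exact: e|exact: cvg_cst].
apply: cvgM; first exact: cvg_cst.
apply: cvgD; apply: cvgM.
- by apply: cvgM; [exact: e|exact: cvg_cst].
- by apply: (@cvg_comp _ _ _ ode_inv_u (fun y => y ^+ 2) _ _ _ cu); exact: exprn_continuous.
- exact: e.
- by apply: cvgM; [apply: cvgM; [exact: cvg_cst|exact: cu]|exact: cd].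
Qed.

Lemma ode_field_ge0 x : 0 <= ode_field x.
Proof. by rewrite mulr_ge0 ?divr_ge0// mulr_ge0 ?expR_ge0// sqr_ge0. Qed.

Lemma ode_solution_field (T : \bar R) u f t : ode_solution n lam u0 C T u f -> before T t ->
  (u t)^-1 = ode_inv_u (f t) /\ time_deriv T f t (ode_field (f t)).
Proof.
move=> sol Tt.
have E : (u t)^-1 = ode_inv_u (f t).
  rewrite /ode_inv_u /a -(ode_integral_cst n_gt0 sol Tt) /ode_integral.
  rewrite -[X in _ = X + _]mulrA -expRD.
  by rewrite mulNr subrr expR0 mulr1 subrK.
split => //; apply: (time_deriv_ext (ode_f sol Tt)) => //.
have := lt0r_neq0 (ode_u_gt0 sol Tt).
rewrite /ode_field -E; move: (expR _) (u t) => w x x0.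
by field.
Qed.

Lemma ode_solution_unique (T : \bar R) u f u' f' :
  ode_solution n lam u0 C T u f -> ode_solution n lam u0 C T u' f' ->
  forall t, before T t -> u t = u' t /\ f t = f' t.
Proof.
move=> sol sol' t Tt.
have E : f t = f' t.
  apply: (autonomous_ode_unique is_derive_ode_field continuous_ode_dfield ode_field_ge0) Tt.
  - by move=> s /(ode_solution_field sol)[].
  - by move=> s /(ode_solution_field sol')[].
  - by have [_ -> _] := sol; have [_ -> _] := sol'.
split => //; apply: invr_inj.
by rewrite (ode_solution_field sol Tt).1 (ode_solution_field sol' Tt).1 E.
Qed.

End OdeUnique.

(* The inverse of an antiderivative of 1 / F solves x' = F x. *)
Lemma autonomous_ode_exists (R : realType) (F : R -> R) (C : R) (P : R -> Prop) :
  continuous F -> 0 < F C -> (\forall x \near C, P x) ->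
  exists (T : R) (g : R -> R), [/\ 0 < T, g 0 = C &
    forall t, 0 <= t < T -> is_derive t 1 g (F (g t)) /\ P (g t)].
Proof.
move=> cF FC nP.
have nF : \forall x \near C, 0 < F x by exact: (cvgr_gt _ (cF C)).
have [r /= r0 rP] : \forall x \near C, 0 < F x /\ P x by apply: filterS2 nF nP.
pose s := r / 2; have s0 : 0 < s by rewrite divr_gt0.
have sr : s < r by rewrite /s; lra.
have sP x : C - s <= x <= C + s -> 0 < F x /\ P x.
  move=> /andP[x1 x2]; apply: rP; rewrite /= ltr_norml.
  by apply/andP; split; lra.
pose Phi x := (F x)^-1.
have cPhi x : C - s <= x <= C + s -> {for x, continuous Phi}.
  by move=> /sP[Fx _]; apply: cvgV; [rewrite gt_eqF|exact: cF].
have iPhi : (@lebesgue_measure R).-integrable `[C - s, C + s] (EFin \o Phi).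
  apply: continuous_compact_integrable; first exact: segment_compact.
  apply: continuous_in_subspaceT => x; rewrite inE/= in_itv/=.
  exact: cPhi.
pose S x := (\int[@lebesgue_measure R]_(t in `[C - s, x]) Phi t)%R.
pose tau x := S x - S C.
have dtau (x : R) : C - s < x < C + s -> is_derive x 1 tau (Phi x).
  move=> /andP[x1 x2].
  have cx : {for x, continuous Phi} by apply: cPhi; rewrite !ltW.
  have [D1 D2] := continuous_FTC1_closed x2 iPhi x1 cx.
  have DS : is_derive x 1 S (Phi x).
    by apply: DeriveDef; [exact: D1|rewrite -derive1E; exact: D2].
  apply: is_derive_eq (is_deriveB DS (is_derive_cst (S C) x 1)) _.
  exact: subr0.
pose a := C - s / 2; pose b := C + s / 2.
have ab : a < b by rewrite /a /b; lra.
have abP x : a <= x <= b -> C - s < x < C + s.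
  by rewrite /a /b => /andP[x1 x2]; apply/andP; split; lra.
have ctau : {within `[a, b], continuous tau}.
  apply: continuous_in_subspaceT => x; rewrite inE/= in_itv/= => /abP/dtau[d _].
  by apply: differentiable_continuous; exact/derivable1_diffP.
have mtau x y : a <= x -> x < y -> y <= b -> tau x < tau y.
  have oo z : z \in `]a, b[ -> C - s < z < C + s.
    by rewrite in_itv/= => /andP[az zb]; apply: abP; rewrite !ltW.
  move=> ax xy yb; apply: (gtr0_derive1_lt_cc _ _ ctau) => //.
  - by move=> z /oo/dtau[].
  - move=> z /oo zs; have D := dtau z zs.
    rewrite derive1E (@derive_val _ _ _ _ _ _ _ D) invr_gt0.
    by move: zs => /andP[z1 z2]; case: (sP z); rewrite ?ltW.
  - by rewrite in_itv/= ax (le_trans (ltW xy) yb).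
  - by rewrite in_itv/= yb (le_trans ax (ltW xy)).
have itau : {in `[a, b] &, injective tau}.
  move=> x y; rewrite !in_itv/= => /andP[ax xb] /andP[ay yb] E.
  have [xy|yx|//] := ltgtP x y.
    by have := mtau x y ax xy yb; rewrite E ltxx.
  by have := mtau y x ay yx xb; rewrite E ltxx.
pose g y := xget C [set x | x \in `[a, b] /\ tau x = y].
have gK : {in `[a, b], cancel tau g}.
  move=> x xab; rewrite /g.
  have [y1 y2] := @xgetPex _ C [set z | z \in `[a, b] /\ tau z = tau x]
    (ex_intro _ x (conj xab erefl)).
  exact: itau.
have Kg := segment_continuous_le_can_sym (ltW ab) ctau gK.
have tauC : tau C = 0 by rewrite /tau subrr.
have aC : a < C by rewrite /a; lra.
have Cb : C < b by rewrite /b; lra.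
have taub : 0 < tau b by rewrite -tauC; exact: mtau (ltW aC) Cb (lexx b).
have taua : tau a < 0 by rewrite -tauC; exact: mtau (lexx a) aC (ltW Cb).
exists (tau b), g; split => //.
  by rewrite -tauC gK// in_itv/= !ltW.
move=> t /andP[t0 tb].
have tI : t \in `[tau a, tau b] by rewrite in_itv/= (ltW tb) (le_trans (ltW taua) t0).
have [x + tE] := segment_continuous_le_surjective (ltW ab) (ltW (lt_trans taua taub)) ctau tI.
rewrite /= in_itv/= => /andP[ax xb].
have gt : g t = x by rewrite -tE gK// in_itv/= ax.
have ax' : a < x.
  by rewrite lt_neqAle ax andbT; apply: contraTneq t0 => E; rewrite -tE -E -ltNge.
have xb' : x < b.
  by rewrite lt_neqAle xb andbT; apply: contraTneq tb => E; rewrite -tE E ltxx.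
have xs : C - s < x < C + s by apply: abP; rewrite ax xb.
have [Fx Px] : 0 < F x /\ P x by apply: sP; case/andP: xs => x1 x2; rewrite !ltW.
rewrite gt; split => //.
have nI : \forall y \near x, y \in `]a, b[ by apply: near_in_itvoo; rewrite in_itv/= ax'.
rewrite -tE -[F x]invrK; apply: is_derive_inverse.
- apply: filterS nI => y; rewrite in_itv/= => /andP[ay yb].
  by apply: gK; rewrite in_itv/= !ltW.
- apply: filterS nI => y; rewrite in_itv/= => /andP[ay yb].
  have [|d _] := dtau y; first by apply: abP; rewrite !ltW.
  by apply: differentiable_continuous; exact/derivable1_diffP.
- exact: dtau.
- by rewrite invr_eq0 gt_eqF.
Qed.

Lemma ode_solution_exists (R : realType) (n : nat) (lam u0 C : R) :
  (0 < n)%N -> 0 < u0 ->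
  exists (T : \bar R) (u f : R -> R), (0 < T)%E /\ ode_solution n lam u0 C T u f.
Proof.
move=> n_gt0 u0_gt0.
have n0 : (n%:R : R) != 0 by rewrite pnatr_eq0 -lt0n.
pose q := ode_inv_u n lam u0 C; pose F := ode_field n lam u0 C.
have qC : q C = u0^-1.
  rewrite /q /ode_inv_u /ode_integral -[X in X + _]mulrA -expRD.
  by rewrite mulNr subrr expR0 mulr1 subrK.
have cF : continuous F.
  move=> x; apply: differentiable_continuous; apply/derivable1_diffP.
  by have [] := is_derive_ode_field n lam u0 C x.
have cq := @continuous_ode_inv_u R n lam u0 C.
have qC0 : 0 < q C by rewrite qC invr_gt0.
have FC : 0 < F C.
  rewrite /F /ode_field; apply: mulr_gt0; first by rewrite divr_gt0// ltr0n.
  by rewrite mulr_gt0 ?expR_gt0// exprn_gt0.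
have nq : \forall x \near C, 0 < q x by exact: (cvgr_gt _ (cq C)).
have [T [f [T0 f0 H]]] := autonomous_ode_exists cF FC nq.
exists T%:E, (fun t => (q (f t))^-1), f; split => //; split => //.
  by rewrite f0 qC invrK.
move=> t Tt; have [|Df qt] := H t; first by case: Tt => t0; rewrite lte_fin => ->; rewrite t0.
split; first by rewrite invr_gt0.
- have Dq := time_derivV (phi := q \o f) (lt0r_neq0 qt) (time_deriv_comp (is_derive_time_deriv T%:E Df)
    (is_derive_ode_inv_u n lam u0 C (f t))).
  apply: (time_deriv_ext Dq) => //; rewrite /F /ode_field.
  have qt0 := lt0r_neq0 qt; rewrite invrK.
  have -> : ode_dinv_u n lam u0 C (f t) = - (2 / n%:R) * q (f t)
      + (2 + 2 / n%:R) * (2 * lam / n.+1%:R) * (expR (- 2 * f t))^-1.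
    by rewrite mulNr expRN invrK /q /ode_inv_u /ode_dinv_u; ring.
  rewrite -/q -[(q \o f) t]/(q (f t)); have := lt0r_neq0 (expR_gt0 (- 2 * f t)).
  have n1' : (1 + n%:R : R) != 0 by rewrite nat1r pnatr_eq0.
  move: (expR _) (q _) qt0 => w x x0 w0.
  by field; rewrite n0 x0 w0 n1'.
- apply: (time_deriv_ext (is_derive_time_deriv T%:E Df)) => //.
  rewrite /F /ode_field -/q.
  move: (expR _) (q _) (lt0r_neq0 qt) => w x x0.
  by field.
Qed.

(** * Ricci flow of the bundle metric *)

Lemma time_deriv_quadratic_form (R : realType) (T : \bar R) (k : nat)
    (X : R -> 'M[R]_k) (D : 'M[R]_k) (v : 'rV[R]_k) (t : R) :
  (forall a b, time_deriv T (fun s => X s a b) t (D a b)) ->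
  time_deriv T (fun s => (v *m X s *m v^T) 0 0) t ((v *m D *m v^T) 0 0).
Proof.
move=> H.
have E (N : 'M[R]_k) : \sum_b (v 0 b * \sum_a (v 0 a * N a b)) = (v *m N *m v^T) 0 0.
  rewrite [RHS]mxE; apply: eq_bigr => b _; rewrite [(v *m N) 0 b]mxE [(v^T) b 0]mxE.
  by rewrite mulrC.
apply: (time_deriv_ext (l := \sum_b (v 0 b * \sum_a (v 0 a * D a b)))
  (phi := fun s => \sum_b (v 0 b * \sum_a (v 0 a * X s a b)))) => //.
apply: time_deriv_sum => b; apply: time_derivZ.
by apply: time_deriv_sum => a; apply: time_derivZ; exact: H.
Qed.

Section BundleRicciFlow.
Variables (R : realType) (n : nat) (M E : topologicalType).
Variables (A : atlas R (n + n) M) (B : atlas R (n + n).+1 E).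
Variables (g0 omega : field2 A) (lam u0 C ell : R).
Variables (proj : E -> M) (act : R -> E -> E) (mu : field1 B).
Hypotheses (n_gt0 : (0 < n)%N) (M_nonempty : [set: M] !=set0).
Hypotheses (kahlerM : kahler_manifold g0 omega) (einsteinM : einstein g0 lam).
Hypothesis manifoldE : smooth_manifold B.
Hypothesis bundleE : principal_bundle A B ell proj act.
Hypothesis connection_mu : principal_connection act mu.
Hypothesis curvature_mu : has_curvature proj mu omega.
Variables (T : \bar R) (u f : R -> R).

Let h := bundle_metric proj mu (scale2 u0 g0) (fun=> C).
Let G t := bundle_metric proj mu (scale2 (u t) g0) (fun=> f t).

Let domM p : dom (chart_at A p) p.
Proof. by have [[[_ _ H _ _] _] _ _ _ _] := kahlerM. Qed.

Let domE e : dom (chart_at B e) e.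
Proof. by have [_ _ H _ _] := manifoldE. Qed.

Lemma ode_solution_ricci_flow : ode_solution n lam u0 C T u f -> ricci_flow T h G.
Proof.
move=> sol; have [u00 f00 _] := sol; split.
- move=> t Tt; apply: (riemannian_bundle_metric kahlerM manifoldE bundleE connection_mu).
  exact: (ode_u_gt0 sol Tt).
- by move=> i e _; rewrite /G /h u00 f00.
move=> t i e a b Tt ie; have ut := ode_u_gt0 sol Tt.
have je := domM (proj e); set j := chart_at A (proj e) in je.
pose X := (jac i j proj e *m g0 j (proj e) *m (jac i j proj e)^T) a b.
pose Y := (mu i e *m (mu i e)^T) a b.
have GE s : G s i e a b = X * u s + Y * expR (- 2 * f s).
  rewrite /G (bundle_metricE mu kahlerM manifoldE bundleE _ _ ie je) addmxE !scalemxE.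
  by rewrite mulNr [X * _]mulrC [Y * _]mulrC.
have Hf := time_deriv_expR (time_derivZ (c := - 2) (ode_f sol Tt)).
apply: (time_deriv_ext (time_derivD (time_derivZ (c := X) (ode_u sol Tt)) (time_derivZ (c := Y) Hf))).
  by move=> s; rewrite GE.
rewrite (ricci_bundle_metric kahlerM einsteinM manifoldE bundleE connection_mu curvature_mu _ ut ie je).
rewrite addmxE !scalemxE -/X -/Y natrD -[- (2 * f t)]mulNr.
have := lt0r_neq0 ut; move: (expR _) (u t) => w x x0.
by field.
Qed.

Lemma ricci_flow_ode_solution : (0 < T)%E -> ricci_flow T h G ->
  ode_solution n lam u0 C T u f.
Proof.
move=> T0 [Griem G0 Gt].
have T00 : before T 0 by split.
have [p _] := M_nonempty.
have [e ep] : exists e, proj e = p by exact: (proj_surjective bundleE).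
pose i := chart_at B e; pose j := chart_at A (proj e).
have ie : dom i e by exact: domE.
have je : dom j (proj e) by exact: domM.
have [xi [S [xmu xJ Smu SJ]]] := vertical_horizontal kahlerM manifoldE bundleE connection_mu ie je.
pose z : 'rV[R]_(n + n) := const_mx 1.
have z0 : z != 0.
  have n2 : (0 < n + n)%N by rewrite addn_gt0 n_gt0.
  apply/eqP => /matrixP/(_ 0 (Ordinal n2)); rewrite !mxE => /eqP.
  by rewrite oner_eq0.
have [_ [_ _ gpos] _ _ _] := kahlerM.
pose q := (z *m g0 j (proj e) *m z^T) 0 0.
have q0 : 0 < q by exact: gpos.
pose X := jac i j proj e *m g0 j (proj e) *m (jac i j proj e)^T.
pose Y := mu i e *m (mu i e)^T.
have vert c w : (xi *m (c *: X + w *: Y) *m xi^T) 0 0 = w.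
  by rewrite frame_quadratic_form xJ xmu !mul0mx !mxE eqxx expr1n mulr1 mulr0 add0r.
have hor c w : ((z *m S) *m (c *: X + w *: Y) *m (z *m S)^T) 0 0 = c * q.
  rewrite frame_quadratic_form -[_ *m S *m mu i e]mulmxA Smu.
  rewrite -[_ *m S *m jac i j proj e]mulmxA SJ mulmx0 mulmx1 [X in X ^+ 2]mxE.
  by rewrite expr0n mulr0 addr0.
have GE s : G s i e = u s *: X + expR (- (2 * f s)) *: Y.
  by rewrite /G (bundle_metricE mu kahlerM manifoldE bundleE _ _ ie je).
have zS0 : z *m S != 0.
  by apply: contra_neq z0 => zS; rewrite -[z]mulmx1 -SJ mulmxA zS mul0mx.
have ut t : before T t -> 0 < u t.
  move=> Tt; have [_ _ pos] := Griem t Tt.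
  by have := pos i e _ ie zS0; rewrite GE hor pmulr_lgt0.
have h0 : u 0 *: X + expR (- (2 * f 0)) *: Y = u0 *: X + expR (- (2 * C)) *: Y.
  by rewrite -GE (G0 i e ie) /h (bundle_metricE mu kahlerM manifoldE bundleE _ _ ie je).
have flow (v : 'rV[R]_((n + n).+1)) t : before T t -> time_deriv T (fun s => (v *m G s i e *m v^T) 0 0) t
    ((v *m (- 2 *: ricci (G t) i e) *m v^T) 0 0).
  move=> Tt; apply: time_deriv_quadratic_form => a b; rewrite scalemxE.
  exact: Gt.
have ricE t : 0 < u t -> let kap := expR (- (2 * f t)) / (2 * u t) in
    - 2 *: ricci (G t) i e = (- 2 * (lam - kap)) *: X + (- 2 * (kap ^+ 2 * (n + n)%:R)) *: Y.
  move=> ut0 kap; rewrite /G (ricci_bundle_metric kahlerM einsteinM manifoldE bundleE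
    connection_mu curvature_mu _ ut0 ie je) scalerDr !scalerA.
  by [].
split.
- apply: (mulIf (lt0r_neq0 q0)).
  by rewrite -(hor _ (expR (- (2 * f 0)))) h0 hor.
- have := vert (u 0) (expR (- (2 * f 0))); rewrite h0 vert => /expR_inj/oppr_inj.
  by move=> /(mulfI _) ->//; rewrite pnatr_eq0.
move=> t Tt; have u_gt0 := ut t Tt; have u_neq0 := lt0r_neq0 u_gt0; split => //.
- suff : time_deriv T (fun s => q^-1 * (u s * q)) t
      (- 2 * lam + expR (- 2 * f t) / u t).
    by move=> H; apply: (time_deriv_ext H) => // s; rewrite mulrC mulfK// lt0r_neq0.
  have H := time_derivZ (c := q^-1) (flow (z *m S) t Tt); rewrite ricE// hor in H.
  apply: (time_deriv_ext H) => [s|]; first by rewrite GE hor.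
  rewrite [- 2 * f t]mulNr; move: (expR _) (u t) u_neq0 => w x x0.
  by field; rewrite x0 lt0r_neq0.
- have w0 s := expR_gt0 (- (2 * f s)).
  have H := flow xi t Tt; rewrite ricE// vert in H.
  have H' := time_deriv_ln (T := T) (phi := fun s => expR (- (2 * f s))) (w0 t).
  have {}H : time_deriv T (fun s => expR (- (2 * f s))) t
      (- 2 * ((expR (- (2 * f t)) / (2 * u t)) ^+ 2 * (n + n)%:R)).
    by apply: (time_deriv_ext H) => // s; rewrite GE vert.
  apply: (time_deriv_ext (time_derivZ (c := - 2^-1) (H' _ H))) => [s|].
    by rewrite expRK mulrNN mulKf// pnatr_eq0.
  have := lt0r_neq0 (w0 t); rewrite [- 2 * f t]mulNr natrD.
  move: (expR _) (u t) u_neq0 => w x x0 w_neq0.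
  by field; rewrite x0 w_neq0.
Qed.

End BundleRicciFlow.

Theorem theorem5p1 (R : realType) (n : nat) (M E : topologicalType)
    (A : atlas R (n + n) M) (B : atlas R (n + n).+1 E)
    (g0 omega : field2 A) (lam u0 C ell : R)
    (proj : E -> M) (act : R -> E -> E) (mu : field1 B)
    (n_gt0 : (0 < n)%N) (M_nonempty : [set: M] !=set0)
    (kahlerM : kahler_manifold g0 omega) (einsteinM : einstein g0 lam)
    (u0_gt0 : 0 < u0) (ell_ge0 : 0 <= ell)
    (manifoldE : smooth_manifold B)
    (bundleE : principal_bundle A B ell proj act)
    (connection_mu : principal_connection act mu)
    (curvature_mu : has_curvature proj mu omega) :
  (exists (T : \bar R) (u f : R -> R),
     (0 < T)%E /\ ode_solution n lam u0 C T u f) /\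
  (forall (T : \bar R) (u f u' f' : R -> R),
     (0 < T)%E -> ode_solution n lam u0 C T u f ->
     ode_solution n lam u0 C T u' f' ->
     forall t, before T t -> u t = u' t /\ f t = f' t) /\
  (forall (T : \bar R) (u f : R -> R), (0 < T)%E ->
     ricci_flow T (bundle_metric proj mu (scale2 u0 g0) (fun _ => C))
       (fun t => bundle_metric proj mu (scale2 (u t) g0) (fun _ => f t))
     <-> ode_solution n lam u0 C T u f) /\
  (forall (T : \bar R) (u f : R -> R), (0 < T)%E ->
     ode_solution n lam u0 C T u f ->
     (lam = 0 -> forall t, before T t ->
        u t = expR (- 2 * C / n.+2%:R) * u0 `^ (n%:R / n.+2%:R)
              * (n.+2%:R * t + expR (2 * C) * u0 ^+ 2) `^ (n.+2%:R^-1) /\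
        f t = n%:R / (2 * n.+2%:R)
                * ln (n.+2%:R * t + expR (2 * C) * u0 ^+ 2)
              + 2 * C / n.+2%:R - n%:R / n.+2%:R * ln u0) /\
     (lam <> 0 -> forall (z : int) t, before T t ->
        Psi n lam z u f t = Psi n lam z u f 0)).
Proof.
split; first exact: (ode_solution_exists lam C n_gt0 u0_gt0).
split.
  move=> T u f u' f' _ sol sol' t.
  exact: (ode_solution_unique n_gt0 sol sol').
split.
  move=> T u f T0; split.
    exact: (ricci_flow_ode_solution n_gt0 M_nonempty kahlerM einsteinM manifoldE bundleE
      connection_mu curvature_mu T0).
  exact: (ode_solution_ricci_flow kahlerM einsteinM manifoldE bundleE connection_mu curvature_mu).
move=> T u f T0 sol; split.
  exact: (ode_lam0_explicit n_gt0 u0_gt0 sol).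
move=> /eqP lam0 z t Tt.
have T00 : before T 0 by split.
by rewrite (ode_psi n_gt0 sol z Tt lam0) (ode_psi n_gt0 sol z T00 lam0).
Qed.
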